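(* Let $A$ be an associative algebra over $\mathbb{F}$. The normalized Hochschild cochain complex $C^*(A,A)$ is equipped with the structure of an algebra over the dg-operad $F_2\mathcal{E}$ (the second filtration term of the Barratt-Eccles operad) such that: (a) the cup-product of Hochschild cochains $x_1\cup x_2:C^*(A,A)\otimes C^*(A,A)\to C^*(A,A)$ is the operation associated to the element $(\mathrm{id})\in\mathcal{E}(2)_0$; (b) for each $r$, the Getzler-Kadeishvili bracket (brace operation) $x_1\{x_2,\ldots,x_r\}:C^*(A,A)^{\otimes r}\to C^*(A,A)$ is the operation associated to the element $w=(w_0,\ldots,w_{r-1})\in\mathcal{E}(r)_{r-1}$ such that $$w_0=(1,2,3,4,\ldots,r-1,r),\quad w_1=(2,1,3,4,\ldots,r-1,r),\quad w_2=(2,3,1,4,\ldots,r-1,r),\quad\ldots,\quad w_{r-1}=(2,3,4,\ldots,r-1,r,1).$$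
   Context: $\mathbb{F}$ is a fixed commutative ground ring. $C^*(A,A)$ is the normalized Hochschild cochain complex: $C^n(A,A)$ consists of the multilinear maps $A^{\otimes n}\to A$ vanishing when one argument is the unit, with the Hochschild differential. The cup-product is $(f\cup g)(a_1,\ldots,a_{p+q})=\pm f(a_1,\ldots,a_p)g(a_{p+1},\ldots,a_{p+q})$, and the brace $f\{g_1,\ldots,g_m\}$ is the signed sum of all multilinear maps obtained by inserting $g_1,\ldots,g_m$, in this order, into $m$ distinct inputs of $f$ (signs as in the usual conventions of Getzler and Kadeishvili). The Barratt-Eccles operad $\mathcal{E}$: $\mathcal{E}(r)_d$ is the $\mathbb{F}$-module generated by $(d+1)$-tuples $(w_0,\ldots,w_d)$ of elements of the symmetric group $\Sigma_r$, modulo the tuples with $w_i=w_{i+1}$ for some $i$; differential $\delta(w_0,\ldots,w_d)=\sum_{i}(-1)^i(w_0,\ldots,\widehat{w_i},\ldots,w_d)$; diagonal $\Sigma_r$-action. A permutation $\sigma$ is written as the sequence $(\sigma(1),\ldots,\sigma(r))$. For $u\in\Sigma_r$, $v\in\Sigma_s$, the permutation $u\circ_k v\in\Sigma_{r+s-1}$ is obtained from $(u(1),\ldots,u(r))$ by replacing the entry $k$ by $(v(1)+k-1,\ldots,v(s)+k-1)$ and increasing by $s-1$ the entries $u(i)>k$. For $u\in\mathcal{E}(r)_d$, $v\in\mathcal{E}(s)_e$, $u\circ_k v=\sum\pm(u_{x_0}\circ_k v_{y_0},\ldots,u_{x_{d+e}}\circ_k v_{y_{d+e}})$, the sum being over lattice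 paths from $(0,0)$ to $(d,e)$ with unit steps increasing $x$ or $y$; the sign is the signature of the shuffle moving all horizontal ($x$-)steps before all vertical ($y$-)steps. Filtration: for $i<j$ and $w\in\Sigma_r$, let $w_{ij}\in\Sigma_{\{i,j\}}$ be the permutation of $(i,j)$ given by the order in which $i,j$ occur in $(w(1),\ldots,w(r))$. A tuple $(w_0,\ldots,w_d)$ belongs to $F_n\mathcal{E}(r)_d$ if and only if, for all $i<j$, the sequence $((w_0)_{ij},\ldots,(w_d)_{ij})$ has no more than $n-1$ variations (indices at which consecutive terms differ). $F_n\mathcal{E}(r)$ is the $\mathbb{F}$-submodule spanned by these tuples; it is a suboperad of $\mathcal{E}$. *)

(* Defs.v *)
(* The classical layer (boolp, functions) is used only to make the Hochschild
   cochains, which are functions, into an lmodType. *)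
From HB Require Import structures.
From mathcomp Require Import all_boot all_order all_algebra all_fingroup.
From mathcomp Require Import zify boolp functions.

Set Implicit Arguments.
Unset Strict Implicit.
Unset Printing Implicit Defensive.

Import GRing.Theory.

Local Open Scope ring_scope.

(* A permutation [w : 'S_r] stands for the sequence of its values; labels and
   positions are numbered from 0, so the identity is the word 0, 1, ..., r-1. *)

Section Words.

Definition word r (w : 'S_r) : seq 'I_r := [seq w i | i <- enum 'I_r].

(* Numbering from 0, the label k is replaced by v(0) + k, ..., v(s-1) + k and
   the labels l > k are increased by s - 1 (decreased by 1 when s = 0). *)
Definition subst_word r s (k : 'I_r) (u : 'S_r) (v : 'S_s) : seq nat :=
  flatten [seq if l == k then [seq (k + m)%N | m : 'I_s <- word v]
               else [:: if (k < l)%N then (l + s).-1 else (l : nat)]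
          | l <- word u].

(* The default value [1] is never used: see [word_perm_comp]. *)
Definition perm_comp r s (k : 'I_r) (u : 'S_r) (v : 'S_s) : 'S_((r + s).-1) :=
  odflt 1%g [pick w : 'S_((r + s).-1) |
               [seq val l | l <- word w] == subst_word k u v].

Lemma perm_eq_word r (w : 'S_r) : perm_eq (word w) (enum 'I_r).
Proof.
apply: uniq_perm; first by rewrite map_inj_uniq ?enum_uniq //; apply: perm_inj.
  exact: enum_uniq.
move=> i; rewrite mem_enum; apply/mapP; exists ((w^-1)%g i); rewrite ?mem_enum //.
by rewrite permKV.
Qed.

Lemma perm_eq_subst_word r s (k : 'I_r) (u : 'S_r) (v : 'S_s) :
  perm_eq (subst_word k u v) (iota 0 (r + s).-1).
Proof.
pose F n := if n == k :> nat then iota k s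
            else [:: if (k < n)%N then (n + s).-1 else n].
apply: (@perm_trans _ (flatten [seq F (val l) | l <- word u])).
  rewrite /subst_word; elim: (word u) => //= l w IHw; apply: perm_cat => //.
  rewrite /F -val_eqE; case: eqP => // _.
  have ->: iota k s = [seq (k + val m)%N | m <- enum 'I_s].
    by rewrite (map_comp (addn k)) val_enum_ord -iotaDl addn0.
  by apply: perm_map; apply: perm_eq_word.
apply: perm_trans (perm_flatten (perm_map _ (perm_eq_word u))) _.
rewrite (map_comp F) val_enum_ord.
have kr := ltn_ord k.
have -> : iota 0 r = iota 0 k ++ (k : nat) :: iota k.+1 (r - k.+1).
  by rewrite -[_ :: _]/(iota (0 + k) (r - k.+1).+1) -iotaD; congr iota; lia.
rewrite map_cat flatten_cat /= {2}/F eqxx.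
have -> : flatten [seq F i | i <- iota 0 k] = iota 0 k.
  rewrite -[RHS]flatten_seq1; congr flatten; apply/eq_in_map => i.
  by rewrite mem_iota /F => ?; rewrite ifF ?ifF //; lia.
have -> : flatten [seq F i | i <- iota k.+1 (r - k.+1)] = iota (k + s) (r - k.+1).
  have -> : iota (k + s) (r - k.+1) = [seq (n + s).-1 | n <- iota k.+1 (r - k.+1)].
    have E a n : iota a n = [seq (a + i)%N | i <- iota 0 n].
      by rewrite -iotaDl addn0.
    rewrite (E (k + s)%N) (E k.+1) -map_comp.
    by apply: eq_map => n /=; lia.
  rewrite -[RHS]flatten_seq1 -map_comp; congr flatten; apply/eq_in_map => i.
  by rewrite mem_iota /F /= => ?; rewrite ifF ?ifT //; lia.
rewrite -iotaD -{2}[(k : nat)]add0n -iotaD (_ : (k + _ = (r + s).-1)%N) //; lia.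
Qed.

Lemma word_perm_comp r s (k : 'I_r) (u : 'S_r) (v : 'S_s) :
  [seq val l | l <- word (perm_comp k u v)] = subst_word k u v.
Proof.
rewrite /perm_comp; case: pickP => [w /eqP //|no_w].
have eq_t := perm_eq_subst_word k u v; set t := subst_word k u v in eq_t no_w *.
have size_t : size t = (r + s).-1 by rewrite (perm_size eq_t) size_iota.
have ltt (i : 'I_(r + s).-1) : (nth 0 t i < (r + s).-1)%N.
  have := mem_nth 0 (_ : i < size t)%N; rewrite size_t => /(_ (ltn_ord i)).
  by rewrite (perm_mem eq_t) mem_iota.
have inj_t : injective (fun i => Ordinal (ltt i)).
  move=> i j [] /eqP; rewrite nth_uniq ?size_t // ?(perm_uniq eq_t) ?iota_uniq //.
  by move/eqP/val_inj.
have /eqP[] := no_w (perm inj_t).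
rewrite -map_comp (eq_map (_ : _ =1 nth 0 t \o val)).
  by rewrite (map_comp (nth 0 t)) val_enum_ord -/(mkseq _ _) -size_t mkseq_nth.
by move=> i /=; rewrite permE.
Qed.

End Words.

Section BarrattEccles.

Variable R : comPzRingType.

Definition simplex r d := {w : (d.+1).-tuple 'S_r | sorted [rel u v | u != v] w}.

(* The free module on the tuples (w_0, ..., w_d) modulo those with some
   w_i = w_{i+1} is the free module on the remaining tuples. *)
Definition BE r d := {ffun simplex r d -> R^o}.

(* The class of a tuple: it is 0 when the tuple is degenerate. *)
Definition BE_gen r d (w : (d.+1).-tuple 'S_r) : BE r d :=
  [ffun t => (val t == w)%:R].

Definition BE_face r d (i : 'I_d.+2) (w : (d.+2).-tuple 'S_r) :
    (d.+1).-tuple 'S_r := [tuple tnth w (lift i j) | j < d.+1].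

Definition BE_diff r d : BE r d -> BE r d.-1 :=
  match d return BE r d -> BE r d.-1 with
  | 0 => fun _ => 0
  | d'.+1 => fun u => \sum_(t : simplex r d'.+1)
      u t *: \sum_(i < d'.+2) (-1) ^+ i *: BE_gen (BE_face i (val t))
  end.

(* In MathComp [(w * s) i = s (w i)]: the word of [w * s] is
   s(w(1)), ..., s(w(r)), so this is the left action s . w = s o w. *)
Definition BE_act r d (s : 'S_r) (u : BE r d) : BE r d :=
  \sum_(t : simplex r d) u t *: BE_gen [tuple of [seq (w * s)%g | w <- val t]].

Definition BE_unit : BE 1 0 := BE_gen [tuple (1%g : 'S_1)].

(* A lattice path from (0,0) to (d,e) is given by the set [S], of cardinal d,
   of the indices of its horizontal steps; its t-th vertex is
   ([path_x S t], [path_y S t]). *)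
Definition path_x n (S : {set 'I_n}) (t : nat) : nat :=
  #|[set i in S | (i < t)%N]|.

Definition path_y n (S : {set 'I_n}) (t : nat) : nat :=
  #|[set i in ~: S | (i < t)%N]|.

(* The number of inversions of the shuffle moving the horizontal steps before
   the vertical ones. *)
Definition path_inv n (S : {set 'I_n}) : nat :=
  #|[set p : 'I_n * 'I_n | [&& (p.1 < p.2)%N, p.1 \notin S & p.2 \in S]]|.

Definition BE_gen_comp r s d e (k : 'I_r)
    (a : (d.+1).-tuple 'S_r) (b : (e.+1).-tuple 'S_s) : BE (r + s).-1 (d + e) :=
  \sum_(S : {set 'I_(d + e)} | #|S| == d) (-1) ^+ path_inv S *:
    BE_gen [tuple perm_comp k (tnth a (inord (path_x S t)))
                              (tnth b (inord (path_y S t))) | t < (d + e).+1].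

Definition BE_comp r s d e (k : 'I_r) (u : BE r d) (v : BE s e) :
    BE (r + s).-1 (d + e) :=
  \sum_(a : simplex r d) \sum_(b : simplex s e)
    (u a * v b) *: BE_gen_comp k (val a) (val b).

(* The permutation w_{ij}, written as a word in the letters i and j. *)
Definition restr_word r (i j : 'I_r) (w : 'S_r) : seq 'I_r :=
  [seq l <- word w | (l == i) || (l == j)].

Definition variations (T : eqType) (s : seq T) : nat :=
  count (fun p => p.1 != p.2) (zip s (behead s)).

Definition in_filtration n r d (w : (d.+1).-tuple 'S_r) : bool :=
  [forall i : 'I_r, forall j : 'I_r, (i < j)%N ==>
     (variations [seq restr_word i j u | u <- w] <= n.-1)%N].

Definition BE_filtration n r d (u : BE r d) : Prop :=
  forall t : simplex r d, u t != 0 -> in_filtration n (val t).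

End BarrattEccles.

Arguments BE_gen R {r d} w.
Arguments BE_unit R : clear implicits.

(* Algebras over F_n E: a dg-module is given by a module [V], the predicates [deg z] singling out
   its homogeneous elements of upper degree z (lower degree -z), and a
   differential [dif] raising the upper degree by one.  An element of
   E(r)_d has lower degree d. *)

Section Algebra.

Variables (R : comPzRingType) (V : lmodType R).
Variables (deg : int -> V -> Prop) (dif : V -> V).

Definition set_tnth r (x : r.-tuple V) (i : 'I_r) (y : V) : r.-tuple V :=
  [tuple if j == i then y else tnth x j | j < r].

Definition homogeneous r (n : r.-tuple int) (x : r.-tuple V) : Prop :=
  forall i, deg (tnth n i) (tnth x i).

(* The sum of the degrees of the first k entries, up to parity. *)
Definition deg_before r (n : r.-tuple int) (k : nat) : nat :=
  (\sum_(i < r | i < k) `|tnth n i|)%N.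

(* The exponent of the Koszul sign of the permutation
   x_1, ..., x_r |-> x_{s(1)}, ..., x_{s(r)}. *)
Definition koszul_exp r (n : r.-tuple int) (s : 'S_r) : nat :=
  (\sum_(p : 'I_r * 'I_r | (p.1 < p.2) && (s p.2 < s p.1))
     `|tnth n (s p.1)| * `|tnth n (s p.2)|)%N.

(* The operation attached to an element of E(r)_d outside F_n E(r)_d is
   arbitrary: it is constrained by none of the axioms. *)
Record filtered_BE_algebra (n : nat) := FilteredBEAlgebra {
  operation :> forall r d, BE R r d -> r.-tuple V -> V;
  operation_linear : forall r d (c : R) (u v : BE R r d) (x : r.-tuple V),
    BE_filtration n u -> BE_filtration n v ->
    operation (c *: u + v) x = c *: operation u x + operation v x;
  operation_multilinear : forall r d (u : BE R r d) (x : r.-tuple V)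
      (i : 'I_r) (c : R) (y z : V),
    BE_filtration n u ->
    operation u (set_tnth x i (c *: y + z)) =
    c *: operation u (set_tnth x i y) + operation u (set_tnth x i z);
  operation_degree : forall r d (u : BE R r d) (m : r.-tuple int)
      (x : r.-tuple V),
    BE_filtration n u -> homogeneous m x ->
    deg (\sum_(i < r) tnth m i - d%:Z) (operation u x);
  operation_diff : forall r d (u : BE R r d) (m : r.-tuple int)
      (x : r.-tuple V),
    BE_filtration n u -> homogeneous m x ->
    dif (operation u x) =
    operation (BE_diff u) x +
    (-1) ^+ d *: \sum_(i < r) (-1) ^+ deg_before m i *:
                   operation u (set_tnth x i (dif (tnth x i)));
  operation_act : forall r d (u : BE R r d) (s : 'S_r) (m : r.-tuple int)
      (x : r.-tuple V),
    BE_filtration n u -> homogeneous m x ->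
    operation (BE_act s u) x =
    (-1) ^+ koszul_exp m s *: operation u [tuple tnth x (s i) | i < r];
  operation_unit : forall x : 1.-tuple V,
    operation (BE_unit R) x = tnth x ord0;
  operation_comp : forall r s d e (k : 'I_r) (u : BE R r d) (v : BE R s e)
      (m : (r + s).-1.-tuple int) (x : (r + s).-1.-tuple V),
    BE_filtration n u -> BE_filtration n v -> homogeneous m x ->
    operation (BE_comp k u v) x =
    (-1) ^+ (e * deg_before m k) *:
      operation u [tuple
        if (i < k)%N then x`_i
        else if i == k then operation v [tuple x`_(k + j) | j < s]
        else x`_(i + s).-1 | i < r] }.

End Algebra.

Section Hochschild.

Variables (R : comPzRingType) (A : algType R).

(* An element of the direct sum of the C^n(A,A) is a function f on finite
   sequences of elements of A: its component in C^n(A,A) is the restriction of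
   f to the sequences of length n. *)
Definition normalized_cochain (f : seq A -> A) : Prop :=
  [/\ forall s1 s2 (c : R) (y z : A),
        f (s1 ++ (c *: y + z) :: s2) =
        c *: f (s1 ++ y :: s2) + f (s1 ++ z :: s2),
      forall s1 s2, f (s1 ++ 1 :: s2) = 0
    & exists N, forall s, (N <= size s)%N -> f s = 0].

Definition cochain_pred : {pred (seq A -> A)} :=
  fun f => `[< normalized_cochain f >].

Fact cochain_pred_submod_closed : submod_closed cochain_pred.
Proof.
split=> [|a f g /asboolP[linf norf [N bf]] /asboolP[ling norg [M bg]]].
  have E s : (0 : seq A -> A) s = 0 by [].
  by apply/asboolP; split=> [s1 s2 c y z|//|]; [rewrite !E scaler0 addr0 | exists 0].
apply/asboolP; split=> [s1 s2 c y z|s1 s2|].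
- rewrite !fctE linf ling !scalerDr !scalerA mulrC !addrA; congr (_ + _).
  by rewrite -!addrA; congr (_ + _); rewrite addrC.
- by rewrite !fctE norf norg scaler0 addr0.
- exists (maxn N M) => s; rewrite geq_max => /andP[Ns Ms].
  by rewrite !fctE bf ?bg // scaler0 addr0.
Qed.

HB.instance Definition _ :=
  GRing.isSubmodClosed.Build R (seq A -> A) cochain_pred
    cochain_pred_submod_closed.

Record cochains := Cochains {
  cochain_fun :> seq A -> A;
  cochain_funP : cochain_fun \in cochain_pred }.

HB.instance Definition _ := [isSub for cochain_fun].
HB.instance Definition _ := [Choice of cochains by <:].
HB.instance Definition _ := [SubChoice_isSubLmodule of cochains by <:].

(* C^n(A,A), which is 0 for n < 0. *)
Definition cochain_deg (n : int) (f : cochains) : Prop :=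
  forall s, (size s)%:Z != n -> f s = 0.

(* a_0, ..., a_i a_{i+1}, ..., a_n *)
Fixpoint mul_at (i : nat) (s : seq A) : seq A :=
  match i, s with
  | 0, a :: b :: s' => a * b :: s'
  | i'.+1, a :: s' => a :: mul_at i' s'
  | _, _ => s
  end.

(* With m the multiplication of A, this is Getzler's differential [m, f] =
   m{f} - (-1)^(n-1) f{m} of f in C^n(A,A), that is (-1)^(n+1) times
   a_1 f(a_2, ...) + sum_i (-1)^i f(..., a_i a_{i+1}, ...)
   + (-1)^(n+1) f(a_1, ..., a_n) a_{n+1}. *)
Definition hochschild_fun (f : seq A -> A) (s : seq A) : A :=
  if s is a :: s' then
    (-1) ^+ size s *:
      (a * f s' + \sum_(i < size s') (-1) ^+ i.+1 *: f (mul_at i s)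
       + (-1) ^+ size s *: (f (belast a s') * last a s'))
  else 0.

Lemma mul_at_linear f p s1 s2 i (c : R) (y z : A) : normalized_cochain f ->
  (i.+1 < size s1 + (size s2).+1)%N ->
  f (p ++ mul_at i (s1 ++ (c *: y + z) :: s2)) =
  c *: f (p ++ mul_at i (s1 ++ y :: s2)) + f (p ++ mul_at i (s1 ++ z :: s2)).
Proof.
move=> [lin _ _]; elim: s1 p i => [|a s1 IHs] p [|i] /=.
- by case: s2 => //= b s2 _; rewrite mulrDl -scalerAl lin.
- by move=> _; rewrite lin.
- case: s1 {IHs} => [|b s1] /= _; first by rewrite mulrDr -scalerAr lin.
  by rewrite -!(cat_rcons _ p) !catA lin.
- by move=> lt_i; rewrite -!(cat_rcons a p) IHs.
Qed.

Lemma mul_at_unit f p s1 s2 i : normalized_cochain f ->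
  (i.+1 < size s1 + (size s2).+1)%N ->
  f (p ++ mul_at i (s1 ++ 1 :: s2)) =
  f (p ++ s1 ++ s2) *+ ((i == size s1) + (i.+1 == size s1)).
Proof.
move=> [_ nor _]; elim: s1 p i => [|a s1 IHs] p [|i] /=.
- by case: s2 => //= b s2 _; rewrite mul1r.
- by move=> _; rewrite nor.
- case: s1 {IHs} => [|b s1] /= _; first by rewrite mulr1.
  by rewrite -!(cat_rcons _ p) !catA nor.
- by move=> lt_i; rewrite -!(cat_rcons a p) IHs // !eqSS.
Qed.

Lemma size_mul_at i s : ((size s).-1 <= size (mul_at i s))%N.
Proof.
elim: s i => [|a s IHs] [|i] //=; first by case: s {IHs}.
by have := IHs i; case: (size s).
Qed.

Lemma sum_mulr_eq (V : nmodType) (F : nat -> V) n k :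
  \sum_(i < n) F i *+ (val i == k) = F k *+ (k < n)%N.
Proof.
case: ltnP => [lt_k|le_n].
  rewrite (bigD1 (Ordinal lt_k)) //= eqxx big1 ?addr0 // => i.
  by rewrite -val_eqE /= => /negPf->.
rewrite big1 // => i _; rewrite (_ : (val i == k) = false) //; apply/negbTE.
by rewrite neq_ltn (leq_trans (ltn_ord i)).
Qed.

Lemma hochschild_funE f s1 x s2 N : N = (size s1 + size s2).+1 ->
  hochschild_fun f (s1 ++ x :: s2) =
  (-1) ^+ N *:
    ((if s1 is a :: s1' then a * f (s1' ++ x :: s2) else x * f s2) +
     \sum_(i < N.-1) (-1) ^+ i.+1 *: f (mul_at i (s1 ++ x :: s2)) +
     (-1) ^+ N *: (if size s2 is n.+1 then f (s1 ++ x :: take n s2) * last x s2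
                   else f s1 * x)).
Proof.
have L : forall a s', a :: s' = s1 ++ x :: s2 ->
    f (belast a s') * last a s' =
    if size s2 is n.+1 then f (s1 ++ x :: take n s2) * last x s2
    else f s1 * x.
  move=> a s' Es; case/lastP: s2 Es => [|s2 z] Es.
    by move: Es; rewrite cats1 lastI => /rcons_inj[-> ->].
  move: Es; rewrite -rcons_cons -rcons_cat lastI => /rcons_inj[-> ->].
  by rewrite size_rcons last_rcons -cats1 take_size_cat.
move=> EN; have S : size (s1 ++ x :: s2) = N by rewrite EN size_cat /= addnS.
rewrite /hochschild_fun; case Es: (s1 ++ x :: s2) => [|a s'].
  by move: S; rewrite Es EN.
rewrite (L _ _ (esym Es)) -Es S.
have -> : size s' = N.-1 by rewrite -S Es.
by case: s1 Es {EN L S} => [|b s1] /= [<- <-].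
Qed.

Fact hochschild_fun_subproof (f : cochains) : hochschild_fun f \in cochain_pred.
Proof.
have zCA (a b : R) (x : A) : a *: (b *: x) = b *: (a *: x).
  by rewrite !scalerA mulrC.
have /asboolP nf := cochain_funP f; have [lin nor [M bf]] := nf.
apply/asboolP; split=> [s1 s2 c y z|s1 s2|].
- rewrite !(hochschild_funE _ _ erefl) zCA -scalerDr; congr (_ *: _).
  rewrite !scalerDr addrACA; congr (_ + _); last first.
    rewrite zCA -scalerDr; congr (_ *: _).
    by case: (s2) => [|a s] /=; rewrite ?mulrDr ?lin ?mulrDl -?scalerAl -?scalerAr.
  rewrite addrACA; congr (_ + _).
    by case: (s1) => [|a s]; rewrite ?lin ?mulrDr ?mulrDl -?scalerAl -?scalerAr.
  rewrite scaler_sumr -big_split /=; apply: eq_bigr => i _.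
  have := mul_at_linear [::] c y z nf (_ : i.+1 < size s1 + (size s2).+1)%N.
  by rewrite addnS ltnS => ->; rewrite ?ltn_ord // scalerDr zCA.
- set v := f (s1 ++ s2); rewrite (hochschild_funE _ _ erefl).
  set k := size s1; set n := (k + size s2)%N.
  have -> : (if s1 is a :: s1' then a * f (s1' ++ 1 :: s2) else 1 * f s2) =
            v *+ (k == 0)%N.
    by rewrite /v /k; case: (s1) => [|a s]; rewrite ?mul1r // nor mulr0.
  have -> : (if size s2 is n.+1 then f (s1 ++ 1 :: take n s2) * last 1 s2
             else f s1 * 1) = v *+ (k == n)%N.
    rewrite /v /n; case: (s2) => [|a s] /=; first by rewrite addn0 eqxx mulr1 cats0.
    rewrite nor mul0r (_ : (k == _) = false) //; apply/negbTE.
    by rewrite neq_ltn -addSnnS leq_addr.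
  have -> : \sum_(i < n) (-1) ^+ i.+1 *: f (mul_at i (s1 ++ 1 :: s2)) =
            (-1) ^+ k.+1 *: v *+ (k < n)%N + (-1) ^+ k *: v *+ (0 < k)%N.
    transitivity (\sum_(i < n) (((-1) ^+ i.+1 *: v) *+ (val i == k)
                                + ((-1) ^+ i.+1 *: v) *+ (i.+1 == k))).
      apply: eq_bigr => i _.
      have := mul_at_unit [::] nf (_ : i.+1 < size s1 + (size s2).+1)%N.
      by rewrite addnS ltnS => ->; rewrite ?ltn_ord // -scalerMnr mulrnDr.
    rewrite big_split (sum_mulr_eq (fun i => (-1) ^+ i.+1 *: v)); congr (_ + _).
    case: k @n => [|k] n; first by rewrite big1 // => i _; rewrite mulr0n.
    under eq_bigr do rewrite eqSS.
    by rewrite (sum_mulr_eq (fun i => (-1) ^+ i.+1 *: v)) /n addSn ltnS leq_addr.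
  have : (k <= n)%N by rewrite leq_addr.
  clearbody n k v; rewrite /= => le_kn.
  rewrite [X in _ *: X](_ : _ = 0) ?scaler0 // lt0n ltn_neqAle le_kn andbT.
  rewrite exprS mulN1r scaleNr.
  case: (eqVneq k n) le_kn => [<- _|_ _]; case: (eqVneq k 0) => [->|_] /=.
  - by rewrite expr0 expr1 !scaleN1r scale1r !mulr0n !mulr1n !addr0 subrr.
  - by rewrite exprS mulN1r scaleNr !mulr0n !mulr1n !add0r subrr.
  - by rewrite expr0 scale1r !mulr0n !mulr1n scaler0 !addr0 subrr.
  - by rewrite !mulr0n !mulr1n scaler0 add0r addr0 addNr.
- exists M.+1 => -[|a s] //= le_M.
  rewrite bf // mulr0 add0r bf ?size_belast // mul0r scaler0 addr0.
  rewrite big1 ?scaler0 // => i _; rewrite bf ?scaler0 //.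
  by rewrite (leq_trans _ (size_mul_at _ _)).
Qed.

Definition hochschild_diff (f : cochains) : cochains :=
  Cochains (hochschild_fun_subproof f).

(* The sign is the Koszul sign of g passing a_1, ..., a_p. *)
Definition cup (p q : nat) (f g : seq A -> A) (s : seq A) : A :=
  if size s == (p + q)%N
  then (-1) ^+ (p * q) *: (f (take p s) * g (drop p s)) else 0.

(* An insertion of g_1, ..., g_m, in this order, into m distinct inputs of f
   is a strictly increasing map [h : 'I_m -> 'I_n], g_j being inserted into
   the input [h j] of f; n and [l j] are the arities of f and of g_j. *)

Definition increasing m n (h : {ffun 'I_m -> 'I_n}) : bool :=
  [forall i : 'I_m, forall j : 'I_m, (i < j)%N ==> (h i < h j)%N].

Section Brace.

Variables (m n : nat) (l : 'I_m -> nat).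

Section Insertion.

Variable h : {ffun 'I_m -> 'I_n}.

Definition inserted_at (i : 'I_n) : option 'I_m := [pick j | h j == i].

(* The number of arguments consumed by each input of f. *)
Definition input_sizes : seq nat :=
  [seq oapp l 1%N (inserted_at i) | i <- enum 'I_n].

Definition insertion (f : seq A -> A) (g : 'I_m -> seq A -> A) (s : seq A) : A :=
  if size s == sumn input_sizes then
    f [seq let b := nth [::] (reshape input_sizes s) i in
           if inserted_at i is Some j then g j b else head 0 b
      | i : 'I_n <- enum 'I_n]
  else 0.

(* Getzler's sign: g_j, of degree l_j - 1, passes the arguments in front of
   it.  Here -1 is written +1 in order to stay in nat. *)
Definition getzler_exp : nat :=
  (\sum_(j < m) (l j).+1 * sumn (take (h j) input_sizes))%N.

End Insertion.

(* Getzler's signs turn the brace into an operation of degree 0 on the cochains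
   graded by arity minus 1; seen on C^*(A,A) it has degree m, and picks up the
   sign of the (de)suspensions passing f, g_1, ..., g_m. *)
Definition suspension_exp : nat :=
  (m * n + \sum_(j < m) (m - j.+1) * l j)%N.

Definition brace (f : seq A -> A) (g : 'I_m -> seq A -> A) (s : seq A) : A :=
  (-1) ^+ suspension_exp *:
    \sum_(h : {ffun 'I_m -> 'I_n} | increasing h)
      (-1) ^+ getzler_exp h *: insertion h f g s.

End Brace.

End Hochschild.

(* The tuple (w_0, ..., w_r) of permutations of r+1 letters: the word of w_i is
   1, ..., i, 0, i+1, ..., r (see [word_brace_simplex]). *)
Definition brace_simplex r : (r.+1).-tuple 'S_r.+1 :=
  [tuple lift_perm i ord0 1%g | i < r.+1].

Lemma word_brace_simplex r (i : 'I_r.+1) :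
  [seq val l | l <- word (tnth (brace_simplex r) i)] =
  iota 1 i ++ 0%N :: iota i.+1 (r - i).
Proof.
have ltri : (i <= r)%N by rewrite -ltnS.
pose F j := if j == i :> nat then 0%N else if (j < i)%N then j.+1 else j.
rewrite tnth_mktuple /word -map_comp.
transitivity [seq F j | j <- [seq val j | j <- enum 'I_r.+1]].
  rewrite -map_comp; apply: eq_map => j /=; rewrite /F val_eqE.
  case: (unliftP i j) => [j' ->|->]; last by rewrite lift_perm_id eqxx.
  rewrite lift_perm_lift perm1 eq_sym (negPf (neq_lift _ _)) /= /bump leq0n.
  case: (leqP i j') => ij' /=; rewrite ?add1n ?add0n ?ij' // ifF //.
  by apply/negbTE; rewrite -leqNgt leqW.
rewrite val_enum_ord.
have -> : iota 0 r.+1 = iota 0 i ++ (i : nat) :: iota i.+1 (r - i).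
  by rewrite -[_ :: _]/(iota (0 + i) (r - i).+1) -iotaD addnS subnKC.
rewrite map_cat /= {2}/F eqxx; congr (_ ++ _ :: _).
  rewrite [RHS](iotaDl 1 0); apply/eq_in_map => j; rewrite mem_iota /F => ?.
  by rewrite ifF ?ifT //; lia.
rewrite -[RHS]map_id; apply/eq_in_map => j; rewrite mem_iota /F => ?.
by rewrite !ifF //; lia.
Qed.

(* Main.v *)
Require Import Defs.
From mathcomp Require Import all_boot all_order all_algebra all_fingroup.
From mathcomp Require Import zify boolp functions.

Set Implicit Arguments.
Unset Strict Implicit.
Unset Printing Implicit Defensive.

Import GRing.Theory.

Local Open Scope ring_scope.

(** A simplex (w_0, ..., w_d) acts by reading the arguments of the resulting
cochain from left to right. The state of the process is a pointed list h :: s,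
made of a value h under construction (the hot value) and of the arguments s not
read yet. A cochain x is extended to pointed lists by h, a_1, ..., a_n |->
h x(a_1, ..., a_n) ([tilde]). The labels of the current word are treated in
order. The first unfinished one is active and can
 - take the hot value as its next entry (its left factor if it has none yet, and
   then its inputs), the next argument becoming hot;
 - finish: its value becomes hot, and is a left factor for the next label, whence
   the products;
 - take the hot value and stay open, while the process restarts with the hot
   value 1 on the next word, deprived of the finished labels. What precedes the
   open label in that word is multiplied together and becomes its next input,
   whence the braces.
The action of the simplex is the signed sum of all complete runs ([run]). It
amounts to the table reduction onto the surjection operad followed by the
interval cut action, in one pass: each axiom is an induction along the recursion
of [run].

Normalization makes the action well defined: if a word is repeated, the label
left open takes the value 1 as an input ([run_stutter]).

For the composition, an inner run is put in the place of the label k of an outer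
one. The row steps of the two runs interleave, and this is a lattice path: the
composite is the sum over the paths ([shuffle_runE]).

For the differential, the Hochschild differential of a cochain is, up to sign,
the alternating sum of the products of neighbours in the pointed list 1 :: s
([bar]). A product of two neighbours that go to the same cochain contributes to
the differential of that cochain. The others cancel, except for those that make
up the runs of the faces of the simplex ([bar_run]). The cancellation moves a
left factor through the labels placed before an open label i in the next word
([run_pass]), which is possible if these have not started. Here the second
filtration term enters: a label l that has started before i becomes active,
and returns in front of i, changes its order with i twice.

For the symmetric groups, the order of the labels enters only through Koszul
signs ([run_tournament]).

For the cup product there is only one word, and each cochain reads its inputs
consecutively ([run_argument]). For the simplex of the braces each word lets one
more cochain come in front of the first one, so each input of x_1 is either an
argument or the value of the next x_j ([run_brace]). These choices are the
insertions of the brace, and the signs of the run are Getzler's up to parity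
([brace_mask_sum]). *)

(** * Running a sequence of words on a list of arguments *)

Lemma signrSS (R : pzRingType) n : (-1) ^+ n.+2 = (-1) ^+ n :> R.
Proof. by rewrite !exprS mulrA mulrNN !mul1r. Qed.

Lemma signr_parity (R : pzRingType) m n : odd m = odd n -> (-1) ^+ m = (-1) ^+ n :> R.
Proof. by rewrite -signr_odd => ->; rewrite signr_odd. Qed.

Section Machine.

Variables (R : comPzRingType) (A : algType R).

Definition push (h : A) (f : seq A -> A) : seq A -> A := fun t => f (h :: t).

(** On a pointed list h :: s the sign is (-1)^|s|, the Koszul sign of an input,
of degree one, that passes a cochain with |s| inputs left to fill. *)
Definition tw (f : seq A -> A) : seq A -> A :=
  fun t => (-1) ^+ (size t).+1 *: f t.

Definition multilinear (f : seq A -> A) := forall t1 t2 (c : R) (y z : A),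
  f (t1 ++ (c *: y + z) :: t2) = c *: f (t1 ++ y :: t2) + f (t1 ++ z :: t2).

Section Labels.

Variables (T : eqType) (lt : rel T).

(** The input taken by i passes the cochains listed after i. A tournament
[lt] is enough for this, and substitution of labels or permutations produce
such relations directly. *)
Definition fill (i : T) (f : seq A -> A) (F : T -> seq A -> A) : T -> seq A -> A :=
  fun l => if l == i then f else if lt i l then tw (F l) else F l.

Definition pending (L w : seq T) : seq T := [seq l <- w | l \in L].

(** [L] lists the unfinished labels in the order of the current word, [ws] the
words to come, and [F] the cochains with the inputs filled so far. The active
label, the first of [L], either takes the hot value h as an input, or is
evaluated at h, or takes h and stays open while the next word starts with the
hot value 1. Labels, words and arguments have to be exhausted together. *)
Fixpoint run (ws : seq (seq T)) : seq T -> (T -> seq A -> A) -> seq A -> A :=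
  fix runL (L : seq T) : (T -> seq A -> A) -> seq A -> A :=
    fix runs (F : T -> seq A -> A) (t : seq A) : A :=
      match t with
      | [::] => 0
      | h :: s =>
        match L with
        | [::] => if nilp ws && nilp s then h else 0
        | i :: L' =>
          let F' := fill i (push h (F i)) F in
          runs F' s + runL L' F (F i [:: h] :: s) +
          match ws with
          | [::] => 0
          | w :: ws' =>
            (-1) ^+ (size s).+1 *: run ws' (pending L w) F' (1 :: s)
          end
        end
      end.

Definition next_row ws L F s : A :=
  if ws is w :: ws' then
    (-1) ^+ (size s).+1 *: run ws' (pending L w) F (1 :: s)
  else 0.

Lemma mem_pending L w l : (l \in pending L w) = (l \in L) && (l \in w).
Proof. exact: mem_filter. Qed.

Lemma eq_pending L L' w : {in w, L =i L'} -> pending L w = pending L' w.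
Proof. by move=> E; apply/eq_in_filter => l /E. Qed.

Lemma run_nil ws L F : run ws L F [::] = 0.
Proof. by case: ws; case: L. Qed.

Lemma run_end ws F h s :
  run ws [::] F (h :: s) = if nilp ws && nilp s then h else 0.
Proof. by case: ws. Qed.

Lemma run_cons ws i L F h s :
  run ws (i :: L) F (h :: s) =
    run ws (i :: L) (fill i (push h (F i)) F) s +
    next_row ws (i :: L) (fill i (push h (F i)) F) s +
    run ws L F (F i [:: h] :: s).
Proof. by rewrite addrAC; case: ws. Qed.

(** The recursion of [run]; the list is arbitrary in the last two premises since
finishing a label and changing rows replace the hot value. *)
Lemma run_ind (P : seq (seq T) -> seq T -> seq A -> Prop) :
  (forall ws L, P ws L [::]) ->
  (forall ws h s, P ws [::] (h :: s)) ->
  (forall ws i L h s, P ws (i :: L) s -> (forall t, P ws L t) ->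
     (forall w ws' L' t, ws = w :: ws' -> P ws' L' t) -> P ws (i :: L) (h :: s)) ->
  forall ws L t, P ws L t.
Proof.
move=> P0 P1 Pc; elim=> [|w ws IHws]; elim=> [|i L IHL];
  elim=> [|h s IHs] //; apply: Pc => // w' ws' L' t [_ <-]; exact: IHws.
Qed.

Definition wf (ws : seq (seq T)) (L : seq T) :=
  uniq L /\ forall w, w \in ws -> uniq w /\ {subset L <= w}.

Lemma wf_tail ws i L : wf ws (i :: L) -> wf ws L.
Proof.
case=> /= /andP[_ uL] H; split=> // w /H [uw sw]; split=> // l lL.
by apply: sw; rewrite inE lL orbT.
Qed.

Lemma wf_row w ws L : wf (w :: ws) L -> wf ws (pending L w).
Proof.
case=> _ H; have [uw _] := H w (mem_head _ _); split; first exact: filter_uniq.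
move=> v vws; have [|uv sv] := H v; first by rewrite inE vws orbT.
by split=> // l; rewrite mem_pending => /andP[/sv].
Qed.

Lemma mem_row w ws L : wf (w :: ws) L -> pending L w =i L.
Proof.
case=> _ H l; rewrite mem_pending; apply: andb_idr.
by have [_] := H w (mem_head _ _); apply.
Qed.

Lemma tw_lin c f g : tw (c *: f + g) = c *: tw f + tw g.
Proof.
by apply: funext => t; rewrite /tw !fctE scalerDr !scalerA mulrC.
Qed.

Lemma twK : involutive tw.
Proof.
by move=> f; apply: funext => t; rewrite /tw scalerA -expr2 sqrr_sign scale1r.
Qed.

Lemma tw1 f h : tw f [:: h] = f [:: h].
Proof. by rewrite /tw /= sqrrN expr1n scale1r. Qed.

Lemma push_tw h f : push h (tw f) = - tw (push h f).
Proof.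
by apply: funext => t; rewrite /push /tw !fctE /= [in LHS]exprS mulN1r scaleNr.
Qed.

Lemma push_lin h (c : R) (f g : seq A -> A) : push h (c *: f + g) = c *: push h f + push h g.
Proof. by []. Qed.

Lemma push_multilin c h1 h2 f : multilinear f ->
  push (c *: h1 + h2) f = c *: push h1 f + push h2 f.
Proof. by move=> lf; apply: funext => t; rewrite /push (lf [::] t). Qed.

Lemma multilinear_push h f : multilinear f -> multilinear (push h f).
Proof. by move=> lf t1 t2 c y z; rewrite /push -!cat_cons lf. Qed.

Lemma multilinear_tw f : multilinear f -> multilinear (tw f).
Proof.
move=> lf t1 t2 c y z; rewrite /tw lf scalerDr !size_cat /= !scalerA.
by rewrite [_ * c]mulrC.
Qed.

Lemma fill_multilinear i f F : multilinear f -> (forall l, multilinear (F l)) ->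
  forall l, multilinear (fill i f F l).
Proof.
move=> lf lF l; rewrite /fill; case: eqP => // _; case: ifP => // _.
exact: multilinear_tw.
Qed.

Lemma fill_push_multilinear i h f F : multilinear f -> (forall l, multilinear (F l)) ->
  forall l, multilinear (fill i (push h f) F l).
Proof. by move=> lf lF; apply: fill_multilinear => //; apply: multilinear_push. Qed.

Definition lin_at c i (F F1 F2 : T -> seq A -> A) :=
  F i = c *: F1 i + F2 i /\ forall l, l != i -> F1 l = F l /\ F2 l = F l.

Lemma lin_at_fill c i j F F1 F2 h : lin_at c i F F1 F2 ->
  lin_at c i (fill j (push h (F j)) F) (fill j (push h (F1 j)) F1)
    (fill j (push h (F2 j)) F2).
Proof.
move=> [Fi Fl]; split=> [|l li]; rewrite /fill.
  case: (eqVneq i j) => [<-|ij]; first by rewrite Fi.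
  by case: ifP; rewrite Fi // tw_lin.
have [F1l F2l] := Fl _ li; rewrite F1l F2l; case: eqP => // lj.
by rewrite -lj F1l F2l.
Qed.

Lemma lin_at_fill2 c j F (f f1 f2 : seq A -> A) : f = c *: f1 + f2 ->
  lin_at c j (fill j f F) (fill j f1 F) (fill j f2 F).
Proof.
by move=> ->; split=> [|l /negPf lj]; rewrite /fill ?eqxx // lj.
Qed.

Lemma scaler_swap (V : lmodType R) (a b : R) (x : V) : a *: (b *: x) = b *: (a *: x).
Proof. by rewrite !scalerA mulrC. Qed.

(** A finished label is never consulted again. *)
Lemma run_out i (F G : T -> seq A -> A) ws L t : (forall l, l != i -> F l = G l) -> i \notin L ->
  run ws L F t = run ws L G t.
Proof.
move: F G; pattern ws, L, t; apply: run_ind ws L t => [ws L|ws h s|ws j L h s IHs IHL IHw] F G FG iL.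
- by rewrite !run_nil.
- by rewrite !run_end.
have ij : j != i by apply: contraNneq iL => ->; rewrite mem_head.
have FGj : F j = G j by rewrite FG.
have FGf l : l != i -> fill j (push h (F j)) F l = fill j (push h (G j)) G l.
  by move=> li; rewrite /fill FGj FG.
rewrite !run_cons; congr (_ + _ + _).
- by apply: IHs.
- rewrite /next_row; case: ws {IHs IHL} IHw => // w ws IHw; congr (_ *: _).
  apply: (IHw _ _ _ _ erefl) => //; rewrite mem_pending; apply/negP => /andP[].
  by rewrite (negPf iL).
- by rewrite FGj; apply: IHL => //; apply: contra iL => iL; rewrite inE iL orbT.
Qed.

(** The two halves need each other: evaluating a label turns linearity in its
cochain into linearity in the hot value. *)
Lemma run_lin ws L t :
  (forall c i F F1 F2, wf ws L -> (forall l, multilinear (F l)) ->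
     (forall l, multilinear (F1 l)) -> (forall l, multilinear (F2 l)) ->
     i \in L -> lin_at c i F F1 F2 ->
     run ws L F t = c *: run ws L F1 t + run ws L F2 t) /\
  (forall F t1 t2 c y z, wf ws L -> (forall l, multilinear (F l)) ->
     t = t1 ++ (c *: y + z) :: t2 ->
     run ws L F t = c *: run ws L F (t1 ++ y :: t2) + run ws L F (t1 ++ z :: t2)).
Proof.
pattern ws, L, t; apply: run_ind ws L t => [ws L|ws h s|ws j L h s IHs IHL IHw].
- by split=> [c i F F1 F2 *|F [|? ?]] //; rewrite !run_nil scaler0 addr0.
- split=> [c i F F1 F2 _ _ _ _ //|F [|h' t1] t2 c y z _ _ [-> Es]].
    by rewrite /= !run_end Es; case: ifP; rewrite ?scaler0 ?addr0.
  rewrite /= !run_end Es.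
  have E x : nilp (t1 ++ x :: t2) = false by case: (t1).
  by rewrite !E !andbF scaler0 addr0.
have famE c i F F1 F2 :
    wf ws (j :: L) -> (forall l, multilinear (F l)) ->
     (forall l, multilinear (F1 l)) -> (forall l, multilinear (F2 l)) ->
     i \in j :: L -> lin_at c i F F1 F2 ->
  run ws (j :: L) F s + next_row ws (j :: L) F s =
  c *: (run ws (j :: L) F1 s + next_row ws (j :: L) F1 s) +
   (run ws (j :: L) F2 s + next_row ws (j :: L) F2 s).
  move=> wfL lF lF1 lF2 iL lin; rewrite (IHs.1 c i F F1 F2) // scalerDr addrACA.
  congr (_ + _); rewrite /next_row; case: ws IHw {IHs IHL} wfL => [|w ws] IHw wfL.
    by rewrite scaler0 addr0.
  rewrite scaler_swap -scalerDr; congr (_ *: _).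
  apply: ((IHw _ _ _ _ erefl).1 c i) => //; first exact: wf_row.
  by rewrite (mem_row wfL).
split=> [c i F F1 F2 wfL lF lF1 lF2 iL lin|F t1 t2 c y z wfL lF Et].
- have lin' := lin_at_fill j h lin.
  rewrite !run_cons.
  rewrite (famE _ _ _ _ _ wfL _ _ _ iL lin');
    try exact: fill_push_multilinear.
  rewrite [in RHS]scalerDr [in RHS]addrACA; congr (_ + _).
  case: (lin) => Fi Fl; case: (eqVneq i j) iL => [ij|ij]; last first.
    rewrite inE (negPf ij) /= => iL; have ji : j != i by rewrite eq_sym.
    have [-> ->] := Fl _ ji.
    by apply: ((IHL _).1 c i) => //; apply: wf_tail wfL.
  rewrite ij in Fi Fl *; rewrite Fi => _.
  have jL : j \notin L by case: wfL => /= /andP[].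
  rewrite ((IHL _).2 F [::] s c (F1 j [:: h]) (F2 j [:: h])) //; last exact: wf_tail wfL.
  by congr (_ *: _ + _); apply: (@run_out j) => // l /Fl [].
case: t1 Et => [|h' t1] /= [-> Et]; last first.
  rewrite {1}Et !run_cons.
  rewrite -Et (IHs.2 _ t1 t2 c y z) //; last first.
    exact: fill_push_multilinear.
  rewrite ((IHL (F j [:: h'] :: s)).2 _ (F j [:: h'] :: t1) t2 c y z) //; first last.
  - by rewrite Et.
  - exact: wf_tail wfL.
  rewrite [in RHS]scalerDr [in RHS]addrACA; congr (_ + _).
  rewrite scalerDr addrACA; congr (_ + _).
  rewrite /next_row; case: ws IHw {IHs IHL famE} wfL => [|w ws] IHw wfL.
    by rewrite scaler0 addr0.
  rewrite scaler_swap; rewrite {1}Et !size_cat /= -scalerDr; congr (_ *: _).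
  apply: ((IHw _ _ _ _ erefl).2 _ (1 :: t1)) => //.
  - exact: wf_row.
  - exact: fill_push_multilinear.
  - by rewrite Et.
rewrite -Et !run_cons.
rewrite (famE c j _ (fill j (push y (F j)) F) (fill j (push z (F j)) F)) //; first last.
- by apply: lin_at_fill2; rewrite push_multilin.
- by rewrite mem_head.
- exact: fill_push_multilinear.
- exact: fill_push_multilinear.
- exact: fill_push_multilinear.
rewrite [in RHS]scalerDr [in RHS]addrACA; congr (_ + _).
have /= -> := lF j [::] [::] c y z.
by apply: ((IHL _).2 _ [::]) => //; apply: wf_tail wfL.
Qed.

End Labels.
End Machine.

(** * Dependence on the labels, the cochains and the arguments *)

Section Relabel.

Variables (R : comPzRingType) (A : algType R).
Variables (T T' : eqType) (lt : rel T) (lt' : rel T') (g : T -> T') (D : {pred T}).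
Hypothesis inj_g : {in D &, injective g}.
Hypothesis lt_g : {in D &, forall i l, lt' (g i) (g l) = lt i l}.

(** Labels matter only through equality and the order; cochains are compared on
nonempty lists because a run never evaluates them elsewhere. *)
Lemma run_relabel (ws : seq (seq T)) (L : seq T) (F : T -> seq A -> A) F' t :
  {subset L <= D} -> (forall w, w \in ws -> {subset w <= D}) ->
  (forall l h s, l \in L -> F' (g l) (h :: s) = F l (h :: s)) ->
  run lt' [seq map g w | w <- ws] (map g L) F' t = run lt ws L F t.
Proof.
move: F F'; pattern ws, L, t.
apply: run_ind ws L t => [ws L|ws h s|ws j L h s IHs IHL IHw] F F' LD wD FF'.
- by rewrite !run_nil.
- by rewrite !run_end; case: ws {wD}.
have jD : j \in D by rewrite LD ?mem_head.
have filE l h' s' : l \in j :: L ->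
    fill lt' (g j) (push h (F' (g j))) F' (g l) (h' :: s') =
    fill lt j (push h (F j)) F l (h' :: s').
  move=> lL; have lD := LD _ lL.
  rewrite /fill lt_g // (inj_in_eq inj_g) //; case: eqP => _.
    by rewrite /push FF' // mem_head.
  by case: ifP => _; rewrite /tw FF'.
rewrite /= !run_cons; congr (_ + _ + _).
- exact: IHs.
- rewrite /next_row; case: ws {IHs IHL} IHw wD => //= w ws IHw wD; congr (_ *: _).
  have -> : pending (g j :: map g L) (map g w) = map g (pending (j :: L) w).
    rewrite /pending filter_map; congr map; apply/eq_in_filter => l lw /=.
    have lD : l \in D by apply: wD lw; rewrite mem_head.
    rewrite -map_cons; apply/mapP/idP => [[l' l'L] /inj_g ->//|]; last by exists l.
    exact: LD.
  apply: IHw => // [l|w' w'ws|l h' s'].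
  + by rewrite mem_pending => /andP[/LD].
  + by apply: wD; rewrite inE w'ws orbT.
  + by rewrite mem_pending => /andP[/filE].
- rewrite FF' ?mem_head //; apply: IHL => // [l lL|l h' s' lL].
    by apply: LD; rewrite inE lL orbT.
  by apply: FF'; rewrite inE lL orbT.
Qed.

End Relabel.

Section Consequences.

Variables (R : comPzRingType) (A : algType R) (T : eqType) (lt : rel T).
Implicit Types (F G : T -> seq A -> A) (f g : seq A -> A) (ws : seq (seq T)) (L : seq T).

Definition upd (i : T) f F : T -> seq A -> A := fun l => if l == i then f else F l.

Lemma upd_multilinear i f F : multilinear f -> (forall l, multilinear (F l)) ->
  forall l, multilinear (upd i f F l).
Proof. by move=> lf lF l; rewrite /upd; case: eqP. Qed.

Lemma zero_multilinear : multilinear (0 : seq A -> A).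
Proof.
have E t : (0 : seq A -> A) t = 0 by [].
by move=> t1 t2 c y z; rewrite !E scaler0 addr0.
Qed.

Lemma run_ext ws L F G t :
  (forall l h s, l \in L -> F l (h :: s) = G l (h :: s)) ->
  run lt ws L F t = run lt ws L G t.
Proof.
move=> FG; have := @run_relabel R A T T lt lt id predT _ _ ws L G F t _ _ FG.
by rewrite map_id (_ : map _ ws = ws) ?(eq_map (@map_id T)) ?map_id //; apply.
Qed.

Lemma run_label_lin c i ws L F F1 F2 t : wf ws L ->
  (forall l, multilinear (F1 l)) -> (forall l, multilinear (F2 l)) ->
  i \in L -> lin_at c i F F1 F2 ->
  run lt ws L F t = c *: run lt ws L F1 t + run lt ws L F2 t.
Proof.
move=> wfL lF1 lF2 iL lin; apply: (run_lin _ _ _ _).1 iL (lin) => // l.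
case: (lin) => Fi Fl; case: (eqVneq l i) => [->|/Fl[<-//]].
rewrite Fi => t1 t2 d y z; rewrite /= !fctE lF1 lF2 !scalerDr scaler_swap !addrA.
by congr (_ + _); rewrite -!addrA; congr (_ + _); rewrite addrC.
Qed.

Lemma run_multilinear ws L F : wf ws L -> (forall l, multilinear (F l)) ->
  multilinear (run lt ws L F).
Proof. by move=> wfL lF t1 t2 c y z; apply: (run_lin _ _ _ _).2. Qed.

Lemma multilinear0 f t1 t2 : multilinear f -> f (t1 ++ 0 :: t2) = 0.
Proof. by move=> /(_ t1 t2 (-1) 0 0); rewrite scaler0 addr0 scaleN1r addNr. Qed.

Lemma run_hot0 ws L F s : wf ws L -> (forall l, multilinear (F l)) ->
  run lt ws L F (0 :: s) = 0.
Proof.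
by move=> wfL lF; apply: (@multilinear0 _ [::]); apply: run_multilinear.
Qed.

Lemma run_zero ws L F i t : wf ws L -> (forall l, multilinear (F l)) ->
  i \in L -> (forall h s, F i (h :: s) = 0) -> run lt ws L F t = 0.
Proof.
move=> wfL lF iL Fi0; pose G := upd i 0 F.
rewrite (@run_ext _ _ _ G); last first.
  by move=> l h s _; rewrite /G /upd; case: eqP => // ->; rewrite Fi0.
have lG l : multilinear (G l).
  by apply: upd_multilinear => //; apply: zero_multilinear.
have := @run_label_lin (-1) i ws L G G G t wfL lG lG iL.
rewrite scaleN1r addNr; apply; split=> [|l _]; last by [].
by rewrite /G /upd eqxx scaler0 addr0.
Qed.

Lemma run_scale c i ws L F t : wf ws L -> (forall l, multilinear (F l)) ->
  i \in L -> run lt ws L (upd i (c *: F i) F) t = c *: run lt ws L F t.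
Proof.
move=> wfL lF iL; have lG l : multilinear (upd i 0 F l).
  by apply: upd_multilinear => //; apply: zero_multilinear.
rewrite (@run_label_lin c i ws L _ F (upd i 0 F)) //; last first.
  split=> [|l /negPf li]; last by rewrite /upd li.
  by rewrite /upd eqxx addr0.
rewrite [X in _ + X](@run_zero _ _ _ i) ?addr0 // => h s.
by rewrite /upd eqxx.
Qed.

Lemma run_add i f g ws L F t : wf ws L -> (forall l, multilinear (F l)) ->
  multilinear f -> multilinear g -> i \in L ->
  run lt ws L (upd i (f + g) F) t =
  run lt ws L (upd i f F) t + run lt ws L (upd i g F) t.
Proof.
move=> wfL lF lf lg iL; rewrite -[run lt _ _ (upd i f F) t]scale1r.
apply: (@run_label_lin _ i) => //; try exact: upd_multilinear.
split=> [|l /negPf li]; last by rewrite /upd li.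
by rewrite /upd eqxx scale1r.
Qed.

Lemma run_scale_ext (c : R) i ws L F G t : wf ws L -> (forall l, multilinear (F l)) ->
  i \in L -> (forall h s, G i (h :: s) = c *: F i (h :: s)) ->
  (forall l h s, l \in L -> l != i -> G l (h :: s) = F l (h :: s)) ->
  run lt ws L G t = c *: run lt ws L F t.
Proof.
move=> wfL lF iL Gi Gl; rewrite -(@run_scale _ i) //; apply: run_ext => l h s lL.
by rewrite /upd; case: eqP => [->|/eqP /Gl ->]; rewrite ?Gi.
Qed.

(** The active label absorbs the hot value at once, so only the restriction of
its cochain to lists with that head matters. *)
Lemma run_hot_ext ws i L F G h h' s : wf ws (i :: L) ->
  (forall t, F i (h :: t) = G i (h' :: t)) -> (forall l, l != i -> F l = G l) ->
  run lt ws (i :: L) F (h :: s) = run lt ws (i :: L) G (h' :: s).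
Proof.
move=> [/= /andP[iL _] _] E Fl; have Ep : push h (F i) = push h' (G i).
  by apply: funext => t; apply: E.
rewrite !run_cons Ep E; have -> : fill lt i (push h' (G i)) F = fill lt i (push h' (G i)) G.
  by apply: funext => l; rewrite /fill; case: eqP => // /eqP/Fl->.
by congr (_ + _); apply: run_out iL.
Qed.

Lemma run_hot_zero ws i L F h s : wf ws (i :: L) -> (forall l, multilinear (F l)) ->
  (forall t, F i (h :: t) = 0) -> run lt ws (i :: L) F (h :: s) = 0.
Proof.
move=> wfL lF E; pose G := upd i 0 F.
rewrite (@run_hot_ext _ _ _ _ G h h) //; last 2 first.
- by move=> t; rewrite E /G /upd eqxx.
- by move=> l /negPf li; rewrite /G /upd li.
apply: (@run_zero _ _ _ i) => //; last by rewrite /G /upd eqxx.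
  by apply: upd_multilinear => //; apply: zero_multilinear.
exact: mem_head.
Qed.

Lemma fill_same i f F : fill lt i f F i = f.
Proof. by rewrite /fill eqxx. Qed.

(** A label without room for an input beside h can only finish. *)
Lemma run_exhausted ws i L F h s : wf ws (i :: L) -> (forall l, multilinear (F l)) ->
  (forall a t, F i [:: h, a & t] = 0) ->
  run lt ws (i :: L) F (h :: s) = run lt ws L F (F i [:: h] :: s).
Proof.
move=> wfL lF Fi0; have lF' : forall l, multilinear (fill lt i (push h (F i)) F l).
  exact: fill_push_multilinear.
have F'i a t : fill lt i (push h (F i)) F i (a :: t) = 0 by rewrite fill_same; apply: Fi0.
rewrite run_cons (@run_zero _ _ _ i) ?mem_head // add0r [next_row _ _ _ _ _](_ : _ = 0) ?add0r //.
rewrite /next_row; case: ws wfL => // w ws wfL.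
rewrite (@run_zero _ _ _ i) ?scaler0 // ?(mem_row wfL) ?mem_head //; exact: wf_row.
Qed.

Lemma multilinear_scale c f : multilinear f -> multilinear (c *: f).
Proof. by move=> lf t1 t2 d y z; rewrite !fctE lf scalerDr scaler_swap. Qed.

Lemma twE f t : tw f t = (-1) ^+ (size t).+1 *: f t.
Proof. by []. Qed.

(** Each of the [size ws] row steps feeds one input that is not read from the
list, which shifts the parity of the arity. *)
Lemma tw_run ws L F t : wf ws L -> (forall l, multilinear (F l)) ->
  tw (run lt ws L F) t = (-1) ^+ size ws *: run lt ws L (fun l => tw (F l)) t.
Proof.
move: F; pattern ws, L, t.
apply: run_ind ws L t => [ws L|ws h s|ws j L h s IHs IHL IHw] F wfL lF.
- by rewrite /tw !run_nil !scaler0.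
- rewrite /tw !run_end; case: ws {wfL} => [|w ws] /=; last by rewrite !scaler0.
  by case: s => [|a s] /=; rewrite ?scaler0 // sqrrN expr1n expr0.
have lF' := fill_push_multilinear lt j h (lF j) lF.
have ltw l : multilinear (tw (F l)) by apply: multilinear_tw.
have filE l : fill lt j (push h (tw (F j))) (fun l => tw (F l)) l =
    upd j (- tw (fill lt j (push h (F j)) F j))
      (fun l => tw (fill lt j (push h (F j)) F l)) l.
  by rewrite /fill /upd eqxx push_tw; case: eqP => // _; case: ifP.
rewrite [LHS]twE !run_cons !scalerDr; congr (_ + _ + _).
- rewrite [in RHS](@run_scale_ext (-1) j _ _ (fun l => tw (fill lt j (push h (F j)) F l))) //.
  + by rewrite scaler_swap -IHs // [in RHS]twE [in LHS]exprS -scalerA.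
  + by move=> l; apply: multilinear_tw.
  + exact: mem_head.
  + by move=> h' s'; rewrite filE /upd eqxx scaleN1r.
  + by move=> l h' s' _ /negPf lj; rewrite filE /upd lj.
- rewrite /next_row; case: ws {IHs IHL} IHw wfL => [|w ws] IHw wfL; rewrite ?scaler0 //.
  rewrite [in RHS](@run_scale_ext (-1) j _ _ (fun l => tw (fill lt j (push h (F j)) F l))) //.
  + rewrite [in LHS]scaler_swap /= [(-1) ^+ (size ws).+1]exprS mulN1r !scaleN1r scaleNr scalerN.
    rewrite scalerN opprK [in RHS]scaler_swap -(IHw _ _ _ _ erefl) //; exact: wf_row.
  + exact: wf_row.
  + by move=> l; apply: multilinear_tw.
  + by rewrite (mem_row wfL) mem_head.
  + by move=> h' s'; rewrite filE /upd eqxx scaleN1r.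
  + by move=> l h' s' _ /negPf lj; rewrite filE /upd lj.
- rewrite tw1 -IHL //; exact: wf_tail wfL.
Qed.

(** The head of a pointed list is a left factor, where a unit is harmless. *)
Definition normalized f := forall t1 t2, t1 <> [::] -> f (t1 ++ 1 :: t2) = 0.

Lemma normalized_push h f : normalized f -> normalized (push h f).
Proof. by move=> nf t1 t2 _; rewrite /push -cat_cons nf. Qed.

Lemma normalized_tw f : normalized f -> normalized (tw f).
Proof. by move=> nf t1 t2 /nf Et; rewrite /tw Et scaler0. Qed.

Lemma fill_normalized i h F : (forall l, normalized (F l)) ->
  forall l, normalized (fill lt i (push h (F i)) F l).
Proof.
move=> nF l; rewrite /fill; case: eqP => _; first exact: normalized_push.
by case: ifP => // _; apply: normalized_tw.
Qed.

(** The unit becomes hot only when the active label has just taken the entry in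
front of it; it then falls into a proper input of that label. *)
Lemma run_normalized ws L F t1 t2 : wf ws L -> (forall l, multilinear (F l)) ->
  (forall l, normalized (F l)) -> t1 <> [::] -> run lt ws L F (t1 ++ 1 :: t2) = 0.
Proof.
move: (erefl (t1 ++ 1 :: t2)); move: {2 3}(t1 ++ _) => t.
move: F t1 t2; pattern ws, L, t.
apply: run_ind ws L t => [ws L|ws h s|ws j L h s IHs IHL IHw] F [|h' t1] t2 //=
  [-> Es] wfL lF nF _.
- by rewrite run_end -Es /nilp size_cat addnS andbF.
have lF' := fill_push_multilinear lt j h (lF j) lF.
have nF' := fill_normalized j h nF.
have wfL' := wf_tail wfL.
rewrite run_cons (IHL _ F (F j [:: h] :: t1) t2) /= ?Es //.
rewrite addr0 [next_row _ _ _ _ _](_ : _ = 0).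
  rewrite addr0; case: t1 Es => [|a t1] Es; last exact: (IHs _ (a :: t1) t2).
  rewrite -Es run_hot_zero // => t; rewrite {1}/fill eqxx.
  by have := nF j [:: h] t; apply.
rewrite /next_row; case: ws wfL {IHs IHL wfL'} IHw => // w ws wfL IHw.
rewrite (IHw _ _ _ _ erefl _ (1 :: t1) t2) ?scaler0 //; last exact: wf_row.
by rewrite -Es.
Qed.

(** A label left open that is still the first unfinished one of the next word
takes the restarting value 1 as an input. *)
Lemma run_same_row w ws L F t : uniq w -> L = pending L w -> wf (w :: ws) L ->
  (forall l, multilinear (F l)) -> (forall l, normalized (F l)) ->
  run lt (w :: ws) L F t = 0.
Proof.
move=> uw; move Ew: (w :: ws) => ws1.
move: F Ew; pattern ws1, L, t.
apply: run_ind ws1 L t => [ws1 L|ws1 h s|ws1 j L h s IHs IHL IHw] F Ew EL wfL lF nF.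
- by rewrite run_nil.
- by rewrite run_end -Ew.
have lF' := fill_push_multilinear lt j h (lF j) lF.
have nF' := fill_normalized j h nF.
rewrite run_cons IHs // IHL //; last 2 first.
- move: EL (wfL.1) uw; rewrite /pending; elim: (w) => //= i w' IHw'.
  rewrite inE; case: eqVneq => [-> [EL] /andP[jL _] /andP[jw _]|ij].
    rewrite (negPf jL) [LHS]EL; apply/eq_in_filter => l lw; rewrite inE.
    by case: eqVneq => // lj; rewrite -lj lw in jw.
  case: ifP => [iL [/esym/eqP]|iL EL uL /andP[_ uw']]; first by rewrite (negPf ij).
  by rewrite [i \in L]iL; apply: IHw'.
- exact: wf_tail wfL.
rewrite /next_row -Ew -EL run_hot_zero ?scaler0 ?addr0 //.
  by move: wfL; rewrite -Ew {2}EL => /wf_row.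
move=> t'; rewrite /fill eqxx; have := nF j [:: h] t'; exact.
Qed.

Lemma run_degenerate ws1 w ws2 L F t : wf (ws1 ++ w :: w :: ws2) L ->
  (forall l, multilinear (F l)) -> (forall l, normalized (F l)) ->
  run lt (ws1 ++ w :: w :: ws2) L F t = 0.
Proof.
move Ew: (ws1 ++ [:: w, w & ws2]) => ws.
move: F ws1 Ew; pattern ws, L, t.
apply: run_ind ws L t => [ws L|ws h s|ws j L h s IHs IHL IHw] F ws1 Ew wfL lF nF.
- by rewrite run_nil.
- by rewrite run_end -Ew; case: (ws1).
have lF' := fill_push_multilinear lt j h (lF j) lF.
have nF' := fill_normalized j h nF.
rewrite run_cons (IHs _ ws1) // (IHL _ _ ws1) //; last exact: wf_tail wfL.
rewrite add0r addr0 /next_row; case: ws Ew wfL {IHs IHL} IHw => // v ws Ew wfL IHw.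
case: ws1 Ew => [|v1 ws1] /= [Ev Ew]; last first.
  by rewrite (IHw _ _ _ _ erefl _ ws1) ?scaler0 //; apply: wf_row wfL.
have [uv Lv] := wfL.2 v (mem_head _ _).
rewrite -Ew Ev run_same_row ?scaler0 //.
- by apply: eq_pending => l lv; rewrite mem_pending lv andbT.
- by have := wf_row wfL; rewrite -Ew Ev.
Qed.

Lemma big_upd (V : nmodType) (j : T) (v : V) (p : T -> V) L : j \notin L ->
  \sum_(l <- L) (if l == j then v else p l) = \sum_(l <- L) p l.
Proof.
move=> jL; rewrite big_seq [RHS]big_seq; apply: eq_bigr => l lL; case: eqP => // lj.
by rewrite -lj lL in jL.
Qed.

(** A nonzero run fills all the inputs, with the arguments and with one value for
each row step. The relation [Q] allows both exact arities and mere bounds. *)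
Lemma run_support ws L F (Q : T -> int -> Prop) h s : wf ws L ->
  (forall l, multilinear (F l)) ->
  (forall l a t, F l (a :: t) <> 0 -> Q l (size t)%:Z) ->
  (forall p : T -> int, (forall l, l \in L -> Q l (p l)) ->
     (size s + size ws)%:Z <> \sum_(l <- L) p l) ->
  run lt ws L F (h :: s) = 0.
Proof.
pose t := h :: s; rewrite -/t (_ : size s = (size t).-1) //.
move: {h s} t => t; move: F Q; pattern ws, L, t.
apply: run_ind ws L t => [ws L|ws h s|ws j L h s IHs IHL IHw] F Q wfL lF QF E.
- by rewrite run_nil.
- rewrite run_end; case: ifP => // /andP[/nilP Ew /nilP Es].
  by have := E (fun=> 0); rewrite Ew Es big_nil /= => -[].
have lF' := fill_push_multilinear lt j h (lF j) lF.
pose Q' l n := if l == j then Q j (n + 1) else Q l n.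
have QF' l a t' : fill lt j (push h (F j)) F l (a :: t') <> 0 -> Q' l (size t')%:Z.
  rewrite /fill /Q'; case: eqP => [_|_].
    by rewrite /push => /QF /=; rewrite -addn1 PoszD.
  case: ifP => _; last exact: QF.
  by rewrite /tw => H; apply: (QF _ a) => E0; apply: H; rewrite E0 scaler0.
have E' (L1 : seq T) p : perm_eq L1 (j :: L) -> (forall l, l \in L1 -> Q' l (p l)) ->
    (size s + size ws)%:Z <> \sum_(l <- L1) p l + 1.
  move=> pL Qp; have := E (fun l => if l == j then p j + 1 else p l).
  have /andP[jL _] := wfL.1.
  rewrite (perm_big _ pL) !big_cons eqxx /= (big_upd _ _ jL).
  move=> H1 H2; apply: H1; last by rewrite H2 addrAC.
  move=> l lL; have := Qp l; rewrite (perm_mem pL) => /(_ lL).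
  by rewrite /Q'; case: eqP => // ->.
rewrite run_cons; have -> : run lt ws L F (F j [:: h] :: s) = 0.
  have [->|/eqP Fj] := eqVneq (F j [:: h]) 0.
    by apply: run_hot0 => //; apply: wf_tail wfL.
  apply: (IHL _ _ Q) => //= [|p Qp]; first exact: wf_tail wfL.
  have /andP[jL _] := wfL.1.
  have := E (fun l => if l == j then 0 else p l); rewrite big_cons eqxx add0r (big_upd _ _ jL).
  apply=> l; rewrite inE; case: eqP => [-> _|_ /Qp //].
  by have := QF _ _ _ Fj.
rewrite addr0 [X in X + _](_ : _ = 0) ?add0r; last first.
  case: s IHs E E' => [|a s] IHs E E'; first exact: run_nil.
  apply: (IHs _ Q') => //= p Qp Ep; apply: (E' (j :: L) p) => //=.
  by rewrite addSn -addn1 PoszD Ep.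
rewrite /next_row; case: ws {IHL IHs} wfL IHw E E' => [|w ws] wfL IHw E E' //.
rewrite (IHw _ _ _ _ erefl _ Q') ?scaler0 //=; first exact: wf_row.
move=> p Qp Ep; apply: (E' (pending (j :: L) w) p) => //.
  apply: uniq_perm; last exact: mem_row wfL.
    exact: filter_uniq (wfL.2 _ (mem_head _ _)).1.
  exact: wfL.1.
by rewrite addnS -addn1 PoszD Ep.
Qed.

End Consequences.

(** * Words with finished labels, and operadic composition *)

Section Pending.

Variables (R : comPzRingType) (A : algType R) (T : eqType) (lt : rel T).
Implicit Types (F : T -> seq A -> A) (f g : seq A -> A).

Lemma pending_tail (i : T) L w : uniq w -> uniq (i :: L) ->
  pending (i :: L) w = i :: L -> pending L w = L.
Proof.
rewrite /pending; elim: w => //= j w IHw /andP[jw uw] iLu.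
rewrite [j \in i :: L]inE; case: (eqVneq j i) => [ji [_ EL]|ji] /=.
  have /andP[/negPf iL _] := iLu; rewrite ji iL -[RHS]EL.
  apply/eq_in_filter => l lw; rewrite inE; case: eqVneq => // li.
  by rewrite ji -li lw in jw.
case: ifP => [jL [ij]|jL]; first by rewrite ij eqxx in ji.
exact: IHw.
Qed.

Lemma pending_pending (L w : seq T) : pending (pending L w) w = pending L w.
Proof. by apply: eq_pending => l lw; rewrite mem_pending lw andbT. Qed.

Lemma pending_pending2 (L L' w : seq T) : {subset L <= L'} ->
  pending L (pending L' w) = pending L w.
Proof.
move=> sLL'; rewrite /pending -filter_predI; apply/eq_in_filter => l _ /=.
by apply: andb_idr => /sLL'.
Qed.

(** Words are read only through their unfinished labels. *)
Lemma run_pending L' ws L (F : T -> seq A -> A) t : {subset L <= L'} ->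
  run lt [seq pending L' w | w <- ws] L F t = run lt ws L F t.
Proof.
move: F; pattern ws, L, t.
apply: run_ind ws L t => [ws L|ws h s|ws j L h s IHs IHL IHw] F sL.
- by rewrite !run_nil.
- by rewrite !run_end; case: ws.
rewrite !run_cons; congr (_ + _ + _).
- exact: IHs.
- case: ws {IHs IHL} IHw => //= w ws IHw; rewrite pending_pending2 //.
  by rewrite (IHw _ _ _ _ erefl) // => l; rewrite mem_pending => /andP[/sL].
- by apply: IHL => l lL; apply: sL; rewrite inE lL orbT.
Qed.

(** Finished labels are invisible, so this is a degenerate pair of words. Besides
degenerate simplices it discards the terms of a composition or of a brace in
which only finished labels move. *)
Lemma run_stutter (w0 : seq T) ws ws1 w w' ws2 L (F : T -> seq A -> A) t :
  w0 :: ws = ws1 ++ w :: w' :: ws2 -> uniq w0 -> pending L w0 = L -> wf ws L ->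
  pending L w = pending L w' ->
  (forall l, multilinear (F l)) -> (forall l, normalized (F l)) ->
  run lt ws L F t = 0.
Proof.
move=> E uw0 EL wfL Ew lF nF; rewrite -(@run_pending L) //.
have wfL' : wf [seq pending L w | w <- ws] L.
  split=> [|v /mapP[u uws ->]]; first exact: wfL.1.
  have [uu Lu] := wfL.2 _ uws; split; first exact: filter_uniq.
  by move=> l lL; rewrite mem_pending lL Lu.
case: ws1 E => [|w1 ws1] [E0 E1]; last first.
  rewrite E1 map_cat /= Ew in wfL' *; exact: run_degenerate.
rewrite E1 /= -Ew -E0 EL in wfL' *; apply: run_same_row => //.
  exact: wfL.1.
by apply/esym/all_filterP/allP.
Qed.

(** The three moves of the active label depend on the hot value h only through
the filled cochain g = push h (F i), and additively so. *)
Definition run_active ws (i : T) L (F : T -> seq A -> A) g s :=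
  run lt ws (i :: L) (fill lt i g F) s + next_row lt ws (i :: L) (fill lt i g F) s +
  run lt ws L F (g [::] :: s).

Lemma run_activeE ws i L F h s :
  run lt ws (i :: L) F (h :: s) = run_active ws i L F (push h (F i)) s.
Proof. exact: run_cons. Qed.

Lemma fill_upd i f g F : fill lt i g (upd i f F) = fill lt i g F.
Proof. by apply: funext => l; rewrite /fill /upd; case: eqP. Qed.

Lemma upd_fill i f g F : upd i f (fill lt i g F) = fill lt i f F.
Proof. by apply: funext => l; rewrite /fill /upd; case: eqP. Qed.

Lemma run_active_push ws i L F f h s : wf ws (i :: L) ->
  run_active ws i L F (push h f) s = run lt ws (i :: L) (upd i f F) (h :: s).
Proof.
move=> [/= /andP[iL _] _]; rewrite run_activeE /run_active fill_upd.
have -> : upd i f F i = f by rewrite /upd eqxx.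
by congr (_ + _); apply: (@run_out _ _ _ _ i) => // l /negPf li; rewrite /upd li.
Qed.

Lemma run_active_add ws i L F g1 g2 s : wf ws (i :: L) ->
  (forall l, multilinear (F l)) -> multilinear g1 -> multilinear g2 ->
  run_active ws i L F (g1 + g2) s = run_active ws i L F g1 s + run_active ws i L F g2 s.
Proof.
move=> wfL lF l1 l2; have iL : i \in i :: L := mem_head _ _.
have E : fill lt i (g1 + g2) F = upd i (g1 + g2) (fill lt i g1 F) by rewrite upd_fill.
have lf1 := fill_multilinear lt i l1 lF.
rewrite /run_active E run_add // !upd_fill.
have -> : (g1 + g2) [::] = 1 *: g1 [::] + g2 [::] by rewrite scale1r.
rewrite (run_multilinear lt (wf_tail wfL) lF [::]) scale1r /= [in RHS]addrACA; congr (_ + _).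
rewrite [in RHS]addrACA; congr (_ + _); rewrite /next_row.
case: ws wfL => [|w ws] wfL; first by rewrite addr0.
rewrite E run_add //; last by rewrite (mem_row wfL).
  by rewrite !upd_fill scalerDr.
exact: wf_row.
Qed.

Lemma run_active0 ws i L F s : wf ws (i :: L) -> (forall l, multilinear (F l)) ->
  run_active ws i L F 0 s = 0.
Proof.
move=> wfL lF; have -> : 0 = push 0 (0 : seq A -> A) by [].
rewrite run_active_push // run_hot0 //; apply: upd_multilinear => //.
exact: zero_multilinear.
Qed.

End Pending.

Section Composition.

Variables (R : comPzRingType) (A : algType R) (Tu Tv : eqType).
Variables (ltu : rel Tu) (ltv : rel Tv) (k : Tu).
Hypothesis ltu_k : forall l, l != k -> ltu k l = ~~ ltu l k.

Local Notation T := (Tu + Tv)%type.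
Implicit Types (F : T -> seq A -> A) (Lu u : seq Tu) (us : seq (seq Tu)) (vs : seq (seq Tv)) (Lv v : seq Tv).

(** The labels substituted for k inherit its comparisons with the others. *)
Definition slt : rel T := fun x y =>
  match x, y with
  | inl a, inl b => ltu a b
  | inl a, inr _ => ltu a k
  | inr _, inl b => ltu k b
  | inr a, inr b => ltv a b
  end.

Definition subst (Lu : seq Tu) (Lv : seq Tv) : seq T :=
  flatten [seq if l == k then [seq inr j | j <- Lv] else [:: inl l] | l <- Lu].

Lemma mem_subst_inl Lu Lv l : (inl l \in subst Lu Lv) = (l != k) && (l \in Lu).
Proof.
apply/flatten_mapP/andP => [[l' l'L]|[lk lL]]; last first.
  by exists l; rewrite // (negPf lk) mem_head.
by case: (eqVneq l' k) => [_ /mapP[]//|lk]; rewrite inE => /eqP[->].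
Qed.

Lemma mem_subst_inr Lu Lv j : (inr j \in subst Lu Lv) = (k \in Lu) && (j \in Lv).
Proof.
apply/flatten_mapP/andP => [[l' l'L]|[kL jL]]; last first.
  by exists k; rewrite // eqxx; apply/mapP; exists j.
by case: (eqVneq l' k) l'L => [->|_] lL; rewrite ?inE // => /mapP[j' j'L [->]].
Qed.

Lemma subst_uniq Lu Lv : uniq Lu -> uniq Lv -> uniq (subst Lu Lv).
Proof.
move=> uLu uLv; elim: Lu uLu => //= l Lu IHL /andP[lL uLu].
rewrite /subst /= -/(subst _ _) cat_uniq IHL // andbT.
apply/andP; split.
  by case: eqP => // _; rewrite map_inj_uniq // => ? ? [].
apply/hasPn => x xL; apply/negP; case: eqVneq xL => [lk|lk] xL.
  case/mapP => j jL Ex; move: xL; rewrite Ex mem_subst_inr -lk.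
  by rewrite (negPf lL).
by rewrite inE => /eqP Ex; move: xL; rewrite Ex mem_subst_inl (negPf lL) andbF.
Qed.

Lemma pending_subst Lu Lv u v : k \in Lu -> uniq Lv ->
  pending (subst Lu Lv) (subst u v) = subst (pending Lu u) (pending Lv v).
Proof.
move=> kL uLv; rewrite /pending; elim: u => //= l u IHu.
rewrite /subst /= -!/(subst _ _) filter_cat IHu.
case: (eqVneq l k) => [->|lk].
  rewrite kL /= /subst /= eqxx; congr (_ ++ _).
  by rewrite filter_map; congr map; apply: eq_filter => j /=; rewrite mem_subst_inr kL.
rewrite /= mem_subst_inl lk /=; case: ifP => // _.
by rewrite /subst /= (negPf lk).
Qed.

Lemma subst_out Lu Lv : k \notin Lu -> subst Lu Lv = map inl Lu.
Proof.
rewrite /subst; elim: Lu => //= l Lu IHL; rewrite inE negb_or => /andP[kl kL].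
by rewrite eq_sym (negPf kl) /= IHL.
Qed.

Lemma pending_subst_out Lu u v : k \notin Lu ->
  pending (map inl Lu) (subst u v) = map inl (pending Lu u).
Proof.
move=> kL; rewrite /pending; elim: u => //= l u IHu.
rewrite /subst /= -!/(subst _ _) filter_cat.
have inlE l' : (inl l' \in map (@inl Tu Tv) Lu) = (l' \in Lu).
  by rewrite mem_map // => ? ? [].
rewrite IHu; case: (eqVneq l k) => [->|lk] /=.
  rewrite (negPf kL) (_ : filter _ _ = [::]) //.
  by elim: (v) => //= j v' ->; case: ifP => // /mapP[].
by rewrite inlE; case: ifP.
Qed.

(** The lattice paths through us and vs, each given by the exponent of its sign
and by the words met after the starting point. A step in vs passes the steps in
us that are still to come. *)
Fixpoint shuffles (u : seq Tu) (us : seq (seq Tu)) :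
    seq Tv -> seq (seq Tv) -> seq (nat * seq (seq T)) :=
  fix shuffles_v v vs :=
    (if nilp us && nilp vs then [:: (0%N, [::])] else [::]) ++
    (if us is u1 :: us' then
       [seq (p.1, subst u1 v :: p.2) | p <- shuffles u1 us' v vs] else [::]) ++
    (if vs is v1 :: vs' then
       [seq (size us + p.1, subst u v1 :: p.2)%N | p <- shuffles_v v1 vs']
     else [::]).

Lemma shufflesE u us v vs :
  shuffles u us v vs =
    (if nilp us && nilp vs then [:: (0%N, [::])] else [::]) ++
    (if us is u1 :: us' then
       [seq (p.1, subst u1 v :: p.2) | p <- shuffles u1 us' v vs] else [::]) ++
    (if vs is v1 :: vs' then
       [seq (size us + p.1, subst u v1 :: p.2)%N | p <- shuffles u us v1 vs']
     else [::]).
Proof. by case: us; case: vs. Qed.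

Definition shuffle_run u us v vs (L : seq T) F t : A :=
  \sum_(p <- shuffles u us v vs) (-1) ^+ p.1 *: run slt p.2 L F t.

Definition full_row (T : eqType) (w : seq T) := uniq w /\ forall l, l \in w.

Definition full (T : eqType) (ws : seq (seq T)) := forall w, w \in ws -> full_row w.

Lemma full_wf (T' : eqType) (ws : seq (seq T')) L : full ws -> uniq L -> wf ws L.
Proof. by move=> fws uL; split=> // w /fws[uw mw]; split=> // l _. Qed.

Lemma full_tail (T' : eqType) (w : seq T') ws : full (w :: ws) -> full ws.
Proof. by move=> fw v vws; apply: fw; rewrite inE vws orbT. Qed.

Lemma full_head (T' : eqType) (w : seq T') ws : full (w :: ws) -> full_row w.
Proof. by apply; apply: mem_head. Qed.

Lemma shuffles_subst u us v vs p w : full (u :: us) -> full (v :: vs) ->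
  p \in shuffles u us v vs -> w \in p.2 ->
  exists u' v', [/\ full_row u', full_row v' & w = subst u' v'].
Proof.
move=> fu fv pS; elim: us vs u v fu fv p pS => [|u1 us IHus]; elim=> [|v1 vs IHvs] u v fu fv p.
- by rewrite shufflesE /= inE => /eqP ->.
- rewrite shufflesE /= => /mapP[q qS ->]; rewrite inE => /orP[/eqP->|].
    by exists u, v1; split=> //; [apply: full_head fu|apply: full_head (full_tail fv)].
  by apply: (IHvs u v1) qS => //; apply: full_tail fv.
- rewrite shufflesE /= cats0 => /mapP[q qS ->]; rewrite inE => /orP[/eqP->|].
    by exists u1, v; split=> //; [apply: full_head (full_tail fu)|apply: full_head fv].
  by apply: (IHus _ u1 v) qS => //; apply: full_tail fu.
- rewrite shufflesE /= mem_cat => /orP[] /mapP[q qS ->]; rewrite inE => /orP[/eqP->|].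
  + by exists u1, v; split=> //; [apply: full_head (full_tail fu)|apply: full_head fv].
  + by apply: (IHus _ u1 v) qS => //; apply: full_tail fu.
  + by exists u, v1; split=> //; [apply: full_head fu|apply: full_head (full_tail fv)].
  + by apply: (IHvs u v1) qS => //; apply: full_tail fv.
Qed.

Lemma subst_full u v (L : seq T) : full_row u -> full_row v ->
  (forall l, inl l \in L -> l != k) -> uniq (subst u v) /\ {subset L <= subst u v}.
Proof.
move=> [uu mu] [uv mv] Lk; split; first exact: subst_uniq.
by case=> x xL; rewrite ?mem_subst_inl ?mem_subst_inr ?mu ?mv ?andbT // Lk.
Qed.

Lemma shuffles_wf u us v vs (L : seq T) p : full (u :: us) -> full (v :: vs) ->
  uniq L -> (forall l, inl l \in L -> l != k) ->
  p \in shuffles u us v vs -> wf p.2 L.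
Proof.
move=> fu fv uL Lk pS; split=> // w wp.
have [u' [v' [fu' fv' ->]]] := shuffles_subst fu fv pS wp.
exact: subst_full.
Qed.

Lemma shuffle_run_cons u us v vs c L F h s :
  let F' := fill slt c (push h (F c)) F in
  shuffle_run u us v vs (c :: L) F (h :: s) =
    shuffle_run u us v vs (c :: L) F' s +
    ((if us is u1 :: us' then
        (-1) ^+ (size s).+1 *:
          shuffle_run u1 us' v vs (pending (c :: L) (subst u1 v)) F' (1 :: s)
      else 0) +
     (if vs is v1 :: vs' then
        (-1) ^+ (size us + (size s).+1) *:
          shuffle_run u us v1 vs' (pending (c :: L) (subst u v1)) F' (1 :: s)
      else 0)) +
    shuffle_run u us v vs L F (F c [:: h] :: s).
Proof.
move=> F'; rewrite /shuffle_run.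
under eq_bigr do rewrite run_cons !scalerDr.
rewrite !big_split /=; congr (_ + _ + _).
rewrite shufflesE !big_cat /= [X in X + _](_ : _ = 0) ?add0r; last first.
  by case: ifP => _; rewrite ?big_nil // big_seq1 scaler0.
congr (_ + _).
  case: us => [|u1 us]; rewrite ?big_nil // big_map scaler_sumr.
  by apply: eq_bigr => p _ /=; rewrite scaler_swap.
case: vs => [|v1 vs]; rewrite ?big_nil // big_map scaler_sumr.
by apply: eq_bigr => p _ /=; rewrite !scalerA -!exprD; congr (_ ^+ _ *: _); lia.
Qed.

(** Once k is finished, a step in vs moves finished labels only, so it repeats a
row; the only path that survives has no such step. *)
Lemma shuffle_run_out u us v vs Lu F t : full (u :: us) -> full (v :: vs) ->
  uniq Lu -> k \notin Lu -> pending Lu u = Lu ->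
  (forall l, multilinear (F l)) -> (forall l, normalized (F l)) ->
  shuffle_run u us v vs (map inl Lu) F t =
  if nilp vs then run ltu us Lu (fun l => F (inl l)) t else 0.
Proof.
move=> fu fv uLu kLu EL lF nF; rewrite /shuffle_run; case: vs fv => [|v1 vs] fv /=.
  have -> : shuffles u us v [::] = [:: (0%N, [seq subst u' v | u' <- us])].
    by elim: us u {EL fu} => [|u1 us IHus] u; rewrite shufflesE //= IHus.
  rewrite big_seq1 scale1r /=.
  rewrite -(@run_pending _ _ _ _ (map inl Lu)) // -map_comp.
  rewrite (eq_map (_ : _ =1 map inl \o pending Lu)); last first.
    by move=> w /=; rewrite pending_subst_out.
  rewrite map_comp (@run_relabel _ _ _ _ ltu slt inl predT _ _ _ _ (fun l => F (inl l))) //; last first.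
    by move=> x y _ _ [].
  exact: run_pending.
rewrite big_seq big1 // => p pS.
have uL : uniq (map (@inl Tu Tv) Lu) by rewrite map_inj_uniq // => ? ? [].
have Lk l : inl l \in map (@inl Tu Tv) Lu -> l != k.
  by case/mapP => l' l'L [->]; apply: contraNneq kLu => <-.
suff [ws1 [w [w' [ws2 [E Eww']]]]] : exists ws1 w w' ws2,
    subst u v :: p.2 = ws1 ++ w :: w' :: ws2 /\
    pending (map inl Lu) w = pending (map inl Lu) w'.
  rewrite (@run_stutter _ _ _ _ _ _ _ _ _ _ _ _ _ E) ?scaler0 //.
  - by have [] := subst_full (full_head fu) (full_head fv) Lk.
  - by rewrite pending_subst_out // EL.
  - exact: shuffles_wf fu fv uL Lk pS.
move: pS; rewrite shufflesE /= andbF /= mem_cat => /orP[|/mapP[q qS ->]]; last first.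
  exists [::], (subst u v), (subst u v1), q.2; split=> //.
  by rewrite !pending_subst_out.
case: us u fu {EL} => // u1 us u fu /mapP[q qS ->] /=.
elim: us u u1 {fu} q qS => [|u2 us IHus] u u1 q; rewrite shufflesE /= ?mem_cat ?inE.
  move=> /mapP[r _ ->] /=; exists [:: subst u v], (subst u1 v), (subst u1 v1), r.2.
  by split=> //; rewrite !pending_subst_out.
case/orP=> /mapP[r rS ->] /=.
  have [ws1 [w [w' [ws2 [E Ew]]]]] := IHus u1 u2 r rS.
  by exists (subst u v :: ws1), w, w', ws2; rewrite /= -E.
exists [:: subst u v], (subst u1 v), (subst u1 v1), r.2.
by split=> //; rewrite !pending_subst_out.
Qed.

(** The sign of an operation of degree e passing a cochain. *)
Definition twn (e : nat) (f : seq A -> A) : seq A -> A :=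
  fun t => (-1) ^+ (e * (size t).+1) *: f t.

Lemma twn_tw e f : twn e (tw f) = tw (twn e f).
Proof. by apply: funext => t; rewrite /twn /tw scaler_swap. Qed.

Lemma twnS e f : twn e.+1 f = tw (twn e f).
Proof. by apply: funext => t; rewrite /twn /tw scalerA -exprD mulSn. Qed.

Lemma twn0 f : twn 0 f = f.
Proof. by apply: funext => t; rewrite /twn mul0n scale1r. Qed.

Lemma twn1 e f h : twn e f [:: h] = f [:: h].
Proof. by rewrite /twn /= exprM sqrr_sign scale1r. Qed.

Lemma push_twn e h f : push h (twn e f) = (-1) ^+ e *: twn e (push h f).
Proof.
apply: funext => t; rewrite /push /twn !fctE scalerA -exprD /=.
by congr (_ ^+ _ *: _); rewrite mulnS.
Qed.

Lemma multilinear_twn e f : multilinear f -> multilinear (twn e f).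
Proof.
by elim: e => [|e IHe] lf; rewrite ?twn0 // twnS; apply: multilinear_tw; apply: IHe.
Qed.

(** The cochains of the outer run when the inner run, an operation of degree
[size vs], sits at k: it has passed the cochains in front of k. *)
Definition nest vs Lv F : Tu -> seq A -> A := fun l =>
  if l == k then run ltv vs Lv (fun j => F (inr j))
  else if ltu l k then twn (size vs) (F (inl l)) else F (inl l).

Lemma nest_multilinear vs Lv F : wf vs Lv -> (forall l, multilinear (F l)) ->
  forall l, multilinear (nest vs Lv F l).
Proof.
move=> wfL lF l; rewrite /nest; case: eqP => _; first exact: run_multilinear.
by case: ifP => // _; apply: multilinear_twn.
Qed.

(** An input taken at i passes k, or i is passed by the inner operation: in
either case the nested picture changes by the same sign at i and at k. *)
Lemma run_fill_nest us Lu vs Lv F i h t : i != k -> i \in Lu -> k \in Lu ->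
  wf us Lu -> wf vs Lv -> (forall l, multilinear (F l)) ->
  run ltu us Lu (fill ltu i (push h (nest vs Lv F i)) (nest vs Lv F)) t =
  run ltu us Lu (nest vs Lv (fill slt (inl i) (push h (F (inl i))) F)) t.
Proof.
move=> ik iL kL wfu wfv lF; set F' := fill slt _ _ F; set G := nest _ _ F'.
have lF' : forall l, multilinear (F' l) by apply: fill_push_multilinear.
have lG : forall l, multilinear (G l) by apply: nest_multilinear.
pose e := (-1) ^+ (size vs * ltu i k) : R.
have -> : fill ltu i (push h (nest vs Lv F i)) (nest vs Lv F) =
    upd i (e *: G i) (upd k (e *: G k) G).
  apply: funext => l; rewrite /fill /upd /G /nest (negPf ik) /e.
  case: (eqVneq l i) => [_|li].
    rewrite /F' /fill eqxx; case: ifP => lik; last by rewrite muln0 scale1r.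
    by rewrite push_twn muln1.
  case: (eqVneq l k) => [->|lk].
    rewrite ?eqxx; case: ifP => lik; last first.
      rewrite muln0 scale1r; congr (run ltv vs Lv _); apply: funext => j.
      by rewrite /F' /fill /= lik.
    apply: funext => s; rewrite tw_run // fctE muln1; congr (_ *: run ltv vs Lv _ _).
    by apply: funext => j; rewrite /F' /fill /= lik.
  rewrite /F' /fill /= [inl l == inl i](negPf li).
  by case: ifP; case: ifP => //; rewrite twn_tw.
have -> : upd i (e *: G i) (upd k (e *: G k) G) =
   upd i (e *: upd k (e *: G k) G i) (upd k (e *: G k) G).
  by congr (upd _ (_ *: _) _); rewrite /upd (negPf ik).
rewrite run_scale //; last first.
  by apply: upd_multilinear => //; apply: multilinear_scale.
by rewrite run_scale // scalerA /e -expr2 sqrr_sign scale1r.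
Qed.

(** The simultaneous recursion of an outer run and of the run nested in it. *)
Lemma shuffle_ind (P : seq (seq Tu) -> seq (seq Tv) -> seq Tu -> seq Tv -> seq A -> Prop) :
  (forall us vs Lu Lv t,
    (forall u1 us' vs' Lu' Lv' t', us = u1 :: us' -> P us' vs' Lu' Lv' t') ->
    (forall v1 vs' Lu' Lv' t', vs = v1 :: vs' -> P us vs' Lu' Lv' t') ->
    (forall l Lu' Lv' t', Lu = l :: Lu' -> P us vs Lu' Lv' t') ->
    (forall j Lv' t', Lv = j :: Lv' -> P us vs Lu Lv' t') ->
    (forall h t', t = h :: t' -> P us vs Lu Lv t') -> P us vs Lu Lv t) ->
  forall us vs Lu Lv t, P us vs Lu Lv t.
Proof.
move=> H; elim=> [|u1 us IHus]; elim=> [|v1 vs IHvs]; elim=> [|i Lu IHLu];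
  elim=> [|j Lv IHLv]; elim=> [|h t IHt]; apply: H;
  by [move=> ? ? ? ? ? ? [_ <-] | move=> ? ? ? ? ? [_ <-] |
      move=> ? ? ? ? [_ <-] | move=> ? ? ? [_ <-] | move=> ? ? [_ <-] | ].
Qed.

(** While a label other than k is active both sides make the same moves: a step in
vs would restart with the same label and put 1 into it. While k is active, one
move of the inner run is exposed. Its inputs and evaluations are those of the
composite, its row steps are the steps in vs, and the row steps of the outer
run are the steps in us. *)
Theorem shuffle_runE us vs Lu Lv t : forall u v F,
  full (u :: us) -> full (v :: vs) -> uniq Lu -> uniq Lv -> k \in Lu ->
  pending Lu u = Lu -> pending Lv v = Lv ->
  (forall l, multilinear (F l)) -> (forall l, normalized (F l)) ->
  run ltu us Lu (nest vs Lv F) t = shuffle_run u us v vs (subst Lu Lv) F t.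
Proof.
move: us vs Lu Lv t; apply: shuffle_ind => us vs Lu Lv t IHus IHvs IHLu IHLv IHt.
move=> u v F fu fv uLu uLv kLu ELu ELv lF nF.
have wfu : wf us Lu by apply: full_wf => //; apply: full_tail fu.
have wfv : wf vs Lv by apply: full_wf => //; apply: full_tail fv.
have lG := nest_multilinear wfv lF.
case: t IHt => [|h s] IHt.
  by rewrite run_nil /shuffle_run big1 // => p _; rewrite run_nil scaler0.
case: Lu => // i Lu in IHLu IHLv IHt kLu uLu ELu wfu lG *.
have xrow u1 us' F' : us = u1 :: us' -> (forall l, multilinear (F' l)) ->
    (forall l, normalized (F' l)) ->
    run ltu us' (pending (i :: Lu) u1) (nest vs Lv F') (1 :: s) =
    shuffle_run u1 us' v vs (pending (subst (i :: Lu) Lv) (subst u1 v)) F' (1 :: s).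
  move=> Eus lF' nF'; have fu1 : full (u1 :: us') by move: (full_tail fu); rewrite Eus.
  have [uu1 mu1] := full_head fu1.
  rewrite pending_subst // ELv; apply: (IHus _ _ _ _ _ _ Eus) => //.
  - exact: filter_uniq.
  - by rewrite mem_pending kLu mu1.
  - exact: pending_pending.
case: (eqVneq i k) => [ik|ik].
  rewrite ik in kLu ELu uLu wfu IHLu IHLv IHt xrow *.
  (* k is active: expose one move of the inner run *)
  have kLu' : k \notin Lu by case/andP: uLu.
  have ELu' : pending Lu u = Lu by apply: pending_tail ELu => //; case: (full_head fu).
  have Esubst Lv' : subst (k :: Lu) Lv' = map inr Lv' ++ map inl Lu.
    by rewrite /subst /= eqxx -/(subst Lu Lv') subst_out.
  case: Lv => [|j Lv] in IHLv IHt uLv ELv wfv lG xrow *.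
    (* the inner run has no label left, so k takes no further input *)
    rewrite Esubst /=.
    rewrite (@shuffle_run_out _ _ _ _ Lu) //; last by case/andP: uLu.
    have Gk t : nest vs [::] F k (h :: t) = if nilp vs && nilp t then h else 0.
      by rewrite /nest eqxx run_end.
    rewrite run_exhausted // => [|a t]; last by rewrite Gk andbF.
    rewrite Gk andbT; case: nilP => [Evs|_]; last by rewrite run_hot0 //; apply: wf_tail wfu.
    apply: run_ext => l a t lLu; rewrite /nest Evs twn0 (_ : (l == k) = false) ?if_same //.
    by apply: contraNF kLu' => /eqP <-.
  have Ec : subst (k :: Lu) (j :: Lv) = inr j :: subst (k :: Lu) Lv.
    by rewrite !Esubst.
  set F' := fill slt (inr j) (push h (F (inr j))) F.
  have lF' : forall l, multilinear (F' l) by apply: fill_push_multilinear.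
  have nF' : forall l, normalized (F' l) by apply: fill_normalized.
  rewrite Ec in xrow *; rewrite shuffle_run_cons -/F'.
  have F'r : (fun j => F' (inr j)) = fill ltv j (push h (F (inr j))) (fun j => F (inr j)).
    by apply: funext => j'.
  have F'l l : F' (inl l) = if ltu k l then tw (F (inl l)) else F (inl l) by [].
  pose gC : seq A -> A := run ltv vs (j :: Lv) (fun j => F' (inr j)).
  pose gR : seq A -> A := next_row ltv vs (j :: Lv) (fun j => F' (inr j)).
  pose gF : seq A -> A := push (F (inr j) [:: h]) (run ltv vs Lv (fun j => F (inr j))).
  have Eg : push h (nest vs (j :: Lv) F k) = gC + gR + gF.
    by apply: funext => t; rewrite /push /nest eqxx run_cons -F'r.
  have lgC : multilinear gC by apply: run_multilinear.
  have lgF : multilinear gF.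
    by apply: multilinear_push; apply: run_multilinear => //; apply: wf_tail wfv.
  have EgR : gR = if vs is v1 :: vs' then
     push 1 (- tw (run ltv vs' (pending (j :: Lv) v1) (fun j => F' (inr j)))) else 0.
    apply: funext => t; rewrite /gR /next_row; case: (vs) => // v1 vs'.
    by rewrite /push /tw !fctE /= [in RHS]exprS mulN1r scaleNr opprK.
  have lgR : multilinear gR.
    rewrite EgR; case: vs wfv {fv IHus IHvs IHLu IHLv IHt xrow lG gC gR Eg lgC EgR gF lgF} => [|v1 vs] wfv.
      exact: zero_multilinear.
    rewrite -scaleN1r; apply: multilinear_push; apply: multilinear_scale.
    by apply: multilinear_tw; apply: run_multilinear => //; apply: wf_row.
  have lgCR : multilinear (gC + gR).
    by move=> t1 t2 c y z; rewrite !fctE lgC lgR scalerDr addrACA.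
  rewrite run_activeE Eg !run_active_add //; congr (_ + _); last first.
    rewrite run_active_push //.
    rewrite (_ : upd k _ _ = nest vs Lv F); last first.
      by apply: funext => l; rewrite /upd /nest; case: eqP.
    apply: (IHLv j) => //; first by case/andP: uLv.
    by apply: pending_tail ELv => //; case: (full_head fv).
  have EG : fill ltu k gC (nest vs (j :: Lv) F) = nest vs (j :: Lv) F'.
    apply: funext => l; rewrite /fill /nest; case: eqP => [_|/eqP lk]; first by [].
    by rewrite F'l ltu_k //; case: (ltu l k).
  have gC0 : gC [::] = 0 by apply: run_nil.
  rewrite {1}/run_active EG gC0 run_hot0 ?addr0 //; last exact: wf_tail wfu.
  rewrite -[LHS]addrA; congr (_ + _); first by rewrite -Ec; apply: IHt.
  congr (_ + _).
    rewrite /next_row; case: us xrow {IHus IHvs IHLu IHLv IHt fu wfu} => // u1 us xrow.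
    by rewrite -(xrow _ _ _ erefl).
  rewrite EgR.
  case: vs fv wfv IHvs {IHus IHLu IHLv IHt xrow lG gC gR Eg lgC EgR gF lgF lgR lgCR EG gC0} => [|v1 vs] fv wfv IHvs.
    rewrite run_active0 //; exact: nest_multilinear.
  rewrite run_active_push //; set K := run ltv vs _ _.
  have [uv1 mv1] := full_head (full_tail fv).
  have lH : forall l, multilinear (nest vs (pending (j :: Lv) v1) F' l).
    by apply: nest_multilinear => //; apply: wf_row.
  rewrite (@run_scale_ext _ _ _ _ (-1) k _ _ (fun l => tw (nest vs (pending (j :: Lv) v1) F' l))) //.
  - rewrite -Ec pending_subst // ELu -(IHvs _ _ _ _ _ erefl) //; first last.
    + exact: pending_pending.
    + exact: filter_uniq.
    + exact: full_tail fv.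
    have := @tw_run _ _ _ ltu us (k :: Lu) (nest vs (pending (j :: Lv) v1) F') (1 :: s) wfu lH.
    rewrite {1}/tw /= => E; rewrite exprD -scalerA.
    rewrite [X in _ = _ *: X](_ : _ = - ((-1) ^+ size us *:
      run ltu us (k :: Lu) (fun l => tw (nest vs (pending (j :: Lv) v1) F' l)) (1 :: s))).
      by rewrite scalerN scalerA -expr2 sqrr_sign scale1r scaleN1r.
    by rewrite -E [in RHS]exprS mulN1r scaleNr opprK.
  - by move=> l; apply: multilinear_tw.
  - by move=> a t; rewrite /upd /nest eqxx scaleN1r.
  - move=> l a t _ lk; rewrite /upd /nest (negPf lk) F'l ltu_k //=.
    by case: (ltu l k); rewrite ?twnS //= twK.
have kLu' : k \in Lu by move: kLu; rewrite inE eq_sym (negPf ik).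
have ELu' : pending Lu u = Lu by apply: pending_tail ELu => //; case: (full_head fu).
have Esub : subst (i :: Lu) Lv = inl i :: subst Lu Lv.
  by rewrite /subst /= (negPf ik).
set F' := fill slt (inl i) (push h (F (inl i))) F.
have lF' : forall l, multilinear (F' l) by apply: fill_push_multilinear.
have nF' : forall l, normalized (F' l) by apply: fill_normalized.
rewrite Esub in xrow *; rewrite run_cons shuffle_run_cons -/F'; congr (_ + _ + _).
- rewrite run_fill_nest ?mem_head // -Esub; exact: IHt.
- have -> : (if vs is v1 :: vs' then
        (-1) ^+ (size us + (size s).+1) *:
          shuffle_run u us v1 vs' (pending (inl i :: subst Lu Lv) (subst u v1)) F' (1 :: s)
      else 0) = 0.
    case: vs fv {IHus IHvs IHLu IHLv IHt xrow wfv lG} => // v1 vs fv.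
    rewrite -Esub pending_subst // ELu /shuffle_run big_seq big1 ?scaler0 // => p pS.
    rewrite /subst /= (negPf ik) /= -/(subst _ _) run_hot_zero ?scaler0 //.
      have -> : inl i :: subst Lu (pending Lv v1) = subst (i :: Lu) (pending Lv v1).
        by rewrite /subst /= (negPf ik).
      apply: (shuffles_wf fu (full_tail fv) _ _ pS).
        by apply: subst_uniq => //; apply: filter_uniq; case: (full_head (full_tail fv)).
      by move=> l; rewrite mem_subst_inl => /andP[].
    move=> t; rewrite /F' /fill eqxx; have := nF (inl i) [:: h] t; exact.
  rewrite addr0 /next_row; case: us IHus xrow wfu {fu IHvs IHLu IHLv IHt} => // u1 us IHus xrow wfu.
  rewrite run_fill_nest ?(mem_row wfu) ?mem_head // ?(xrow _ _ _ erefl) //.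
  exact: wf_row.
- have -> : nest vs Lv F i [:: h] = F (inl i) [:: h].
    by rewrite /nest (negPf ik); case: ifP; rewrite ?twn1.
  by apply: (IHLu i) => //; case/andP: uLu.
Qed.

End Composition.

(** * The bar differential, and left factors passing through a run *)

Section BarDifferential.

Variables (R : comPzRingType) (A : algType R).
Implicit Types (f g : seq A -> A).

(** The alternating sum of the products of neighbours, closed by the product of g
with the last entry: see [barE]. The recursion along the list is the one of
[run]. *)
Fixpoint bar (g : seq A -> A) (t : seq A) : A :=
  if t is h :: s then
    (if s is a :: s' then g (h * a :: s') else g [::] * h) - bar (push h g) s
  else 0.

(** [bar] without the value of g at the empty list, a value which is 0 for an
extended cochain but not for a partly filled one. *)
Definition bar0 (g : seq A -> A) (t : seq A) : A :=
  if t is h :: s then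
    (if s is a :: s' then g (h * a :: s') else 0) - bar (push h g) s
  else 0.

Definition lmerge (h : A) f : seq A -> A :=
  fun t => if t is v :: t' then f (h * v :: t') else 0.

(** The identity as a partly filled cochain: the label that carries it hands on
the hot value. *)
Definition unitfun : seq A -> A := fun t => if t is [:: v] then v else 0.

Lemma bar_lin c f g t : bar (c *: f + g) t = c *: bar f t + bar g t.
Proof.
elim: t f g => [|h s IHs] f g /=; first by rewrite scaler0 addr0.
rewrite push_lin IHs scalerBr opprD [in RHS]addrACA; congr (_ + _).
by case: s {IHs} => [|a s]; rewrite !fctE // mulrDl scalerAl.
Qed.

Lemma bar_0 t : bar 0 t = 0.
Proof.
by have := bar_lin (-1) 0 0 t; rewrite scaler0 addr0 scaleN1r addNr.
Qed.

Lemma bar_add f g t : bar (f + g) t = bar f t + bar g t.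
Proof. by have := bar_lin 1 f g t; rewrite !scale1r. Qed.

Lemma bar_scale c f t : bar (c *: f) t = c *: bar f t.
Proof. by have := bar_lin c f 0 t; rewrite addr0 bar_0 addr0. Qed.

Lemma bar_opp f t : bar (- f) t = - bar f t.
Proof. by rewrite -scaleN1r bar_scale scaleN1r. Qed.

Lemma bar_homog c f g t :
  (forall u, (size u).+1 = size t -> f u = c *: g u) -> bar f t = c *: bar g t.
Proof.
elim: t f g => [|h s IHs] f g E /=; first by rewrite scaler0.
rewrite (IHs _ (push h g)) => [|u Eu]; last by apply: E; rewrite /= Eu.
rewrite scalerBr; congr (_ - _).
by case: s E {IHs} => [|a s] E; rewrite E // scalerAl.
Qed.

Lemma bar0_homog c f g t :
  (forall u, (size u).+1 = size t -> f u = c *: g u) -> bar0 f t = c *: bar0 g t.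
Proof.
case: t => [|h s] E; first by rewrite scaler0.
rewrite /bar0 (@bar_homog c _ (push h g)) => [|u Eu]; last by apply: E; rewrite /= Eu.
rewrite scalerBr; congr (_ - _).
by case: s E => [|a s] E; rewrite ?scaler0 // E.
Qed.

Lemma bar_tw f : bar (tw f) = - tw (bar f).
Proof.
apply: funext => t; rewrite fctE /tw -scaleNr -[- (_ ^+ _)]mulN1r -exprS.
by apply: bar_homog => u <-; rewrite [in RHS]signrSS.
Qed.

Lemma bar0_tw f : bar0 (tw f) = - tw (bar0 f).
Proof.
apply: funext => t; rewrite fctE /tw -scaleNr -[- (_ ^+ _)]mulN1r -exprS.
by apply: bar0_homog => u <-; rewrite [in RHS]signrSS.
Qed.

Lemma bar_push b g s :
  bar (push b g) s =
    - bar g (b :: s) + (if s is a :: s' then g (b * a :: s') else g [::] * b).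
Proof. by rewrite /= opprB subrK. Qed.

Lemma bar_multilinear f : multilinear f -> multilinear (bar f).
Proof.
move=> lf t1 t2 c y z; elim: t1 f lf => [|h t1 IHt] f lf /=.
  rewrite push_multilin // bar_lin scalerBr opprD [in RHS]addrACA; congr (_ + _).
  case: t2 => [|a t2]; first by rewrite mulrDr scalerAr.
  by rewrite mulrDl -scalerAl (lf [::]).
rewrite IHt ?scalerBr; last exact: multilinear_push.
rewrite opprD [in RHS]addrACA; congr (_ + _).
case: t1 {IHt} => [|a t1] /=; last by rewrite (lf (_ :: t1)).
by rewrite mulrDr -scalerAr (lf [::]).
Qed.

Lemma bar0_multilinear f : multilinear f -> multilinear (bar0 f).
Proof.
move=> lf t1 t2 c y z; have lb h := bar_multilinear (multilinear_push h lf).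
case: t1 => [|h t1] /=.
  rewrite push_multilin // bar_lin scalerBr opprD [in RHS]addrACA; congr (_ + _).
  case: t2 => [|a t2]; first by rewrite scaler0 addr0.
  by rewrite mulrDl -scalerAl (lf [::]).
rewrite lb scalerBr opprD [in RHS]addrACA; congr (_ + _).
case: t1 => [|a t1] /=; last by rewrite (lf (_ :: t1)).
by rewrite mulrDr -scalerAr (lf [::]).
Qed.

Lemma lmerge_multilinear h f : multilinear f -> multilinear (lmerge h f).
Proof.
move=> lf [|a t1] t2 c y z /=; last by rewrite (lf (_ :: t1)).
by rewrite mulrDr -scalerAr (lf [::]).
Qed.

Lemma unitfun_multilinear : multilinear unitfun.
Proof.
move=> [|a t1] t2 c y z /=; last by case: t1 => *; rewrite /= scaler0 addr0.
by case: t2 => //; rewrite scaler0 addr0.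
Qed.

Lemma tw_unitfun : tw unitfun = unitfun.
Proof.
apply: funext => -[|a [|b t]]; rewrite /tw ?scaler0 //=.
by rewrite sqrrN expr1n scale1r.
Qed.

Lemma tw_lmerge h f : tw (lmerge h f) = lmerge h (tw f).
Proof. by apply: funext => -[|a t]; rewrite /tw /= ?scaler0. Qed.

(** Filling an input and differentiating anticommute up to the products in which
that input is involved. *)
Lemma push_bar0 h f :
  push h (bar0 f) = lmerge h f - bar0 (push h f) - lmerge (f [:: h]) unitfun.
Proof.
apply: funext => t; rewrite /push !fctE; case: t => [|v t] /=; first by rewrite !subr0.
rewrite -addrA; congr (_ + _); rewrite -opprD addrAC; congr (- (_ - _)).
by case: t => [|a t]; rewrite ?addr0 // add0r.
Qed.

End BarDifferential.

Arguments unitfun {R A} t.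

Section Order.

Variable T : eqType.
Implicit Types (w L : seq T) (ws : seq (seq T)) (i l : T).

Definition before w i l := (index i w < index l w)%N.

Fixpoint stays i l ws : Prop :=
  if ws is w :: ws' then
    (before w i l -> forall w', w' \in ws' -> before w' i l) /\ stays i l ws'
  else True.

Definition always i l ws := forall w, w \in ws -> before w i l.

Lemma before_pending (p : {pred T}) w i l : p i -> p l ->
  before [seq x <- w | p x] i l = before w i l.
Proof.
move=> pi pl; rewrite /before; elim: w => //= x w IHw.
case: ifP => px /=; first by case: (x == i); case: (x == l).
have xN j : p j -> (x == j) = false by move=> pj; apply: contraFF px => /eqP ->.
by rewrite !xN.
Qed.

Lemma before_cons x w i l : i != x -> l != x -> before (x :: w) i l = before w i l.
Proof. by move=> ix lx; rewrite /before /= ![x == _]eq_sym (negPf ix) (negPf lx). Qed.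

Lemma before_head w i l : l != i -> before (i :: w) i l.
Proof. by move=> li; rewrite /before /= eqxx eq_sym (negPf li). Qed.

Lemma before_head_l w i l : ~~ before (i :: w) l i.
Proof. by rewrite /before /= eqxx. Qed.

Lemma stays_head w w' ws i l : before w i l = before w' i l ->
  stays i l (w :: ws) -> stays i l (w' :: ws).
Proof. by move=> E [H1 H2]; split=> //; rewrite -E. Qed.

Lemma always_head w w' ws i l : before w i l = before w' i l ->
  always i l (w :: ws) -> always i l (w' :: ws).
Proof.
move=> E H v; rewrite inE => /orP[/eqP->|vws]; first by rewrite -E H ?mem_head.
by apply: H; rewrite inE vws orbT.
Qed.

Lemma always_tail w ws i l : always i l (w :: ws) -> always i l ws.
Proof. by move=> H v vws; apply: H; rewrite inE vws orbT. Qed.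

Lemma stays_always w ws i l : before w i l -> stays i l (w :: ws) -> always i l (w :: ws).
Proof. by move=> b [/(_ b) H _] v; rewrite inE => /orP[/eqP->|/H]. Qed.

Lemma always_nbefore w i l ws : w \in ws -> always i l ws -> ~~ before w l i.
Proof. by move=> /[swap] H /H; rewrite /before -leqNgt => /ltnW. Qed.

Lemma never_stays i l ws : (forall w, w \in ws -> ~~ before w i l) -> stays i l ws.
Proof.
elim: ws => //= w ws IHws H; split; last first.
  by apply: IHws => v vws; apply: H; rewrite inE vws orbT.
by move=> b; have := H w (mem_head _ _); rewrite b.
Qed.

(** The second filtration term: the order of two labels changes at most once, so
one of the two orders is never left once it is reached. *)
Definition complexity2 L ws :=
  forall i l, i \in L -> l \in L -> i != l -> stays i l (L :: ws) \/ stays l i (L :: ws).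

(** i precedes l now, so the only change left to the pair is that l comes first. *)
Lemma complexity2_head i L ws : complexity2 (i :: L) ws ->
  forall l, l \in i :: L -> l != i -> stays l i ((i :: L) :: ws).
Proof.
move=> c2 l lL li; have [//|H] := c2 l i lL (mem_head _ _) li.
apply: never_stays => w wws; apply: always_nbefore wws _.
by apply: stays_always H; apply: before_head.
Qed.

Lemma before_finish i L a b : uniq (i :: L) -> a \in L -> b \in L ->
  before (i :: L) a b = before L a b.
Proof.
by move=> /= /andP[iL _] aL bL; apply: before_cons; apply: contraNneq iL => <-.
Qed.

Lemma before_row L w a b : a \in L -> b \in L -> before w a b = before (pending L w) a b.
Proof. by move=> aL bL; rewrite [RHS](@before_pending (mem L)). Qed.

Lemma complexity2_sub L L' ws ws' : {subset L' <= L} ->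
  (forall a b, a \in L' -> b \in L' -> stays a b (L :: ws) -> stays a b (L' :: ws')) ->
  complexity2 L ws -> complexity2 L' ws'.
Proof.
move=> sL st c2 a b aL bL ab; have := c2 a b (sL _ aL) (sL _ bL) ab.
by case=> H; [left|right]; apply: st.
Qed.

(** A move of a run, with what the arguments below need to know about it: they
are stated once for both ways of leaving the current word. *)
Definition follows L ws L' ws' :=
  [/\ {subset L' <= L}, wf ws' L', complexity2 L ws -> complexity2 L' ws',
      forall a b, a \in L' -> b \in L' -> stays a b (L :: ws) -> stays a b (L' :: ws')
    & forall a b, a \in L' -> b \in L' -> always a b (L :: ws) -> always a b (L' :: ws')].

Lemma follows_row L w ws : wf (w :: ws) L -> follows L (w :: ws) (pending L w) ws.
Proof.
move=> wfL; have mL := mem_row wfL.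
have sL : {subset pending L w <= L} by move=> l; rewrite mL.
have st a b : a \in pending L w -> b \in pending L w ->
    stays a b (L :: w :: ws) -> stays a b (pending L w :: ws).
  by rewrite !mL => aL bL [_]; apply: stays_head; apply: before_row.
split=> // [||a b]; [exact: wf_row|exact: complexity2_sub|].
by rewrite !mL => aL bL /always_tail; apply: always_head; apply: before_row.
Qed.

Lemma follows_finish i L ws : wf ws (i :: L) -> follows (i :: L) ws L ws.
Proof.
move=> wfL; have uL := wfL.1.
have sL : {subset L <= i :: L} by move=> l lL; rewrite inE lL orbT.
have st a b : a \in L -> b \in L -> stays a b ((i :: L) :: ws) -> stays a b (L :: ws).
  by move=> aL bL; apply: stays_head; apply: before_finish.
split=> // [||a b aL bL]; [exact: wf_tail wfL|exact: complexity2_sub|].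
by apply: always_head; apply: before_finish.
Qed.

End Order.

Section Passing.

Variables (R : comPzRingType) (A : algType R) (T : eqType) (lt : rel T).
Implicit Types (F G : T -> seq A -> A) (f g : seq A -> A).
Implicit Types (w L : seq T) (ws : seq (seq T)) (i l : T).

(** What distinguishes a cochain without any filled input: its first entry is a
left factor. *)
Definition fresh f := forall h v t, f (h * v :: t) = h * f (v :: t).

Lemma fresh_tw f : fresh f -> fresh (tw f).
Proof. by move=> ff h v t; rewrite /tw /= ff scalerAr. Qed.

Lemma fill_other i f F l : l != i -> fill lt i f F l = if lt i l then tw (F l) else F l.
Proof. by move=> /negPf li; rewrite /fill li. Qed.

Lemma rem_pending i L w : uniq L -> uniq w -> pending (rem i L) w = rem i (pending L w).
Proof.
move=> uL uw; rewrite [RHS]rem_filter ?filter_uniq // /pending -filter_predI.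
by apply: eq_filter => l /=; rewrite mem_rem_uniq // inE.
Qed.

(** An input taken by the label of [unitfun] kills the run, and its evaluation
leaves the hot value unchanged. *)
Lemma run_unitfun ws L F i t : wf ws L -> (forall l, multilinear (F l)) -> i \in L ->
  (forall h s, F i (h :: s) = unitfun (h :: s)) ->
  run lt ws L F t = run lt ws (rem i L) F t.
Proof.
move: F; pattern ws, L, t.
apply: run_ind ws L t => [ws L|ws h s|ws j L h s IHs IHL IHw] F wfL lF iL Fi //.
  by rewrite !run_nil.
have lF' := fill_push_multilinear lt j h (lF j) lF.
have [/= /andP[jL uL] _] := wfL; move: iL; rewrite /= inE.
case: (eqVneq j i) => [ji _|ji /=]; last first.
  have Fi' h' s' : fill lt j (push h (F j)) F i (h' :: s') = unitfun (h' :: s').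
    by rewrite fill_other 1?eq_sym //; case: ifP; rewrite ?/tw Fi // -[in RHS]tw_unitfun.
  move=> iL; rewrite !run_cons; congr (_ + _ + _).
  - by rewrite IHs ?inE ?iL ?orbT //= (negPf ji).
  - rewrite /next_row; case: ws wfL IHw {IHs IHL} => // w ws wfL IHw.
    rewrite (IHw _ _ _ _ erefl) //; last 2 first.
    + exact: wf_row.
    + by rewrite (mem_row wfL) inE iL orbT.
    rewrite -rem_pending /= ?(negPf ji) //; first by case: wfL => /=.
    by case: wfL => _ /(_ w (mem_head _ _)) [].
  - by rewrite IHL //; apply: wf_tail wfL.
by rewrite -ji in Fi *; rewrite run_exhausted // ?Fi // => a u; rewrite Fi.
Qed.

Lemma run_hot_extL ws i L F G h h' s : wf ws (i :: L) ->
  (forall t, F i (h :: t) = G i (h' :: t)) -> {in L, forall l, F l = G l} ->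
  run lt ws (i :: L) F (h :: s) = run lt ws (i :: L) G (h' :: s).
Proof.
move=> wfL E Fl; pose H l := if l \in i :: L then F l else G l.
rewrite (@run_ext _ _ _ _ _ _ _ H) => [|l a t lL]; last by rewrite /H lL.
apply: run_hot_ext => // [t|l li]; first by rewrite /H mem_head.
by rewrite /H inE (negPf li) /=; case: ifP => // /Fl.
Qed.

Definition lmul (h : A) f : seq A -> A := fun t => h * f t.

Lemma tw_lmul h f : tw (lmul h f) = lmul h (tw f).
Proof. by apply: funext => t; rewrite /tw /lmul scalerAr. Qed.

(** The state in which a left factor of the hot value is bound to reach the next
entry of i: what precedes i has not started, so the factor meets products
only. *)
Definition before_merge i F L ws :=
  [/\ wf ws L, i \in L, complexity2 L ws,
      forall l, l \in L -> l != i -> stays l i (L :: ws)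
    & forall l, l \in L -> l != i -> fresh (F l) \/ always i l (L :: ws)].

(** The same state once a label j in front of i has taken the factor, which j
holds until it finishes. *)
Definition inside_factor i j F L ws :=
  [/\ wf ws L /\ complexity2 L ws, [/\ i \in L, j \in L & i != j],
      always j i (L :: ws),
      forall l, l \in L -> (l != i -> stays l i (L :: ws)) /\
                            (l != j -> stays l j (L :: ws))
    & forall l, l \in L -> l != i -> l != j ->
        [\/ fresh (F l), always i l (L :: ws) | always l j (L :: ws)]].

Lemma before_merge_follows i F L ws L' ws' : follows L ws L' ws' -> i \in L' ->
  before_merge i F L ws -> before_merge i F L' ws'.
Proof.
move=> [sL wfL' c2' st al] iL' [_ iL c2 si fr].
split=> // [|l lL li|l lL li]; first exact: c2'.
  by apply: st => //; apply: si; rewrite ?sL.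
by case: (fr l (sL _ lL) li) => [|H]; [left|right; apply: al].
Qed.

Lemma inside_factor_follows i j F L ws L' ws' : follows L ws L' ws' ->
  i \in L' -> j \in L' -> inside_factor i j F L ws -> inside_factor i j F L' ws'.
Proof.
move=> [sL wfL' c2' st al] iL' jL' [[_ c2] [_ _ ij] aji s fr].
split=> // [||l lL|l lL li lj]; [by split; last exact: c2'|exact: al| |].
  by have [s1 s2] := s l (sL _ lL); split=> [/s1|/s2]; apply: st.
case: (fr l (sL _ lL) li lj) => [|H|H]; first exact: Or31.
  by apply: Or32; apply: al.
by apply: Or33; apply: al.
Qed.

Lemma before_merge_start i F a f L ws : a != i ->
  before_merge i F (a :: L) ws -> inside_factor i a (fill lt a f F) (a :: L) ws.
Proof.
move=> ai [wfL iL c2 si fr]; have aL := mem_head a L.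
split=> //; first by rewrite eq_sym.
- by apply: stays_always (si a aL ai); apply: before_head; rewrite eq_sym.
- move=> l lL; split=> [/(si l lL) //|la]; exact: complexity2_head.
- move=> l lL li la; rewrite fill_other //.
  case: (fr l lL li) => [frl|H]; last exact: Or32.
  by apply: Or31; case: ifP => // _; apply: fresh_tw.
Qed.

Lemma inside_factor_fill i j F a f L ws :
  inside_factor i j F (a :: L) ws -> inside_factor i j (fill lt a f F) (a :: L) ws.
Proof.
case=> [[wfL c2] [iL jL ij] aji s fr]; split=> // l lL li lj.
case: (eqVneq l a) => [la|la].
  apply: Or33; have [_ /(_ lj)] := s l lL; rewrite la.
  by apply: stays_always; apply: before_head; rewrite eq_sym -la.
rewrite fill_other //; case: (fr l lL li lj) => [frl|H|H].
- by apply: Or31; case: ifP => // _; apply: fresh_tw.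
- exact: Or32.
- exact: Or33.
Qed.

Lemma inside_factor_end i j F L ws :
  inside_factor i j F (j :: L) ws -> before_merge i F L ws.
Proof.
case=> [[wfL c2] [iL jL ij] aji s fr].
have [sL wfL' c2' st al] := follows_finish wfL.
have jL' : j \notin L by case/andP: wfL.1.
have iL' : i \in L by move: iL; rewrite inE (negPf ij).
split=> // [|l lL li|l lL li]; first exact: c2'.
  by apply: st => //; apply: (s l (sL _ lL)).1.
have lj : l != j by apply: contraNneq jL' => <-.
case: (fr l (sL _ lL) li lj) => [|H|H]; [by left|by right; apply: al|].
by have /negP[] := before_head_l L j l; apply: H; apply: mem_head.
Qed.

Definition merged i h F G (L : seq T) :=
  G i = lmerge h (F i) /\ forall l, l \in L -> l != i -> G l = F l.

Definition factored i j h F G (L : seq T) :=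
  [/\ G i = lmerge h (F i), F j = lmul h (G j)
    & forall l, l \in L -> l != i -> l != j -> G l = F l].

Lemma factored_fill i j h x F G a L : i != j -> a \in L -> a != i ->
  factored i j h F G L ->
  factored i j h (fill lt a (push x (F a)) F) (fill lt a (push x (G a)) G) L.
Proof.
move=> ij aL ai [Gi Fj Gl]; split=> [||l lL li lj].
- by rewrite !fill_other 1?eq_sym // Gi tw_lmerge; case: ifP.
- case: (eqVneq j a) => [<-|ja]; first by rewrite !fill_same Fj.
  by rewrite !fill_other // Fj tw_lmul; case: ifP.
- case: (eqVneq l a) => [la|la]; first by rewrite la !fill_same Gl // -la.
  by rewrite !fill_other // Gl.
Qed.

Lemma merged_fill i h x F G a L : a \in L -> a != i -> fresh (F a) ->
  merged i h F G L ->
  factored i a h (fill lt a (push (h * x) (F a)) F) (fill lt a (push x (G a)) G) L.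
Proof.
move=> aL ai fra [Gi Gl]; split=> [||l lL li la].
- by rewrite !fill_other 1?eq_sym // Gi tw_lmerge; case: ifP.
- by rewrite !fill_same Gl //; apply: funext => t; apply: fra.
- by rewrite !fill_other // Gl.
Qed.

(** The factor h is handed through the fresh labels that precede i. The second
half follows it while an open label j holds it as a left factor. *)
Lemma run_pass ws L t :
  (forall F G h v s i, t = v :: s -> before_merge i F L ws -> merged i h F G L ->
     run lt ws L F (h * v :: s) = run lt ws L G t) /\
  (forall F G h i j, inside_factor i j F L ws -> factored i j h F G L ->
     run lt ws L F t = run lt ws L G t).
Proof.
pattern ws, L, t; apply: run_ind ws L t => [ws L|ws x s|ws a L x s IHs IHL IHw].
- by split=> // *; rewrite !run_nil.
- by split=> [F G h v s' i _ []|F G h i j [_ []]].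
have next_rowE F G h i j : inside_factor i j F (a :: L) ws -> factored i j h F G (a :: L) ->
    next_row lt ws (a :: L) F s = next_row lt ws (a :: L) G s.
  move=> IF Fa; rewrite /next_row; case: ws IF IHw {IHs IHL} => // w ws IF IHw.
  case: (IF) => [[wfL _] [iL jL _] _ _ _].
  rewrite ((IHw _ _ _ _ erefl).2 F G h i j) //.
    by apply: (inside_factor_follows (follows_row wfL)) IF; rewrite (mem_row wfL).
  case: Fa => Gi Fj Gl; split=> // l; rewrite mem_pending => /andP[lL _]; exact: Gl.
have aL : a \in a :: L := mem_head _ _.
split=> [F G h _ _ i [<- <-] bm mg|F G h i j ifa fa].
- case: (bm) (mg) => wfL iL c2 si fr [Gi Gl]; case: (eqVneq a i) => [ai|ai].
    rewrite ai in wfL Gl *; apply: run_hot_extL => // [t|l lL]; first by rewrite Gi.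
    rewrite Gl // ?inE ?lL ?orbT //; apply: contraTneq lL => ->.
    by case/andP: wfL.1.
  have fra : fresh (F a).
    have [//|H] := fr a aL ai; have /= := always_nbefore (mem_head _ _) H.
    by rewrite before_head // eq_sym.
  have ifa f := before_merge_start f ai bm.
  have fa := merged_fill x aL ai fra mg.
  rewrite !run_cons; congr (_ + _ + _).
  + exact: (IHs.2 _ _ h i a).
  + exact: (next_rowE _ _ h i a).
  + rewrite fra Gl //; apply: ((IHL _).1 _ _ _ _ _ i) => //.
      apply: (before_merge_follows (follows_finish wfL)) bm.
      by move: iL; rewrite inE eq_sym (negPf ai).
    by split=> // l lL; apply: Gl; rewrite inE lL orbT.
- case: (ifa) (fa) => [[wfL c2] [iL jL ij] aji st fr] [Gi Fj Gl].
  have ai : a != i.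
    apply: contraTneq (aji _ (mem_head _ _)) => ->; exact: before_head_l.
  have ifa' f := inside_factor_fill f ifa.
  have fa' := factored_fill x ij aL ai fa.
  rewrite !run_cons; congr (_ + _ + _).
  + exact: (IHs.2 _ _ h i j).
  + exact: (next_rowE _ _ h i j).
  + have sL l : l \in L -> l \in a :: L by rewrite inE orbC => ->.
    case: (eqVneq a j) => [aj|aj].
      rewrite aj Fj; apply: ((IHL _).1 _ _ _ _ _ i) => //.
        by apply: inside_factor_end; rewrite -aj in ifa *; exact: ifa.
      split=> // l lL li; apply: Gl => //; first exact: sL.
      by apply: contraTneq lL => ->; rewrite -aj; case/andP: wfL.1.
    rewrite Gl //; apply: ((IHL _).2 _ _ h i j).
      apply: (inside_factor_follows (follows_finish wfL)) ifa.
        by move: iL; rewrite inE eq_sym (negPf ai).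
      by move: jL; rewrite inE eq_sym (negPf aj).
    by split=> // l /sL; apply: Gl.
Qed.

End Passing.

(** * The differential of a run *)

(** The bookkeeping in the proof of [bar_run] is done by [abelian]: expressions
are quoted as [zexpr] over a list of atoms, and two of them agree as soon as
every atom has the same coefficient in both. *)
Inductive zexpr := ZVar of nat | ZZero | ZAdd of zexpr & zexpr | ZOpp of zexpr.

Fixpoint zeval (V : zmodType) (env : seq V) (e : zexpr) : V :=
  match e with
  | ZVar n => nth 0 env n
  | ZZero => 0
  | ZAdd a b => zeval env a + zeval env b
  | ZOpp a => - zeval env a
  end.

Fixpoint zcoef (n : nat) (e : zexpr) : int :=
  match e with
  | ZVar m => (m == n)%:Z
  | ZZero => 0
  | ZAdd a b => zcoef n a + zcoef n b
  | ZOpp a => - zcoef n a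
  end.

Lemma zevalE (V : zmodType) (env : seq V) e :
  zeval env e = \sum_(i < size env) nth 0 env i *~ zcoef i e.
Proof.
elim: e => /= [n||a IHa b IHb|a IHa].
- case: (ltnP n (size env)) => [lt_n|le_n].
    rewrite (bigD1 (Ordinal lt_n)) //= eqxx big1 ?addr0 // => i.
    by rewrite -val_eqE /= eq_sym => /negPf->.
  rewrite nth_default // big1 // => i _.
  by rewrite (_ : (n == i) = false) //; apply/eqP=> E; move: le_n; rewrite E leqNgt ltn_ord.
- by rewrite big1.
- by rewrite IHa IHb -big_split; apply: eq_bigr => i _; rewrite mulrzDr.
- by rewrite IHa -sumrN; apply: eq_bigr => i _; rewrite mulrNz.
Qed.

Lemma zeval_eq (V : zmodType) (env : seq V) e1 e2 :
  all (fun i => zcoef i e1 == zcoef i e2) (iota 0 (size env)) ->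
  zeval env e1 = zeval env e2.
Proof.
move=> /allP E; rewrite !zevalE; apply: eq_bigr => i _.
by rewrite (eqP (E i _)) // mem_iota ltn_ord.
Qed.

Ltac zsame x y :=
  match constr:(Set) with
  | _ => let _ := match constr:(Set) with _ => unify x y end in constr:(true)
  | _ => constr:(false)
  end.
Ltac zindex x env :=
  lazymatch env with
  | ?y :: ?env' =>
    lazymatch zsame x y with
    | true => constr:(0%N)
    | false => let n := zindex x env' in constr:(n.+1)
    end
  end.
Ltac zmember x env :=
  lazymatch env with
  | ?y :: ?env' =>
    lazymatch zsame x y with true => constr:(true) | false => zmember x env' end
  | nil => constr:(false)
  end.
Ltac zatoms e env :=
  lazymatch e with
  | @GRing.zero _ => env
  | GRing.add ?a ?b => let env' := zatoms a env in zatoms b env'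
  | GRing.opp ?a => zatoms a env
  | _ => lazymatch zmember e env with true => env | false => constr:(e :: env) end
  end.
Ltac zquote e env :=
  lazymatch e with
  | @GRing.zero _ => constr:(ZZero)
  | GRing.add ?a ?b =>
      let a' := zquote a env in let b' := zquote b env in constr:(ZAdd a' b')
  | GRing.opp ?a => let a' := zquote a env in constr:(ZOpp a')
  | _ => let n := zindex e env in constr:(ZVar n)
  end.
(** Convertible subterms count as the same atom. *)
Ltac abelian :=
  lazymatch goal with
  | |- @eq ?V ?a ?b =>
    let env := zatoms a (@nil V) in
    let env := zatoms b env in
    let a' := zquote a env in
    let b' := zquote b env in
    exact: (@zeval_eq _ env a' b' (erefl true))
  end.

Section BarRun.

Variables (R : comPzRingType) (A : algType R) (T : eqType) (lt : rel T).
Hypothesis lt_total : forall i l, i != l -> lt i l = ~~ lt l i.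
Implicit Types (F G : T -> seq A -> A) (f g : seq A -> A).
Implicit Types (w L : seq T) (ws : seq (seq T)) (i l : T).

(** The invariant of runs. A label that has started was first at that time; by
[complexity2_head], a label that comes in front of it later stays there. *)
Definition tame F L ws :=
  [/\ wf ws L, complexity2 L ws
    & forall l, l \in L -> fresh (F l) \/
        forall l', l' \in L -> l' != l -> stays l' l (L :: ws)].

Lemma tame_fill i f F L ws : tame F (i :: L) ws -> tame (fill lt i f F) (i :: L) ws.
Proof.
case=> wfL c2 fr; split=> // l lL; case: (eqVneq l i) => [->|li].
  by right=> l' l'L l'i; apply: complexity2_head.
case: (fr l lL) => [frl|H]; [left|by right].
by rewrite fill_other //; case: ifP => // _; apply: fresh_tw.
Qed.

Lemma tame_follows F L ws L' ws' : follows L ws L' ws' -> tame F L ws -> tame F L' ws'.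
Proof.
move=> [sL wfL' c2' st _] [_ c2 fr]; split=> // [|l lL]; first exact: c2'.
case: (fr l (sL _ lL)) => [frl|H]; [by left|right=> l' l'L l'l].
by apply: st => //; apply: H; rewrite ?sL.
Qed.

Lemma tame_before_merge i F L ws : tame F (i :: L) ws -> before_merge i F (i :: L) ws.
Proof.
case=> wfL c2 fr; split=> //; first exact: mem_head.
  by move=> l lL li; apply: complexity2_head.
move=> l lL li; case: (fr l lL) => [frl|H]; [by left|right].
apply: stays_always (H i (mem_head _ _) _); last by rewrite eq_sym.
exact: before_head.
Qed.

Definition remove_row k ws := take k ws ++ drop k.+1 ws.

(** The faces of the simplex (current word, ws): the first one starts with the
next word, read on the unfinished labels. *)
Definition face_sum ws L F t : A :=
  if ws is w :: ws' then
    run lt ws' (pending L w) F t -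
    \sum_(k < size ws) (-1) ^+ k *: run lt (remove_row k ws) L F t
  else 0.

Lemma face_sum_nil ws L F : face_sum ws L F [::] = 0.
Proof.
case: ws => //= w ws; rewrite run_nil big1 ?subr0 // => k _.
by rewrite run_nil scaler0.
Qed.

Lemma sum_next_row w ws L F s : wf (w :: ws) L ->
  \sum_(k < size (w :: ws)) (-1) ^+ k *: next_row lt (remove_row k (w :: ws)) L F s =
  (-1) ^+ (size s).+1 *: face_sum ws (pending L w) F (1 :: s).
Proof.
move=> wfL; rewrite big_ord_recl /= expr0 scale1r /remove_row /= drop0.
case: ws wfL => [|w' ws] wfL; first by rewrite big_ord0 addr0 scaler0.
rewrite /next_row /face_sum scalerBr; congr (_ + _).
  by congr (_ *: run lt _ _ _ _); apply: eq_pending => l _; rewrite (mem_row wfL).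
rewrite scaler_sumr -sumrN; apply: eq_bigr => k _.
by rewrite /= /bump leq0n add1n [in LHS]exprS mulN1r scaleNr scaler_swap.
Qed.

Lemma bar_run_end ws F t : bar (run lt ws [::] F) t = 0.
Proof.
case: ws => [|w ws]; last first.
  rewrite (_ : run _ _ _ _ = 0) ?bar_0 //; apply: funext => -[|h s]; first exact: run_nil.
  by rewrite run_end.
case: t => [|h [|a [|b t]]] //=; first by rewrite mul0r subrr.
  by rewrite /push /= !subr0 addrN.
rewrite (_ : push a _ = 0) ?bar_0; last by apply: funext.
rewrite /push /=; case: t => [|c t]; by rewrite ?mul0r !subr0.
Qed.

Lemma fill_fill i f g F : fill lt i f (fill lt i g F) = upd i f F.
Proof.
apply: funext => l; rewrite /upd; case: (eqVneq l i) => [->|li].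
  by rewrite fill_same.
by rewrite !fill_other //; case: (lt i l); rewrite ?twK.
Qed.

Lemma next_rowE ws L F s : next_row lt ws L F s =
  if ws is w :: ws' then - ((-1) ^+ size s *: run lt ws' (pending L w) F (1 :: s)) else 0.
Proof. by case: ws => //= w ws; rewrite exprS mulN1r scaleNr. Qed.

(** The sign is that of one [tw]: an input of i passes l, whose arity [bar0]
changes, or else the twist made by [bar0] at l meets the changed arity of i. *)
Lemma run_fill_bar0 i l h ws L F t : i != l -> l \in L -> i \in L -> wf ws L ->
  (forall l, multilinear (F l)) ->
  let F1 := fill lt i (push h (F i)) F in
  let G := fill lt l (bar0 (F l)) F in
  run lt ws L (fill lt i (push h (G i)) G) t =
  - run lt ws L (fill lt l (bar0 (F1 l)) F1) t.
Proof.
move=> il lL iL wfL lF F1 G.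
have lF1 : forall l, multilinear (F1 l) by apply: fill_push_multilinear.
have F1i : F1 i = push h (F i) by rewrite /F1 fill_same.
have F1m m : m != i -> F1 m = if lt i m then tw (F m) else F m.
  exact: fill_other.
have Gl : G l = bar0 (F l) by rewrite /G fill_same.
have Gm m : m != l -> G m = if lt l m then tw (F m) else F m.
  exact: fill_other.
have li : l != i by rewrite eq_sym.
clearbody F1 G; have E := lt_total il; pose j := if lt i l then l else i.
rewrite (@run_scale_ext _ _ _ _ (-1) j _ _ (fill lt l (bar0 (F1 l)) F1)) ?scaleN1r //.
- by apply: fill_multilinear => //; apply: bar0_multilinear.
- by rewrite /j; case: ifP.
- move=> a u; rewrite scaleN1r /j; case: (boolP (lt i l)) E => E1 /esym E2.
    by rewrite fill_same fill_other // E1 Gl F1m // E1 bar0_tw fctE opprK.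
  by rewrite fill_same fill_other // (negbFE E2) Gm // (negbFE E2) push_tw F1i.
- move=> m a u _; rewrite /j; case: (eqVneq m i) => [->|mi].
    case: (boolP (lt i l)) E => [E1 /esym/negbTE E2 _|_ _]; last by rewrite eqxx.
    by rewrite fill_same fill_other // E2 Gm // E2 F1i.
  case: (eqVneq m l) => [->|ml].
    case: (boolP (lt i l)) E => [_ _|/negPf E1 _ _]; first by rewrite eqxx.
    by rewrite fill_same fill_other // E1 Gl F1m // E1.
  by rewrite !fill_other // Gm // F1m //; case: (lt i m); case: (lt l m).
Qed.

Lemma run_upd_opp i f F ws L t : wf ws L -> (forall l, multilinear (F l)) ->
  multilinear f -> i \in L ->
  run lt ws L (upd i (- f) F) t = - run lt ws L (upd i f F) t.
Proof.
move=> wfL lF lf iL; rewrite -[RHS]scaleN1r; apply: (@run_scale_ext _ _ _ _ _ i) => //.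
- exact: upd_multilinear.
- by move=> h s; rewrite /upd eqxx scaleN1r fctE.
- by move=> l h s _ /negPf li; rewrite /upd li.
Qed.

Lemma run_push_bar0 i h f F ws L t : wf ws L -> (forall l, multilinear (F l)) ->
  multilinear f -> i \in L ->
  run lt ws L (upd i (push h (bar0 f)) F) t =
    run lt ws L (upd i (lmerge h f) F) t - run lt ws L (upd i (bar0 (push h f)) F) t -
    run lt ws L (upd i (lmerge (f [:: h]) unitfun) F) t.
Proof.
move=> wfL lF lf iL; have lu : multilinear (unitfun : seq A -> A) by apply: unitfun_multilinear.
have lm g : multilinear g -> multilinear (- g).
  by move=> lg; rewrite -scaleN1r; apply: multilinear_scale.
have l1 := lmerge_multilinear h lf; have l2 := bar0_multilinear (multilinear_push h lf).
have l3 := lmerge_multilinear (f [:: h]) lu.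
rewrite push_bar0 !run_add ?run_upd_opp //; do 1?exact: lm.
by move=> t1 t2 c y z; rewrite !fctE l1 l2 scalerBr opprD addrACA.
Qed.

(** Follow one move of the active label i. Multiplying the hot value h with the
next argument gives the term of [bar0] at i and the terms of the run after the
move, up to products of h, or of the value b of i, with the entry that another
label takes next. These cancel between taking h and finishing i, unless a row
step intervenes. In that case [run_pass] trades h in front of the next word for
h multiplied into the next entry of i, and likewise for b with [run_unitfun];
the two runs that remain are the moves of the face deleting the current
word. *)
Theorem bar_run ws L t : forall F, tame F L ws -> (forall l, multilinear (F l)) ->
  bar (run lt ws L F) t =
    \sum_(l <- L) run lt ws L (fill lt l (bar0 (F l)) F) t +
    (-1) ^+ (size t).-1 *: face_sum ws L F t.
Proof.
pattern ws, L, t; apply: run_ind ws L t => [ws L|ws h s|ws i L h s IHs IHL IHw] F tF lF.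
- rewrite face_sum_nil scaler0 addr0 big1 // => l _; exact: run_nil.
- rewrite bar_run_end big_nil add0r; case: ws tF => [|w ws] tF; first by rewrite scaler0.
  rewrite /face_sum (_ : pending [::] w = [::]); last by elim: (w).
  rewrite run_end big_ord_recl /= expr0 scale1r /remove_row /= drop0 run_end big1 ?addr0.
    by rewrite subrr scaler0.
  by move=> k _; rewrite ?run_end scaler0.
have [wfL c2 _] := tF; have uL := wfL.1; have iL := mem_head i L.
have iL' : i \notin L by case/andP: uL.
pose F1 := fill lt i (push h (F i)) F; pose b := F i [:: h].
have lF1 : forall l, multilinear (F1 l) by apply: fill_push_multilinear.
have tF1 : tame F1 (i :: L) ws by apply: tame_fill.
have lbar0 l : multilinear (bar0 (F l)) by apply: bar0_multilinear.
have lbar1 l : multilinear (bar0 (F1 l)) by apply: bar0_multilinear.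
(* HA, HB: h, respectively b, multiplied with the next argument; K: the run on
   the next word; D1, D2, D3: bar0 at l after i takes h, finishes, or changes
   the row *)
pose HA := if s is a :: s' then run lt ws (i :: L) F (h * a :: s') else 0.
pose HB := if s is a :: s' then run lt ws L F (b * a :: s') else 0.
pose K : seq A -> A := if ws is w :: ws' then run lt ws' (pending (i :: L) w) F1 else 0.
pose KK := if s is a :: s' then (-1) ^+ size s' *: K s else 0.
pose D1 l := run lt ws (i :: L) (fill lt l (bar0 (F1 l)) F1) s.
pose D2 l := run lt ws L (fill lt l (bar0 (F l)) F) (b :: s).
pose D3 l := if ws is w :: ws' then
  run lt ws' (pending (i :: L) w) (fill lt l (bar0 (F1 l)) F1) (1 :: s) else 0.
pose c : R := (-1) ^+ size s.
have K0 : K [::] = 0 by rewrite /K; case: (ws) => // w ws'; apply: run_nil.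
have LHS : bar (run lt ws (i :: L) F) (h :: s) =
    HA - bar (run lt ws (i :: L) F1) s + bar (run lt ws L F) (b :: s) - HB +
    c *: bar K (1 :: s) + KK.
  rewrite [LHS]/= run_nil mul0r -/HA.
  have -> : push h (run lt ws (i :: L) F) =
      run lt ws (i :: L) F1 + push 1 (- tw K) + push b (run lt ws L F).
    apply: funext => t'; rewrite /push run_cons -/F1 -/b; congr (_ + _ + _).
    rewrite next_rowE /K /tw; case: (ws) => [|w ws'].
      by rewrite !fctE scaler0 oppr0.
    by rewrite !fctE /= [in RHS]signrSS.
  have bK : bar (- tw K) (1 :: s) = c *: bar K (1 :: s).
    rewrite bar_opp bar_tw fctE opprK /tw /c /=.
    by rewrite [in LHS]signrSS.
  rewrite !bar_add !bar_push bK run_nil mul0r -/HB.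
  have -> : (if s is a :: s' then (- tw K) (1 * a :: s') else (- tw K) [::] * 1) =
     - KK.
    rewrite /KK; case: (s) => [|a s']; first by rewrite fctE /tw K0 scaler0 oppr0 mul0r.
    by rewrite mul1r fctE /tw /= signrSS.
  abelian.
have T_other l : l \in L ->
    run lt ws (i :: L) (fill lt l (bar0 (F l)) F) (h :: s) = - D1 l + c *: D3 l + D2 l.
  move=> lL; have il : i != l by apply: contraNneq iL' => ->.
  have lL' : l \in i :: L by rewrite inE lL orbT.
  rewrite run_cons run_fill_bar0 //; congr (_ + _ + _).
    rewrite next_rowE /D3; case Ews: ws => [|w ws']; first by rewrite scaler0.
    have wfw : wf (w :: ws') (i :: L) by rewrite -Ews.
    by rewrite run_fill_bar0 ?(mem_row wfw) // ?scalerN ?opprK //; apply: wf_row.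
  by rewrite /D2 fill_other //; case: ifP; rewrite ?tw1.
have T_i : run lt ws (i :: L) (fill lt i (bar0 (F i)) F) (h :: s) =
    HA - D1 i - HB + c *: D3 i +
    (if ws is w :: ws' then
       c *: (run lt ws' (pending L w) F (b :: s) - run lt ws' (pending (i :: L) w) F (h :: s))
     else 0).
  rewrite run_cons fill_same fill_fill run_push_bar0 //.
  have -> : bar0 (F i) [:: h] = 0 by rewrite /= subrr.
  rewrite run_hot0 ?addr0; [|exact: wf_tail wfL|]; last exact: fill_multilinear.
  have lu : multilinear (unitfun : seq A -> A) by apply: unitfun_multilinear.
  have H1 : run lt ws (i :: L) (upd i (lmerge h (F i)) F) s = HA.
    rewrite /HA; case: (s) => [|a s']; first exact: run_nil.
    apply: run_hot_ext => // [t'|l /negPf li]; last by rewrite /upd li.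
    by rewrite /upd eqxx.
  have H2 : run lt ws (i :: L) (upd i (bar0 (push h (F i))) F) s = D1 i.
    by rewrite /D1 /F1 fill_same fill_fill.
  have H3 : run lt ws (i :: L) (upd i (lmerge (F i [:: h]) unitfun) F) s = HB.
    rewrite -/b /HB; case: (s) => [|a s']; first exact: run_nil.
    have lb : forall l, multilinear (upd i (lmerge b unitfun) F l).
      by apply: upd_multilinear => //; apply: lmerge_multilinear.
    pose F2 := upd i unitfun F.
    rewrite (@run_hot_ext _ _ _ _ _ _ _ _ F2 a (b * a)) //; last 2 first.
    - by move=> t'; rewrite /F2 /upd eqxx.
    - by move=> l /negPf li; rewrite /F2 /upd li.
    rewrite (@run_unitfun _ _ _ _ _ _ _ i) // /F2 /=; last 2 first.
    - exact: upd_multilinear.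
    - by move=> h' s1; rewrite /upd eqxx.
    by rewrite eqxx; apply: (@run_out _ _ _ _ i) => // l /negPf li; rewrite /upd li.
  rewrite H1 H2 H3 next_rowE.
  rewrite /D3; case Ews: ws => [|w ws'].
    by rewrite scaler0 !addr0; abelian.
  have wfw : wf (w :: ws') (i :: L) by rewrite -Ews.
  have tFw : tame F (i :: L) (w :: ws') by rewrite -Ews.
  have wfw' := wf_row wfw; have mw := mem_row wfw.
  have iw : i \in pending (i :: L) w by rewrite mw.
  rewrite run_push_bar0 // -/b.
  have X1 : run lt ws' (pending (i :: L) w) (upd i (lmerge h (F i)) F) (1 :: s) =
      run lt ws' (pending (i :: L) w) F (h :: s).
    rewrite -[h in RHS]mulr1; apply/esym.
    apply: ((run_pass lt ws' (pending (i :: L) w) (1 :: s)).1 _ _ h 1 s i) => //.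
      by apply: before_merge_follows (follows_row wfw) iw _; apply: tame_before_merge.
    by split=> [|l _ /negPf li]; rewrite /upd ?eqxx ?li.
  have X7 : run lt ws' (pending (i :: L) w) (upd i (lmerge b unitfun) F) (1 :: s) =
      run lt ws' (pending L w) F (b :: s).
    have lun : forall l, multilinear (upd i unitfun F l) by apply: upd_multilinear.
    transitivity (run lt ws' (pending (i :: L) w) (upd i unitfun F) (b * 1 :: s)).
      apply/esym.
      apply: ((run_pass lt ws' (pending (i :: L) w) (1 :: s)).1 _ _ b 1 s i) => //.
        apply: before_merge_follows (follows_row wfw) iw _; have [H1' H2' H3' H4' H5'] := tame_before_merge tFw.
        by split=> // l lL li; rewrite /upd (negPf li); apply: H5'.
      by split=> [|l _ /negPf li]; rewrite /upd ?eqxx ?li.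
    rewrite mulr1 (@run_unitfun _ _ _ _ _ _ _ i) //; last first.
      by move=> h' s1; rewrite /upd eqxx.
    rewrite -rem_pending //; last by have [] := wfw.2 w (mem_head _ _).
    rewrite /= eqxx; apply: (@run_out _ _ _ _ i) => [l /negPf li|].
      by rewrite /upd li.
    by rewrite mem_pending (negPf iL').
  have -> : fill lt i (bar0 (F1 i)) F1 = upd i (bar0 (push h (F i))) F.
    by rewrite /F1 fill_same fill_fill.
  rewrite X1 X7 -/c !scalerBr; abelian.
have EK : bar K (1 :: s) = \sum_(l <- i :: L) D3 l +
    (if ws is w :: ws' then c *: face_sum ws' (pending (i :: L) w) F1 (1 :: s) else 0).
  rewrite /K /D3; case Ews: ws => [|w ws']; first by rewrite bar_0 big1 ?addr0.
  have wfw : wf (w :: ws') (i :: L) by rewrite -Ews.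
  have tFw : tame F1 (i :: L) (w :: ws') by rewrite -Ews.
  rewrite (IHw _ _ _ _ Ews) //; last exact: tame_follows (follows_row wfw) _.
  congr (_ + _); apply: perm_big; apply: uniq_perm => //; last exact: mem_row wfw.
  exact: (wf_row wfw).1.
have ES : c *: face_sum ws (i :: L) F (h :: s) =
    c *: face_sum ws (i :: L) F1 s + c *: face_sum ws L F (b :: s) - c *: K s +
    (if ws is w :: ws' then
       face_sum ws' (pending (i :: L) w) F1 (1 :: s) +
       c *: (run lt ws' (pending (i :: L) w) F (h :: s) - run lt ws' (pending L w) F (b :: s))
     else 0).
  case Ews: ws => [|w ws'].
    have -> : K s = 0 by rewrite /K Ews.
    by rewrite /face_sum !scaler0 !addr0 subr0.
  have wfw : wf (w :: ws') (i :: L) by rewrite -Ews.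
  have Esum : \sum_(k < size (w :: ws')) (-1) ^+ k *: run lt (remove_row k (w :: ws')) (i :: L) F (h :: s) =
      \sum_(k < size (w :: ws')) (-1) ^+ k *: run lt (remove_row k (w :: ws')) (i :: L) F1 s +
      (-1) ^+ (size s).+1 *: face_sum ws' (pending (i :: L) w) F1 (1 :: s) +
      \sum_(k < size (w :: ws')) (-1) ^+ k *: run lt (remove_row k (w :: ws')) L F (b :: s).
    rewrite -sum_next_row // -!big_split /=; apply: eq_bigr => k _.
    by rewrite run_cons -/F1 -/b !scalerDr.
  rewrite {1}/face_sum Esum [face_sum (w :: ws') (i :: L) F1 s]/face_sum.
  rewrite [face_sum (w :: ws') L F (b :: s)]/face_sum.
  have -> : K s = run lt ws' (pending (i :: L) w) F1 s by rewrite /K Ews.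
  rewrite !scalerBr !scalerDr scalerA exprS mulN1r mulrN -expr2 sqrr_sign scaleN1r.
  abelian.
have Es : - ((-1) ^+ (size s).-1 *: face_sum ws (i :: L) F1 s) + KK =
    c *: face_sum ws (i :: L) F1 s - c *: K s.
  rewrite /KK /c; case: (s) => [|a s']; first by rewrite face_sum_nil K0 !scaler0 subr0 oppr0 addr0.
  by rewrite /= [in RHS]exprS mulN1r !scaleNr opprK.
have SumL : \sum_(l <- L) run lt ws (i :: L) (fill lt l (bar0 (F l)) F) (h :: s) =
    - (\sum_(l <- L) D1 l) + c *: (\sum_(l <- L) D3 l) + \sum_(l <- L) D2 l.
  rewrite -sumrN scaler_sumr -!big_split /= big_seq [RHS]big_seq.
  by apply: eq_bigr => l lL; rewrite T_other.
rewrite LHS IHs // IHL //; last exact: tame_follows (follows_finish wfL) tF.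
rewrite EK ![(size (_ :: s)).-1]/= -/c ES [in RHS]big_cons T_i SumL.
rewrite -/(\sum_(l <- i :: L) D1 l) -/(\sum_(l <- L) D2 l) !(big_cons _ _ i L) -/(D1 i).
have -> : KK = c *: face_sum ws (i :: L) F1 s - c *: K s +
    (-1) ^+ (size s).-1 *: face_sum ws (i :: L) F1 s.
  by rewrite -Es addrAC addNr add0r.
have cc : c * c = 1 by rewrite /c -expr2 sqrr_sign.
rewrite !scalerDr; case: (ws) => [|w ws']; first by rewrite !scaler0; abelian.
by rewrite !scalerBr scalerA cc scale1r; abelian.
Qed.

End BarRun.

(** * Left factors and Koszul signs *)

Section Fresh.

Variables (R : comPzRingType) (A : algType R) (T : eqType) (lt : rel T).
Implicit Types (F G : T -> seq A -> A) (f g : seq A -> A).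
Implicit Types (w L : seq T) (ws : seq (seq T)) (i l : T).

(** As [inside_factor], for a factor that ends up in front of the result. *)
Definition under_factor j F L ws :=
  [/\ wf ws L, complexity2 L ws, j \in L,
      forall l, l \in L -> l != j -> stays l j (L :: ws)
    & forall l, l \in L -> l != j -> fresh (F l) \/ always l j (L :: ws)].

Lemma under_factor_follows j F L ws L' ws' : follows L ws L' ws' -> j \in L' ->
  under_factor j F L ws -> under_factor j F L' ws'.
Proof.
move=> [sL wfL' c2' st al] jL' [_ c2 jL s fr].
split=> // [|l lL lj|l lL lj]; first exact: c2'.
  by apply: st => //; apply: s; rewrite ?sL.
by case: (fr l (sL _ lL) lj) => [|H]; [left|right; apply: al].
Qed.

(** The factor is handed from label to label; the second half follows it while an
open label j holds it. *)
Lemma run_fresh ws L t :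
  (forall F h v s, t = v :: s -> wf ws L -> complexity2 L ws ->
     (forall l, l \in L -> fresh (F l)) ->
     run lt ws L F (h * v :: s) = h * run lt ws L F t) /\
  (forall F G h j, under_factor j F L ws -> F j = lmul h (G j) ->
     (forall l, l \in L -> l != j -> F l = G l) ->
     run lt ws L F t = h * run lt ws L G t).
Proof.
pattern ws, L, t; apply: run_ind ws L t => [ws L|ws x s|ws a L x s IHs IHL IHw].
- by split=> // *; rewrite !run_nil mulr0.
- split=> [F h v s' [-> ->] _ _ _|F G h j [_ _ //]].
  by rewrite !run_end; case: ifP; rewrite ?mulr0.
have next_rowH F G h j : under_factor j F (a :: L) ws -> F j = lmul h (G j) ->
    (forall l, l \in a :: L -> l != j -> F l = G l) ->
    next_row lt ws (a :: L) F s = h * next_row lt ws (a :: L) G s.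
  move=> uf Fj Fl; rewrite /next_row.
  case: ws uf IHw {IHs IHL} => [|w ws] uf IHw; first by rewrite mulr0.
  case: (uf) => wfL _ jL _ _.
  rewrite ((IHw _ _ _ _ erefl).2 F G h j) ?scalerAr //.
    by apply: under_factor_follows (follows_row wfL) _ uf; rewrite (mem_row wfL).
  by move=> l; rewrite mem_pending => /andP[lL _]; apply: Fl.
have aL := mem_head a L.
split=> [F h _ _ [<- <-] wfL c2 fr|F G h j uf Fj Fl].
  have fra := fr a aL.
  have uf : under_factor a (fill lt a (push (h * x) (F a)) F) (a :: L) ws.
    split=> // l lL la; first exact: complexity2_head.
    by left; rewrite fill_other //; case: ifP => _; [apply: fresh_tw|]; apply: fr.
  have Ea : fill lt a (push (h * x) (F a)) F a =
      lmul h (fill lt a (push x (F a)) F a).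
    by rewrite !fill_same; apply: funext => t'; apply: fra.
  have El l : l \in a :: L -> l != a ->
      fill lt a (push (h * x) (F a)) F l = fill lt a (push x (F a)) F l.
    by move=> _ la; rewrite !fill_other.
  rewrite !run_cons !mulrDr; congr (_ + _ + _).
  - exact: (IHs.2 _ _ h a).
  - exact: (next_rowH _ _ h a).
  - rewrite fra; apply: (IHL _).1 => //; first exact: wf_tail wfL.
      by have [_ _ /(_ c2)] := follows_finish wfL.
    by move=> l lL; apply: fr; rewrite inE lL orbT.
have [wfL c2 jL st fr] := uf; have uL := wfL.1.
have aL' : a \notin L by case/andP: uL.
have sL l : l \in L -> l \in a :: L by rewrite inE orbC => ->.
have uf' : under_factor j (fill lt a (push x (F a)) F) (a :: L) ws.
  split=> // l lL lj; case: (eqVneq l a) => [la|la].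
    right; rewrite la; apply: stays_always; first by apply: before_head; rewrite eq_sym -la.
    by apply: st; rewrite // -la.
  rewrite fill_other //; case: (fr l lL lj) => [frl|H]; [left|by right].
  by case: ifP => // _; apply: fresh_tw.
have Ej : fill lt a (push x (F a)) F j = lmul h (fill lt a (push x (G a)) G j).
  case: (eqVneq j a) => [<-|ja]; first by rewrite !fill_same Fj.
  by rewrite !fill_other // Fj tw_lmul; case: ifP.
have El l : l \in a :: L -> l != j ->
    fill lt a (push x (F a)) F l = fill lt a (push x (G a)) G l.
  move=> lL lj; case: (eqVneq l a) => [la|la]; first by rewrite la !fill_same Fl // -la.
  by rewrite !fill_other // Fl.
rewrite !run_cons !mulrDr; congr (_ + _ + _).
- exact: (IHs.2 _ _ h j).
- exact: (next_rowH _ _ h j).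
case: (eqVneq a j) => [aj|aj].
  have El' l : l \in L -> F l = G l.
    by move=> lL; apply: Fl (sL _ lL) _; move: lL; apply: contraTneq => ->; rewrite -aj.
  rewrite [in LHS]aj Fj /lmul -aj (@run_ext _ _ _ _ _ _ F G) => [|l b t' /El' -> //].
  apply: (IHL _).1 => //.
  - exact: wf_tail wfL.
  - by have [_ _ /(_ c2)] := follows_finish wfL.
  move=> l lL; rewrite -El' //.
  have lj : l != j by rewrite -aj; apply: contraNneq aL' => <-.
  case: (fr l (sL _ lL) lj) => // H.
  by rewrite aj in H; have /negP[] := before_head_l L j l; apply: H; apply: mem_head.
have jL' : j \in L by move: jL; rewrite inE eq_sym (negPf aj).
rewrite Fl //; apply: ((IHL _).2 F G h j) => // [|l /sL]; last exact: Fl.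
exact: under_factor_follows (follows_finish wfL) jL' uf.
Qed.

Lemma run_scale_seq (c : T -> R) S ws L F t : wf ws L -> (forall l, multilinear (F l)) ->
  uniq S -> {subset S <= L} ->
  run lt ws L (fun l => if l \in S then c l *: F l else F l) t =
  (\prod_(l <- S) c l) *: run lt ws L F t.
Proof.
move=> wfL lF; elim: S => [|i S IHS] /=; first by rewrite big_nil scale1r.
case/andP=> iS uS sS; rewrite big_cons -scalerA -IHS //; last first.
  by move=> l lS; apply: sS; rewrite inE lS orbT.
apply: (@run_scale_ext _ _ _ _ _ i) => //.
- by move=> l; case: ifP => // _; apply: multilinear_scale.
- by apply: sS; apply: mem_head.
- by move=> h s; rewrite mem_head (negPf iS).
- by move=> l h s _ /negPf li; rewrite inE li.
Qed.

Lemma run_scale_all (c : T -> R) ws L F G t : wf ws L -> (forall l, multilinear (F l)) ->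
  (forall l h s, l \in L -> G l (h :: s) = c l *: F l (h :: s)) ->
  run lt ws L G t = (\prod_(l <- L) c l) *: run lt ws L F t.
Proof.
move=> wfL lF EG; rewrite -run_scale_seq //; last exact: wfL.1.
by apply: run_ext => l h s lL; rewrite EG // lL.
Qed.

End Fresh.

Section Tournament.

Variables (R : comPzRingType) (A : algType R) (T : eqType).
Implicit Types (F G : T -> seq A -> A) (f g : seq A -> A).
Implicit Types (w L : seq T) (ws : seq (seq T)) (i l : T).

Definition has_parity (n : nat) f := forall h s, f (h :: s) != 0 -> odd (size s) = odd n.

Lemma tw_parity n f h s : has_parity n f -> tw f (h :: s) = (-1) ^+ n *: f (h :: s).
Proof.
move=> pf; have [E|/pf E] := eqVneq (f (h :: s)) 0; first by rewrite /tw E !scaler0.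
rewrite /tw /= [in LHS]signrSS.
by rewrite (signr_parity R E).
Qed.

Lemma has_parity_tw n f : has_parity n f -> has_parity n (tw f).
Proof.
move=> pf h s; rewrite (tw_parity _ _ pf) => H; apply: (pf h).
by apply: contraNneq H => ->; rewrite scaler0.
Qed.

Lemma has_parity_push n f h : has_parity n f -> has_parity n.+1 (push h f).
Proof. by move=> pf a s /pf /= <-; rewrite negbK. Qed.

Lemma run_fill_parity (lt1 lt2 : rel T) (p : T -> nat) i g ws L F t : wf ws L ->
  (forall l, multilinear (F l)) -> multilinear g -> (forall l, has_parity (p l) (F l)) ->
  run lt1 ws L (fill lt2 i g F) t =
  (-1) ^+ (\sum_(l <- L | (l != i) && lt2 i l) p l) *: run lt1 ws L (upd i g F) t.
Proof.
move=> wfL lF lg pF.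
pose c l : R := if (l != i) && lt2 i l then (-1) ^+ p l else 1.
rewrite (@run_scale_all _ _ _ _ c _ _ (upd i g F)) //.
- by congr (_ *: _); rewrite -big_mkcond -expr_sum.
- exact: upd_multilinear.
- move=> l h s _; rewrite /c /upd; case: (eqVneq l i) => [->|li] /=.
    by rewrite fill_same scale1r.
  by rewrite fill_other //; case: ifP; rewrite ?scale1r // (tw_parity _ _ (pF l)).
Qed.

Variables (lt lt' : rel T).
Hypothesis lt_total : forall i l, i != l -> lt i l = ~~ lt l i.
Hypothesis lt'_total : forall i l, i != l -> lt' i l = ~~ lt' l i.

(** The exponent of the Koszul sign relating the two orders of the cochains. *)
Definition flips (p : T -> nat) L :=
  (\sum_(i <- L) \sum_(l <- L | (i != l) && lt i l && lt' l i) p i * p l)%N.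

Lemma flips_perm p L L' : perm_eq L L' -> flips p L = flips p L'.
Proof.
move=> pL; rewrite /flips (perm_big _ pL); apply: eq_bigr => i _.
exact: perm_big.
Qed.

Lemma flips_cons p i L : uniq (i :: L) ->
  flips p (i :: L) =
  (p i * (\sum_(l <- L | lt i l (+) lt' i l) p l) + flips p L)%N.
Proof.
move=> /= /andP[iL uL]; rewrite /flips big_cons.
have -> : (\sum_(j <- L) \sum_(l <- i :: L | (j != l) && lt j l && lt' l j) p j * p l =
    \sum_(j <- L) (if (j != i) && lt j i && lt' i j then p j * p i else 0) +
    \sum_(j <- L) \sum_(l <- L | (j != l) && lt j l && lt' l j) p j * p l)%N.
  by rewrite -big_split; apply: eq_bigr => j _; rewrite big_cons; case: ifP.
rewrite big_cons eqxx /= addnA; congr (_ + _)%N.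
rewrite big_distrr /= [X in (X + _)%N]big_mkcond [RHS]big_mkcond /=.
rewrite -big_split /= big_seq [RHS]big_seq; apply: eq_bigr => l lL.
have il : i != l by apply: contraNneq iL => ->.
rewrite il eq_sym il /= (lt_total il) (lt'_total il).
by case: (lt l i); case: (lt' l i); rewrite //= ?addn0 ?add0n // mulnC.
Qed.

Lemma odd_sum_addb (P Q : pred T) (p : T -> nat) L :
  odd (\sum_(l <- L | P l (+) Q l) p l) =
  odd (\sum_(l <- L | P l) p l) (+) odd (\sum_(l <- L | Q l) p l).
Proof.
elim: L => [|l L IHL]; rewrite ?big_nil // !big_cons.
case: (P l); case: (Q l) => //=; rewrite ?oddD IHL //.
- by rewrite ?oddD addbACA addbb addFb.
- by rewrite addbA.
- by rewrite addbCA.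
Qed.

(** The order enters only through twists, which are signs on cochains of known
parity. An input taken by i changes the parity of i, hence [flips], exactly by
the difference of the twists. *)
Lemma run_tournament p F ws L t : wf ws L -> (forall l, multilinear (F l)) ->
  (forall l, has_parity (p l) (F l)) ->
  run lt ws L F t = (-1) ^+ flips p L *: run lt' ws L F t.
Proof.
move: F p; pattern ws, L, t.
apply: run_ind ws L t => [ws L|ws h s|ws i L h s IHs IHL IHw] F p wfL lF pF.
- by rewrite !run_nil scaler0.
- by rewrite !run_end /flips big_nil scale1r.
have uL := wfL.1; pose p' l := if l == i then (p i).+1 else p l.
have lF' lt1 : forall l, multilinear (fill lt1 i (push h (F i)) F l).
  exact: fill_push_multilinear.
have pF' lt1 l : has_parity (p' l) (fill lt1 i (push h (F i)) F l).
  rewrite /p'; case: eqP => [->|/eqP li]; first by rewrite fill_same; apply: has_parity_push.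
  by rewrite fill_other //; case: ifP => // _; apply: has_parity_tw.
have step ws' L' s' : perm_eq L' (i :: L) -> wf ws' L' ->
    (forall F p, wf ws' L' -> (forall l, multilinear (F l)) ->
      (forall l, has_parity (p l) (F l)) ->
      run lt ws' L' F s' = (-1) ^+ flips p L' *: run lt' ws' L' F s') ->
    run lt ws' L' (fill lt i (push h (F i)) F) s' =
    (-1) ^+ flips p (i :: L) *: run lt' ws' L' (fill lt' i (push h (F i)) F) s'.
  move=> pL wfL' IH; rewrite (IH _ p') // (flips_perm _ pL).
  have lp := multilinear_push h (lF i).
  rewrite (@run_fill_parity _ _ p) // [in RHS](@run_fill_parity _ _ p) // !scalerA -!exprD.
  congr (_ *: _); apply: signr_parity.
  rewrite !(perm_big _ pL) /= !big_cons eqxx /= !flips_cons // {1}/p' eqxx.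
  have -> : flips p' L = flips p L.
    rewrite /flips big_seq [RHS]big_seq; apply: eq_bigr => j jL.
    rewrite big_seq_cond [RHS]big_seq_cond; apply: eq_bigr => l /andP[lL _].
    have ne m : m \in L -> (m == i) = false.
      by move=> mL; apply: contraTF mL => /eqP ->; case/andP: uL.
    by rewrite /p' !ne.
  have p'L (P : pred T) : (\sum_(l <- L | P l) p' l = \sum_(l <- L | P l) p l)%N.
    rewrite big_seq_cond [RHS]big_seq_cond; apply: eq_bigr => l /andP[lL _].
    by rewrite /p' (_ : (l == i) = false) //; apply: contraTF lL => /eqP ->; case/andP: uL.
  have dropi (P : pred T) : (\sum_(l <- L | (l != i) && P l) p l = \sum_(l <- L | P l) p l)%N.
    rewrite big_seq_cond [RHS]big_seq_cond; apply: eq_bigl => l.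
    case lL: (l \in L) => //=; rewrite (_ : l != i) //.
    by apply: contraTneq lL => ->; case/andP: uL.
  rewrite !p'L !dropi !oddD !oddM odd_sum_addb /=.
  by do 4!case: (odd _).
rewrite !run_cons !scalerDr; congr (_ + _ + _).
- exact: step.
- rewrite /next_row; case: ws wfL {IHs IHL} IHw => [|w ws] wfL IHw; first by rewrite scaler0.
  rewrite scaler_swap; congr (_ *: _); apply: step; last exact: IHw.
    apply: uniq_perm => //; first exact: (wf_row wfL).1.
    exact: mem_row wfL.
  exact: wf_row.
- have wfL' := wf_tail wfL; rewrite (IHL _ _ p) //.
  have [->|nz] := eqVneq (F i [:: h]) 0; first by rewrite !run_hot0 // !scaler0.
  have /= /esym ev := pF i _ _ nz.
  congr (_ *: _); apply: signr_parity.
  by rewrite flips_cons // oddD oddM ev.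
Qed.

End Tournament.

(** * The second filtration term, and cochains as functions on pointed lists *)

Section Filtration.

Lemma variations_cons (b b' : bool) bs :
  variations [:: b, b' & bs] = ((b != b') + variations (b' :: bs))%N.
Proof. by []. Qed.

Fixpoint nondecreasing_bool (bs : seq bool) :=
  if bs is b :: bs' then (b ==> all id bs') && nondecreasing_bool bs' else true.

Lemma variations0 (b : bool) bs : (variations (b :: bs) == 0)%N -> bs = nseq (size bs) b.
Proof.
elim: bs b => //= b' bs IHbs b; rewrite variations_cons addn_eq0 eqb0 negbK.
by case/andP => /eqP -> /IHbs {1}->.
Qed.

Lemma variations_le1 (bs : seq bool) : (variations bs <= 1)%N ->
  nondecreasing_bool bs \/ nondecreasing_bool (map negb bs).
Proof.
elim: bs => [|b [|b' bs] IHbs]; [by left|by left; rewrite /= implybT|].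
rewrite variations_cons; case: (eqVneq b b') => [-> le1|bb' /=].
  have aux (c X : bool) : c ==> X -> c ==> c && X by case: c.
  by case: (IHbs le1) => /= /andP[H1 H2]; [left|right]; rewrite H1 H2 aux.
rewrite add1n ltnS leqn0 => /variations0 ->.
have H n c : nondecreasing_bool (nseq n c).
  by elim: n => //= n ->; rewrite andbT; case: c => //=; rewrite all_nseq orbT.
rewrite /= map_nseq !H !andbT; case: b b' bb' {IHbs} => -[] //= _; [right|left];
  by rewrite ?all_nseq ?orbT ?andbT.
Qed.

Lemma stays_nondecreasing (T : eqType) (i l : T) ws :
  nondecreasing_bool [seq before w i l | w <- ws] -> stays i l ws.
Proof.
elim: ws => //= w ws IHws /andP[/implyP H /IHws]; split=> // /H /allP aws v vws.
by apply: aws; apply: map_f.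
Qed.

Lemma before_neg (T : eqType) (w : seq T) i l : i != l -> i \in w -> l \in w ->
  before w l i = ~~ before w i l.
Proof.
move=> il iw lw; rewrite /before -leqNgt [in RHS]leq_eqVlt; case: eqVneq => //= E.
by rewrite -(nth_index i iw) -[l](nth_index i lw) E eqxx in il.
Qed.

Lemma full_word r (w : 'S_r) : full_row (word w).
Proof.
split; first by rewrite (perm_uniq (perm_eq_word w)) enum_uniq.
by move=> l; rewrite (perm_mem (perm_eq_word w)) mem_enum.
Qed.

Lemma restr_word_before r (i j : 'I_r) (w : 'S_r) : i != j ->
  restr_word i j w = if before (word w) i j then [:: i; j] else [:: j; i].
Proof.
move=> ij; rewrite /restr_word; have [uw mw] := full_word w.
have := mw i; have := mw j; elim: (word w) uw => //= a s IHs /andP[a_s us].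
have filt1 (x y : 'I_r) : x != y -> x \notin s -> y \in s ->
    [seq l <- s | (l == x) || (l == y)] = [:: y].
  move=> xy xs ys; rewrite (@eq_in_filter _ _ (pred1 y)); last first.
    by move=> l ls /=; case: eqP => // lx; rewrite -lx ls in xs.
  by rewrite filter_pred1_uniq.
rewrite !inE /before /= ![a == _]eq_sym.
case: (eqVneq i a) => [ia|ia] /=.
  rewrite -ia in a_s *; rewrite eq_sym (negPf ij) /= => js _.
  by rewrite filt1.
case: (eqVneq j a) => [ja|ja] /=.
  rewrite -ja in a_s * => _ iS /=; rewrite (eq_filter (a2 := fun l => (l == j) || (l == i))).
    by rewrite filt1 // eq_sym.
  by move=> l; rewrite orbC.
by move=> js iS; rewrite ltnS; exact: IHs.
Qed.

(** A two-valued sequence with at most one variation is monotone in one of the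
two directions. *)
Lemma filtration_complexity2 r d (w : (d.+1).-tuple 'S_r) u us :
  [seq word v | v <- w] = u :: us -> in_filtration 2 w -> complexity2 u us.
Proof.
move=> Ew /forallP fw.
have H (i j : 'I_r) : (i < j)%N -> stays i j (u :: us) \/ stays j i (u :: us).
  move=> ltij; have ij : i != j by rewrite neq_ltn ltij.
  have /forallP/(_ j)/implyP/(_ ltij) := fw i.
  have -> : variations [seq restr_word i j v | v <- w] =
      variations [seq before v i j | v <- u :: us].
    rewrite -Ew -map_comp; elim: (tval w) => //= a [|b s] IHs //=.
    rewrite variations_cons -IHs /= !restr_word_before //.
    rewrite /variations /=; congr (_ + _)%N; congr nat_of_bool.
    by case: before; case: before; rewrite // ?eqxx // eqseq_cons ?(negPf ij) // eq_sym (negPf ij).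
  case/variations_le1; [left|right]; apply: stays_nondecreasing => //.
  rewrite -Ew -!map_comp in b *; congr (nondecreasing_bool _): b.
  apply: eq_map => v /=; have [_ mw] := full_word v.
  by rewrite (before_neg ij).
move=> i j _ _; rewrite neq_ltn => /orP[/H //|/H].
by case; [right|left].
Qed.

End Filtration.

Section Tilde.

Variables (R : comPzRingType) (A : algType R).
Implicit Types (f g : seq A -> A).

(** The head of a pointed list acts as a left factor: this turns the first term
of the Hochschild differential into a product of neighbours. *)
Definition tilde f : seq A -> A := fun t => if t is h :: s then h * f s else 0.

Lemma tilde_lin c f g : tilde (c *: f + g) = c *: tilde f + tilde g.
Proof.
apply: funext => -[|h s]; rewrite /tilde !fctE; first by rewrite scaler0 addr0.
by rewrite mulrDr -scalerAr.
Qed.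

Lemma fresh_tilde f : fresh (tilde f).
Proof. by move=> h v t; rewrite /tilde mulrA. Qed.

Lemma tilde_multilinear (x : cochains A) : multilinear (tilde x).
Proof.
have /asboolP[lin _ _] := cochain_funP x.
move=> [|h t1] t2 c y z /=; first by rewrite mulrDl -scalerAl.
by rewrite lin mulrDr -scalerAr.
Qed.

Lemma tilde_normalized (x : cochains A) : normalized (tilde x).
Proof.
have /asboolP[_ nor _] := cochain_funP x.
by move=> [|h t1] t2 // _; rewrite /= nor mulr0.
Qed.

Lemma tilde_supp (x : cochains A) n h s : cochain_deg n x ->
  tilde x (h :: s) != 0 -> (size s)%:Z = n.
Proof.
by move=> dx; apply: contraNeq => /dx /= ->; rewrite mulr0.
Qed.

Lemma tilde_parity (x : cochains A) n : cochain_deg n x -> has_parity `|n| (tilde x).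
Proof. by move=> dx h s /(tilde_supp dx) <-. Qed.

Lemma barE g h s : bar g (h :: s) =
  \sum_(i < size s) (-1) ^+ i *: g (mul_at i (h :: s)) +
  (-1) ^+ size s *: (g (belast h s) * last h s).
Proof.
elim: s g h => [|a s IHs] g h; first by rewrite /= big_ord0 add0r scale1r subr0.
rewrite [LHS]/= -/(bar (push h g) (a :: s)) IHs /= big_ord_recl /= expr0 scale1r.
rewrite opprD addrA; congr (_ + _ + _); last by rewrite exprS mulN1r scaleNr.
by rewrite -sumrN; apply: eq_bigr => i _; rewrite /bump leq0n add1n exprS mulN1r scaleNr.
Qed.

Lemma hochschild_bar (f : seq A -> A) s :
  hochschild_fun f s = (-1) ^+ size s *: bar (tilde f) (1 :: s).
Proof.
case: s => [|a s]; first by rewrite /= mul0r subr0 scaler0.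
rewrite barE /hochschild_fun; congr (_ *: _).
rewrite big_ord_recl /= expr0 scale1r !mul1r.
by congr (_ + _ + _); apply: eq_bigr => i _; rewrite mul1r.
Qed.

Lemma bar_lmul h f t : bar (lmul h f) t = h * bar f t.
Proof.
elim: t f => [|a t IHt] f /=; first by rewrite mulr0.
rewrite -/(lmul h (push a f)) (IHt (push a f)) mulrBr; congr (_ - _).
by case: t {IHt} => [|b t]; rewrite /lmul // mulrA.
Qed.

Lemma bar0_tilde f h s : bar0 (tilde f) (h :: s) = h * bar (tilde f) (1 :: s).
Proof.
have -> : bar0 (tilde f) (h :: s) = bar (tilde f) (h :: s).
  by case: s => //=; rewrite mul0r.
have E : push h (tilde f) = lmul h (push 1 (tilde f)).
  by apply: funext => t; rewrite /push /lmul /= mul1r.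
rewrite /= E bar_lmul mulrBr; congr (_ - _).
by case: s => [|a s]; rewrite ?mul0r ?mulr0 // mul1r mulrA.
Qed.

Lemma tilde_hochschild (x : cochains A) h s :
  tilde (hochschild_diff x) (h :: s) = (-1) ^+ size s *: bar0 (tilde x) (h :: s).
Proof. by rewrite bar0_tilde /= hochschild_bar scalerAr. Qed.

End Tilde.

(** * The action of the Barratt-Eccles simplices *)

Section RunExtra.

Variables (R : comPzRingType) (A : algType R) (T : eqType) (lt : rel T).
Implicit Types (F G : T -> seq A -> A) (w L : seq T) (ws : seq (seq T)).

Lemma run_single i F h s : run lt [::] [:: i] F (h :: s) = F i (h :: s).
Proof.
elim: s h F => [|a s IHs] h F; rewrite run_cons.
  by rewrite run_nil run_end /next_row /= !add0r.
by rewrite IHs fill_same run_end /next_row /= !addr0.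
Qed.

Lemma run_sign (p : T -> nat) ws L F h s : wf ws L -> (forall l, multilinear (F l)) ->
  (forall l, has_parity (p l) (F l)) ->
  (-1) ^+ size s *: run lt ws L F (h :: s) =
  (-1) ^+ (size ws + \sum_(l <- L) p l) *: run lt ws L F (h :: s).
Proof.
move=> wfL lF pF; have := tw_run lt (h :: s) wfL lF.
rewrite (@run_scale_all _ _ _ _ (fun l => (-1) ^+ p l) _ _ F) //; last first.
  by move=> l a t _; rewrite (tw_parity _ _ (pF l)).
by rewrite -expr_sum scalerA -exprD {1}/tw /= [in LHS]signrSS.
Qed.

Definition run_rows ws F t : A := if ws is w :: ws' then run lt ws' w F t else 0.

End RunExtra.

Lemma big_full (S : Type) (idx : S) (op : Monoid.com_law idx) (I : finType) (w : seq I)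
    (P : pred I) (F : I -> S) : full_row w ->
  \big[op/idx]_(l <- w | P l) F l = \big[op/idx]_(l | P l) F l.
Proof.
move=> [uw mw]; apply: perm_big; apply: uniq_perm => //; first exact: index_enum_uniq.
by move=> l; rewrite mw mem_index_enum.
Qed.

Section Operation.

Variables (R : comPzRingType) (A : algType R).

Lemma cochain_eqP (f g : cochains A) : f =1 g -> f = g.
Proof. by move=> fg; apply: val_inj; apply: funext. Qed.

Lemma cochainE c (f g : cochains A) s : (c *: f + g : cochains A) s = c *: f s + g s.
Proof. by []. Qed.

Lemma cochain_scaleE c (f : cochains A) s : (c *: f : cochains A) s = c *: f s.
Proof. by []. Qed.

Lemma cochain_addE (f g : cochains A) s : (f + g : cochains A) s = f s + g s.
Proof. by []. Qed.

Lemma cochain_sumE (I : Type) (r : seq I) (P : pred I) (F : I -> cochains A) s :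
  (\sum_(i <- r | P i) F i) s = \sum_(i <- r | P i) F i s.
Proof. exact: (big_morph (fun f : cochains A => f s)). Qed.

Definition ord_lt r : rel 'I_r := fun i j => (i < j)%N.

Lemma ord_lt_total r (i j : 'I_r) : i != j -> ord_lt i j = ~~ ord_lt j i.
Proof. by move=> ij; rewrite /ord_lt -leqNgt [in RHS]leq_eqVlt val_eqE (negPf ij). Qed.

Definition inputs r (x : r.-tuple (cochains A)) : 'I_r -> seq A -> A :=
  fun i => tilde (tnth x i).

Definition theta_fun r d (w : (d.+1).-tuple 'S_r) (x : r.-tuple (cochains A)) (s : seq A) : A :=
  run_rows (@ord_lt r) [seq word v | v <- w] (inputs x) (1 :: s).

Lemma words_full r (ws : seq 'S_r) : full [seq word v | v <- ws].
Proof. by move=> v /mapP[w _ ->]; apply: full_word. Qed.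

Lemma tuple_words r d (w : (d.+1).-tuple 'S_r) :
  exists u us, [/\ [seq word v | v <- w] = u :: us, size us = d & full (u :: us)].
Proof.
case: w => -[//|v ws] /= /eqP[sz]; exists (word v), [seq word v | v <- ws].
by rewrite size_map -map_cons; split=> //; apply: words_full.
Qed.

Lemma inputs_multilinear r (x : r.-tuple (cochains A)) l : multilinear (inputs x l).
Proof. exact: tilde_multilinear. Qed.

Lemma inputs_normalized r (x : r.-tuple (cochains A)) l : normalized (inputs x l).
Proof. exact: tilde_normalized. Qed.

Lemma full_rows_wf (T : eqType) (u : seq T) us : full (u :: us) -> wf us u.
Proof. by move=> fu; apply: full_wf (full_tail fu) _; case: (full_head fu). Qed.

Lemma theta_fun_subproof r d (w : (d.+1).-tuple 'S_r) (x : r.-tuple (cochains A)) :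
  theta_fun w x \in @cochain_pred R A.
Proof.
have [u [us [Ew _ fu]]] := tuple_words w; rewrite /theta_fun Ew /=.
have wfu := full_rows_wf fu.
have lx l := @inputs_multilinear r x l; have nx l := @inputs_normalized r x l.
apply/asboolP; split=> [s1 s2 c y z|s1 s2|].
- by rewrite -!cat_cons (run_multilinear _ wfu lx).
- by rewrite -cat_cons run_normalized.
have bx l : {N : nat | forall s, (N <= size s)%N -> tnth x l s = 0}.
  by apply: cid; have /asboolP[] := cochain_funP (tnth x l).
pose N l := sval (bx l); exists (\sum_(l <- u) N l).+1%N => s le_s.
apply: (@run_support _ _ _ _ _ _ _ (fun l n => n <= (N l)%:Z)) => // [l a t|p Qp] .
  move=> nz; rewrite lez_nat ltnW // ltnNge; apply/negP => /(svalP (bx l)) E.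
  by apply: nz; rewrite /inputs /= E mulr0.
apply/eqP; rewrite Order.POrderTheory.gt_eqF //.
apply: (@Order.POrderTheory.le_lt_trans _ _ (\sum_(l <- u) (N l)%:Z)).
  by rewrite big_seq [X in _ <= X]big_seq; apply: Num.Theory.ler_sum.
rewrite -(big_morph Posz PoszD (erefl _)) ltz_nat; apply: leq_trans le_s _.
exact: leq_addr.
Qed.

Definition theta r d (w : (d.+1).-tuple 'S_r) (x : r.-tuple (cochains A)) : cochains A :=
  Cochains (theta_fun_subproof w x).

Lemma thetaE r d (w : (d.+1).-tuple 'S_r) (x : r.-tuple (cochains A)) s :
  theta w x s = run_rows (@ord_lt r) [seq word v | v <- w] (inputs x) (1 :: s).
Proof. by []. Qed.

Definition BE_operation r d (u : BE R r d) (x : r.-tuple (cochains A)) : cochains A :=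
  \sum_(t : simplex r d) (u t : R) *: theta (val t) x.

Lemma BE_operation_linear r d (c : R) (u v : BE R r d) x :
  BE_operation (c *: u + v) x = c *: BE_operation u x + BE_operation v x.
Proof.
rewrite /BE_operation scaler_sumr -big_split; apply: eq_bigr => t _.
by rewrite !ffunE /= scalerDl scalerA.
Qed.

Lemma BE_operation_sum r d x (I : finType) (P : pred I) (c : I -> R) (u : I -> BE R r d) :
  BE_operation (\sum_(i | P i) c i *: u i) x = \sum_(i | P i) c i *: BE_operation (u i) x.
Proof.
apply: (big_ind2 (fun (u : BE R r d) (f : cochains A) => BE_operation u x = f)).
- rewrite /BE_operation big1 // => t _; by rewrite ffunE scale0r.
- move=> u1 f1 u2 f2 <- <-; rewrite -[u1]scale1r BE_operation_linear !scale1r //.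
- move=> i _; rewrite -[c i *: u i]addr0 BE_operation_linear.
  rewrite [X in _ + X](_ : _ = 0) ?addr0 // /BE_operation big1 // => t _.
  by rewrite ffunE scale0r.
Qed.

Lemma not_sorted_neq (T : eqType) (w : seq T) : ~~ sorted [rel u v | u != v] w ->
  exists ws1 v ws2, w = ws1 ++ v :: v :: ws2.
Proof.
case: w => //= v w; elim: w v => //= v' w IHw v; rewrite negb_and negbK.
case/orP=> [/eqP ->|/IHw [ws1 [a [ws2 E]]]]; first by exists [::], v', w.
by exists (v :: ws1), a, ws2; rewrite E.
Qed.

Lemma theta_degenerate r d (w : (d.+1).-tuple 'S_r) x :
  ~~ sorted [rel u v | u != v] w -> theta w x = 0.
Proof.
move=> /not_sorted_neq [ws1 [v [ws2 Ew]]]; apply: cochain_eqP => s /=.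
have [u [us [Ews _ fu]]] := tuple_words w; rewrite /theta_fun Ews /=.
apply: (@run_stutter _ _ _ _ u us [seq word v | v <- ws1] (word v) (word v)
  [seq word v | v <- ws2]) => //.
- by rewrite -Ews Ew map_cat.
- by case: (full_head fu).
- by apply/all_filterP/allP.
- exact: full_rows_wf.
- exact: inputs_multilinear.
- exact: inputs_normalized.
Qed.

(** The class of a degenerate tuple is 0, and so is its action by
[run_stutter]. *)
Lemma BE_operation_gen r d (w : (d.+1).-tuple 'S_r) x :
  BE_operation (BE_gen R w) x = theta w x.
Proof.
rewrite /BE_operation; have [sw|nsw] := boolP (sorted [rel u v | u != v] w).
  rewrite (bigD1 (Sub w sw : simplex r d)) //= big1 ?addr0 => [|t].
    by rewrite ffunE /= eqxx scale1r.
  by rewrite -val_eqE /= => /negPf nt; rewrite ffunE nt scale0r.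
rewrite theta_degenerate // big1 // => t _; rewrite ffunE.
case: eqP => [Et|_]; last by rewrite scale0r.
by have := valP t; rewrite Et (negPf nsw).
Qed.

Lemma BE_operation_multilinear r d (u : BE R r d) (x : r.-tuple (cochains A))
    (i : 'I_r) (c : R) y z :
  BE_operation u (set_tnth x i (c *: y + z)) =
  c *: BE_operation u (set_tnth x i y) + BE_operation u (set_tnth x i z).
Proof.
rewrite /BE_operation scaler_sumr -big_split; apply: eq_bigr => t _ /=.
rewrite scaler_swap -scalerDr; congr (_ *: _); apply: cochain_eqP => s.
rewrite cochainE /= /theta_fun; have [w [ws [-> _ fu]]] := tuple_words (val t) => /=.
apply: (@run_label_lin _ _ _ _ _ i); do 1?exact: inputs_multilinear.
- exact: full_rows_wf.
- by case: (full_head fu).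
split=> [|l /negPf li]; rewrite /inputs !tnth_mktuple ?eqxx ?li //.
by rewrite -tilde_lin.
Qed.

Lemma BE_operation_degree r d (u : BE R r d) (m : r.-tuple int) (x : r.-tuple (cochains A)) :
  homogeneous (@cochain_deg R A) m x ->
  cochain_deg (\sum_(i < r) tnth m i - d%:Z) (BE_operation u x).
Proof.
move=> hx s sz; rewrite cochain_sumE big1 // => t _.
rewrite cochain_scaleE /= /theta_fun.
have [w [ws [-> sz_ws fu]]] := tuple_words (val t) => /=.
rewrite (@run_support _ _ _ _ _ _ _ (fun l n => n = tnth m l)) ?scaler0 //.
- exact: full_rows_wf.
- exact: inputs_multilinear.
- by move=> l a t' /eqP/(tilde_supp (hx l)).
- move=> p Ep E; case/eqP: sz; rewrite PoszD sz_ws in E.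
  rewrite -[LHS](addrK d%:Z) E; congr (_ - _); rewrite -(@big_full _ _ _ _ w) /=; last exact: full_head fu.
  by rewrite big_seq [RHS]big_seq; apply: eq_bigr => l lw; rewrite Ep.
Qed.

Lemma BE_operation_unit (x : 1.-tuple (cochains A)) :
  BE_operation (BE_unit R) x = tnth x ord0.
Proof.
rewrite BE_operation_gen; apply: cochain_eqP => s; rewrite /= /theta_fun.
have -> : [seq word v | v <- [tuple (1%g : 'S_1)]] = [:: [:: ord0]].
  by rewrite /= /word enum_ordSl (size0nil (size_enum_ord 0)) /= perm1.
by rewrite /run_rows run_single /inputs /tilde mul1r.
Qed.

(** Renaming the labels by s only changes the order with respect to which the
Koszul signs are taken. *)
Lemma theta_act r d (w : (d.+1).-tuple 'S_r) (s : 'S_r) (m : r.-tuple int)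
    (x : r.-tuple (cochains A)) : homogeneous (@cochain_deg R A) m x ->
  theta [tuple of [seq (v * s)%g | v <- w]] x =
  (-1) ^+ koszul_exp m s *: theta w [tuple tnth x (s i) | i < r].
Proof.
move=> hx; apply: cochain_eqP => t; rewrite cochain_scaleE /= /theta_fun /=.
have [u [us [Ew _ fu]]] := tuple_words w.
have -> : [seq word v | v <- [seq (v * s)%g | v <- w]] =
    [seq [seq s i | i <- v] | v <- u :: us].
  rewrite -Ew -!map_comp; apply: eq_map => v /=.
  by rewrite /word -[RHS]map_comp; apply: eq_map => i; rewrite /= permM.
rewrite Ew /=; pose lts : rel 'I_r := fun i j => ord_lt (s i) (s j).
have ltsT i j : i != j -> lts i j = ~~ lts j i.
  by move=> ij; apply: ord_lt_total; rewrite (inj_eq perm_inj).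
rewrite (@run_relabel _ _ _ _ lts _ s predT _ _ us u (inputs [tuple tnth x (s i) | i < r])) //.
- rewrite (@run_tournament _ _ _ lts (@ord_lt r) ltsT (@ord_lt_total r)
    (fun l => `|tnth m (s l)|%N)) //; last 3 first.
  + exact: full_rows_wf.
  + exact: inputs_multilinear.
  + by move=> l; rewrite /inputs tnth_mktuple; apply: tilde_parity.
  have fuu := full_head fu; congr (_ ^+ _ *: _); rewrite /flips big_full //.
  under eq_bigr do rewrite big_full //.
  rewrite pair_big_dep /= /koszul_exp.
  rewrite (reindex_inj (_ : injective (fun q : 'I_r * 'I_r => (q.2, q.1)))); last first.
    by move=> [a b] [c e] [-> ->].
  apply: eq_big => [[a b]|[a b] _] /=; last exact: mulnC.
  rewrite /lts /ord_lt; case: (ltnP a b) => [ab|_]; last by rewrite andbF.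
  by rewrite neq_ltn ab orbT andbT.
- by move=> i j _ _; apply: perm_inj.
- by move=> l h a _; rewrite /inputs tnth_mktuple.
Qed.

Lemma BE_operation_act r d (u : BE R r d) (s : 'S_r) (m : r.-tuple int)
    (x : r.-tuple (cochains A)) : homogeneous (@cochain_deg R A) m x ->
  BE_operation (BE_act s u) x =
  (-1) ^+ koszul_exp m s *: BE_operation u [tuple tnth x (s i) | i < r].
Proof.
move=> hx; rewrite BE_operation_sum scaler_sumr; apply: eq_bigr => t _.
by rewrite BE_operation_gen (theta_act _ _ hx) scaler_swap.
Qed.

Lemma has_parity_diff (x : cochains A) n : has_parity n (tilde x) ->
  has_parity n.+1 (tilde (hochschild_diff x)).
Proof.
move=> px h s; rewrite tilde_hochschild bar0_tilde; apply: contraNeq => odd_s.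
rewrite (@bar_homog _ _ 0 (tilde x) 0) ?scale0r ?mulr0 ?scaler0 //.
move=> [|a t] [sz]; rewrite scale0r //; apply/eqP; apply: contraNT odd_s => nz; have E := px _ _ nz.
by rewrite /= -E -sz /=.
Qed.

Lemma map_remove_row (T : eqType) (T' : eqType) (f : T -> seq T') k ws :
  [seq f v | v <- take k ws ++ drop k.+1 ws] = remove_row k [seq f v | v <- ws].
Proof. by rewrite /remove_row map_cat map_take map_drop. Qed.

Lemma BE_face_words r d (i : 'I_d.+2) (w : (d.+2).-tuple 'S_r) :
  [seq word v | v <- BE_face i w] = remove_row i [seq word v | v <- w].
Proof.
rewrite -map_remove_row; congr map; apply: (@eq_from_nth _ 1%g) => [|j].
  by rewrite size_tuple size_cat size_takel ?size_drop size_tuple //; have := ltn_ord i; lia.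
rewrite size_tuple => lt_j; rewrite -[j in LHS]/(val (Ordinal lt_j)) -tnth_nth tnth_mktuple.
rewrite (tnth_nth 1%g) /= nth_cat size_takel ?size_tuple; last by have := ltn_ord i; lia.
rewrite /bump; case: (ltnP j i) => ij; first by rewrite nth_take.
by rewrite nth_drop add1n addSn subnKC.
Qed.

(** [bar_run] for extended cochains; what is left is to express the twists by the
degrees of the inputs. *)
Theorem theta_diff r d (w : (d.+1).-tuple 'S_r) (m : r.-tuple int)
    (x : r.-tuple (cochains A)) :
  in_filtration 2 w -> homogeneous (@cochain_deg R A) m x ->
  hochschild_diff (theta w x) =
    (match d return (d.+1).-tuple 'S_r -> cochains A with
     | 0 => fun _ => 0
     | d'.+1 => fun w => \sum_(i < d'.+2) (-1) ^+ i *: theta (BE_face i w) x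
     end w) +
    (-1) ^+ d *: \sum_(i < r) (-1) ^+ deg_before m i *:
                   theta w (set_tnth x i (hochschild_diff (tnth x i))).
Proof.
move=> fw hx; have [u [us [Ew sz fu]]] := tuple_words w.
have c2 := filtration_complexity2 Ew fw.
have wfu := full_rows_wf fu; have [uu mu] := full_head fu.
have lF := @inputs_multilinear r x.
have fF l : fresh (inputs x l) by apply: fresh_tilde.
(* no cochain has started *)
have tF : tame (inputs x) u us by split=> // l _; left.
pose p l := `|tnth m l|%N.
have pF l : has_parity (p l) (inputs x l) by apply: tilde_parity.
apply: cochain_eqP => s; rewrite cochain_addE [LHS]/= hochschild_bar.
have -> : tilde (theta_fun w x) = run (@ord_lt r) us u (inputs x).
  apply: funext => -[|h t]; rewrite /= ?run_nil // /theta_fun Ew /=.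
  by rewrite -[h in RHS]mulr1 ((run_fresh _ us u (1 :: t)).1 _ h 1 t).
rewrite (bar_run (@ord_lt_total r)) // scalerDr addrC; congr (_ + _).
  rewrite scalerA -expr2 sqrr_sign scale1r /face_sum.
  case: d w Ew sz {fw} => [|d'] w Ew sz; first by move/size0nil: sz => ->.
  case: us Ew sz fu wfu c2 tF => // v us Ew [sz] fu wfu c2 tF; subst d'.
  rewrite cochain_sumE [in RHS]big_ord_recl cochain_scaleE scale1r.
  rewrite thetaE.
  have [uv mv] := full_head (full_tail fu).
  have E0 : remove_row 0 (u :: v :: us) = v :: us by rewrite /remove_row /= ?drop0.
  congr (_ + _).
    rewrite BE_face_words Ew E0 /=; congr (run _ _ _ _ _).
    by apply/all_filterP/allP.
  rewrite -sumrN; apply: eq_bigr => k _.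
  rewrite cochain_scaleE thetaE BE_face_words Ew lift0.
  by rewrite /= exprS mulN1r scaleNr.
rewrite cochain_scaleE cochain_sumE big_full // !scaler_sumr; apply: eq_bigr => l _.
rewrite cochain_scaleE thetaE Ew /run_rows.
set y := set_tnth x l _.
have yl : inputs y l = tilde (hochschild_diff (tnth x l)).
  by rewrite /inputs tnth_mktuple eqxx.
have yj j : j != l -> inputs y j = inputs x j.
  by move=> /negPf jl; rewrite /inputs tnth_mktuple jl.
pose p' j := if j == l then (p l).+1 else p j.
have py j : has_parity (p' j) (inputs y j).
  rewrite /p'; case: (eqVneq j l) => [->|jl]; last by rewrite yj.
  by rewrite yl; apply: has_parity_diff; apply: pF.
rewrite (@run_fill_parity _ _ _ _ _ p) //; last by apply: bar0_multilinear; apply: lF.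
rewrite (@run_scale_ext _ _ _ _ ((-1) ^+ (p l).+1) l _ _ (inputs y)) //; first last.
- by move=> j h t _ jl; rewrite /upd (negPf jl) yj.
- move=> h t; rewrite /upd eqxx; have := py l; rewrite /p' eqxx => pl.
  rewrite -(tw_parity _ _ pl) yl /tw tilde_hochschild scalerA /=.
  by rewrite [in RHS]signrSS -expr2 sqrr_sign scale1r.
- exact: inputs_multilinear.
rewrite scaler_swap [X in _ *: X]scaler_swap (@run_sign R A _ (@ord_lt r) p' us u (inputs y) 1 s wfu (@inputs_multilinear _ y) py).
rewrite !scalerA -!exprD sz; congr (_ *: _).
have Eu P f : (\sum_(j <- u | P j) f j = \sum_(j | P j) f j)%N by apply: big_full.
rewrite !Eu.
have -> : (\sum_j p' j = deg_before m l + (p l).+1 +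
    \sum_(j | (j != l) && ord_lt l j) p j)%N.
  rewrite (bigD1 l) //= {1}/p' eqxx addnC addnAC; congr (_ + _)%N.
  rewrite (bigID (fun j : 'I_r => (j < l)%N)) /=; congr (_ + _)%N.
    apply: eq_big => [j|j /andP[/negPf jl _]]; last by rewrite /p' jl.
    by apply: andb_idl => jl; rewrite neq_ltn jl.
  apply: eq_big => [j|j /andP[/negPf jl _]]; last by rewrite /p' jl.
  by case: (eqVneq j l) => //= jl; rewrite -leqNgt /ord_lt ltn_neqAle eq_sym jl.
set a := (\sum_(j | _) p j)%N; apply: signr_parity.
rewrite !oddD /=.
by case: (odd a); case: (odd (p l)); case: (odd d); case: (odd _).
Qed.

Theorem BE_operation_diff r d (u : BE R r d) (m : r.-tuple int)
    (x : r.-tuple (cochains A)) :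
  BE_filtration 2 u -> homogeneous (@cochain_deg R A) m x ->
  hochschild_diff (BE_operation u x) =
    BE_operation (BE_diff u) x +
    (-1) ^+ d *: \sum_(i < r) (-1) ^+ deg_before m i *:
                   BE_operation u (set_tnth x i (hochschild_diff (tnth x i))).
Proof.
move=> fu hx.
have dlin c (f g : cochains A) :
    hochschild_diff (c *: f + g) = c *: hochschild_diff f + hochschild_diff g.
  apply: cochain_eqP => s; rewrite cochainE /= !hochschild_bar.
  have -> : tilde (c *: f + g : cochains A) = c *: tilde f + tilde g.
    by rewrite -tilde_lin.
  by rewrite bar_lin scalerDr scaler_swap.
have d0 : hochschild_diff (0 : cochains A) = 0.
  by have := dlin (-1) 0 0; rewrite scaler0 addr0 scaleN1r addNr.
rewrite {1}/BE_operation.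
have -> : hochschild_diff (\sum_(t : simplex r d) (u t : R) *: theta (val t) x) =
    \sum_(t : simplex r d) (u t : R) *: hochschild_diff (theta (val t) x).
  apply: (big_ind2 (fun f g : cochains A => hochschild_diff f = g)) => //.
  - by move=> f1 g1 f2 g2 <- <-; rewrite -[f1]scale1r dlin !scale1r.
  - by move=> t _; rewrite -[_ *: _]addr0 dlin d0 addr0.
have E (t : simplex r d) : (u t : R) *: hochschild_diff (theta (val t) x) =
   (u t : R) *: (match d return (d.+1).-tuple 'S_r -> cochains A with
     | 0 => fun _ => 0
     | d'.+1 => fun w => \sum_(i < d'.+2) (-1) ^+ i *: theta (BE_face i w) x
     end (val t) +
    (-1) ^+ d *: \sum_(i < r) (-1) ^+ deg_before m i *:
                   theta (val t) (set_tnth x i (hochschild_diff (tnth x i)))).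
  have [->|nz] := eqVneq (u t) 0; first by rewrite !scale0r.
  by rewrite (theta_diff (fu t nz) hx).
under eq_bigr do rewrite E scalerDr.
rewrite big_split /=; congr (_ + _).
  case: d u fu E => [|d] u fu E.
    rewrite [LHS]big1 ?[RHS]big1 // => t _; first by rewrite ffunE scale0r.
    by rewrite scaler0.
  rewrite /BE_diff BE_operation_sum; apply: eq_bigr => t _; congr (_ *: _).
  by rewrite BE_operation_sum; apply: eq_bigr => i _; rewrite BE_operation_gen.
under eq_bigr do rewrite scaler_swap scaler_sumr.
rewrite -scaler_sumr exchange_big; congr (_ *: _); apply: eq_bigr => i _.
rewrite /BE_operation scaler_sumr; apply: eq_bigr => t _.
by rewrite scaler_swap.
Qed.

End Operation.

(** * Lattice paths and shuffles of words *)

Section PathSteps.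

(** Paths are turned into sequences of steps, true for a horizontal one, in order
to recurse along them. *)
Definition path_set n (b : n.-tuple bool) : {set 'I_n} := [set i | tnth b i].

Fixpoint step_inv (b : seq bool) : nat :=
  if b is c :: b' then ((if c then 0 else count id b') + step_inv b')%N else 0%N.

Lemma path_set_bij n : bijective (@path_set n).
Proof.
exists (fun S : {set 'I_n} => [tuple i \in S | i < n]) => [b|S].
  by apply: eq_from_tnth => i; rewrite tnth_mktuple inE.
by apply/setP => i; rewrite inE tnth_mktuple.
Qed.

Lemma count_take_sum (b : seq bool) (P : pred bool) t :
  (\sum_(i < size b) (P (nth false b i) && (i < t)%N) = count P (take t b))%N.
Proof.
elim: b t => [|c b IHb] [|t]; rewrite ?big_ord0 //= big_ord_recl /=.
  by rewrite andbF big1 // => i _; rewrite andbF.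
by rewrite andbT -IHb.
Qed.

Lemma path_x_count n (b : n.-tuple bool) t : path_x (path_set b) t = count id (take t b).
Proof.
rewrite /path_x -sum1_card big_mkcond /= -count_take_sum size_tuple.
by apply: eq_bigr => i _; rewrite !inE (tnth_nth false); case: (_ && _).
Qed.

Lemma path_y_count n (b : n.-tuple bool) t : path_y (path_set b) t = count negb (take t b).
Proof.
rewrite /path_y -sum1_card big_mkcond /= -(@count_take_sum _ negb) size_tuple.
by apply: eq_bigr => i _; rewrite !inE (tnth_nth false); case: (_ && _).
Qed.

Lemma path_set_card n (b : n.-tuple bool) : #|path_set b| = count id b.
Proof.
rewrite -[in RHS](take_oversize (_ : (size b <= n)%N)) ?size_tuple // -path_x_count.
by rewrite /path_x; congr #|pred_of_set _|; apply/setP => i; rewrite !inE ltn_ord andbT.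
Qed.

Lemma step_inv_sum (b : seq bool) :
  step_inv b = (\sum_(i < size b) \sum_(j < size b)
    [&& (i < j)%N, ~~ nth false b i & nth false b j])%N.
Proof.
elim: b => [|c b IHb] /=; first by rewrite big_ord0.
rewrite big_ord_recl big_ord_recl /= add0n IHb; congr (_ + _)%N.
  case: c => /=; first by rewrite big1.
  rewrite -[in LHS](take_size b) -count_take_sum; apply: eq_bigr => i _.
  by rewrite ltn_ord andbT.
by apply: eq_bigr => i _; rewrite big_ord_recl /= add0n.
Qed.

Lemma path_inv_steps n (b : n.-tuple bool) : path_inv (path_set b) = step_inv b.
Proof.
have Eb (c : bool) : (if c then 1 else 0)%N = c by case: c.
rewrite /path_inv -sum1_card big_mkcond /= step_inv_sum size_tuple pair_bigA /=.
by apply: eq_bigr => -[i j] _; rewrite Eb !inE /= !(tnth_nth false).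
Qed.

Lemma big_tuple_cons (V : nmodType) n (F : n.+1.-tuple bool -> V) :
  \sum_b F b = \sum_(b : n.-tuple bool) F [tuple of true :: b] +
               \sum_(b : n.-tuple bool) F [tuple of false :: b].
Proof.
rewrite (reindex (fun p : bool * n.-tuple bool => [tuple of p.1 :: p.2])) /=; last first.
  apply: onW_bij; exists (fun b : n.+1.-tuple bool => (thead b, [tuple of behead b])).
    by move=> [c b]; congr (_, _); apply: val_inj.
  by move=> b; rewrite [RHS]tuple_eta.
rewrite -(pair_bigA _ (fun c (b : n.-tuple bool) => F [tuple of c :: b])) /=.
by rewrite big_bool.
Qed.

Variables (Tu Tv : eqType) (k : Tu).
Implicit Types (u : seq Tu) (us : seq (seq Tu)) (v : seq Tv) (vs : seq (seq Tv)).

Fixpoint path_rows (b : seq bool) u us v vs : seq (seq (Tu + Tv)%type) :=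
  subst k u v ::
  match b, us, vs with
  | true :: b', u1 :: us', _ => path_rows b' u1 us' v vs
  | false :: b', _, v1 :: vs' => path_rows b' u us v1 vs'
  | _, _, _ => [::]
  end.

Lemma path_rows_cons c b u us v vs : path_rows (c :: b) u us v vs = subst k u v ::
  if c then (if us is u1 :: us' then path_rows b u1 us' v vs else [::])
  else (if vs is v1 :: vs' then path_rows b u us v1 vs' else [::]).
Proof. by case: c; case: us; case: vs. Qed.

Lemma path_rows_nth b u us v vs : (count id b <= size us)%N -> (count negb b <= size vs)%N ->
  path_rows b u us v vs =
  [seq subst k (nth u (u :: us) (count id (take t b)))
               (nth v (v :: vs) (count negb (take t b))) | t <- iota 0 (size b).+1].
Proof.
elim: b u us v vs => [|c b IHb] u us v vs // le_u le_v.
have -> : iota 0 (size (c :: b)).+1 = 0%N :: [seq t.+1 | t <- iota 0 (size b).+1].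
  by rewrite -(iotaDl 1 0).
rewrite map_cons -map_comp path_rows_cons; congr (_ :: _); move: le_u le_v.
have bnd (P : pred bool) t : (count P (take t b) <= count P b)%N.
  by rewrite -[X in (_ <= count P X)%N](cat_take_drop t) count_cat leq_addr.
have take_cons c' t : take t.+1 (c' :: b) = c' :: take t b by [].
case: c => le_u le_v.
  case: us le_u => // u1 us le_u; rewrite IHb //; apply: eq_map => t /=.
  by rewrite add0n (set_nth_default u1) // ltnS; apply: leq_trans (bnd id t) le_u.
case: vs le_v => // v1 vs le_v; rewrite IHb //; apply: eq_map => t /=.
by rewrite add0n [in RHS](set_nth_default v1) // ltnS; apply: leq_trans (bnd negb t) le_v.
Qed.

Lemma sum_path_rows (R : comPzRingType) (V : lmodType R) (K : seq (seq (Tu + Tv)%type) -> V)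
    n u us v vs : n = (size us + size vs)%N ->
  \sum_(b : n.-tuple bool | count id b == size us)
     (-1) ^+ step_inv b *: K (path_rows b u us v vs) =
  \sum_(p <- shuffles k u us v vs) (-1) ^+ p.1 *: K (subst k u v :: p.2).
Proof.
elim: n u us v vs K => [|n IHn] u us v vs K En.
  case: us vs En => [|//] [|//] _; rewrite shufflesE /= big_seq1 /=.
  rewrite (big_pred1 [tuple]) // => b /=; rewrite tuple0; by apply/esym/eqP; apply: val_inj.
rewrite big_mkcond big_tuple_cons -!big_mkcond /= shufflesE big_cat /=.
rewrite [X in _ = X + _](_ : _ = 0); last first.
  by case: ifP => // [/andP[/nilP E1 /nilP E2]|]; rewrite ?big_nil //; rewrite E1 E2 in En.
rewrite add0r big_cat; congr (_ + _).
  case: us En => [|u1 us] /= En; first by rewrite big_nil big1 // => b /eqP.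
  case: En => En.
  by rewrite big_map /= -(IHn _ _ _ _ (fun r => K (subst k u v :: r))).
case: vs En => [|v1 vs] /= En.
  rewrite big_nil big1 // => b; rewrite add0n => /eqP E.
  by have := count_size id b; rewrite size_tuple E; lia.
rewrite big_map /=; under [RHS]eq_bigr do rewrite exprD -scalerA.
rewrite -scaler_sumr -(IHn _ _ _ _ (fun r => K (subst k u v :: r))); last by lia.
rewrite scaler_sumr; apply: eq_big => [b|b]; rewrite add0n // => /eqP <-.
by rewrite scalerA -exprD.
Qed.

End PathSteps.

(** * Compatibility with the operadic composition *)

Section OperadicComposition.

Variables (R : comPzRingType) (A : algType R).

Section Labels.

Variables (r s : nat) (k : 'I_r).

(** The numbering of labels in u o_k v; inl k is not used, whence
[proper_label]. *)
Definition comp_label (y : 'I_r + 'I_s) : nat :=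
  match y with
  | inl l => if (k < l)%N then (l + s).-1 else l
  | inr j => (k + j)%N
  end.

Definition proper_label : {pred ('I_r + 'I_s)%type} :=
  fun y => if y is inl l then l != k else true.

Lemma comp_label_inj : {in proper_label &, injective comp_label}.
Proof.
move=> [l|j] [l'|j'] kl kl' /eqP E.
- have {}kl : (l : nat) != k := kl; have {}kl' : (l' : nat) != k := kl'.
  congr inl; apply/val_inj/eqP; move: E; have := ltn_ord l; have := ltn_ord l'.
  by rewrite /=; case: (ltnP k l); case: (ltnP k l'); lia.
- have {}kl : (l : nat) != k := kl; exfalso; move: E; have := ltn_ord j'.
  by rewrite /=; case: (ltnP k l); lia.
- have {}kl' : (l' : nat) != k := kl'; exfalso; move: E; have := ltn_ord j.
  by rewrite /=; case: (ltnP k l'); lia.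
- by congr inr; apply/val_inj/eqP; move: E => /=; rewrite eqn_add2l.
Qed.

Lemma comp_label_lt : {in proper_label &, forall y z,
  ltn (comp_label y) (comp_label z) = slt (@ord_lt r) (@ord_lt s) k y z}.
Proof.
move=> [l|j] [l'|j'] kl kl'; rewrite /= /ord_lt.
- have {}kl : (l : nat) != k := kl; have {}kl' : (l' : nat) != k := kl'.
  have := ltn_ord l; have := ltn_ord l'.
  by case: (ltnP k l); case: (ltnP k l'); lia.
- have {}kl : (l : nat) != k := kl.
  by have := ltn_ord j'; case: (ltnP k l); lia.
- have {}kl' : (l' : nat) != k := kl'.
  by have := ltn_ord j; case: (ltnP k l'); lia.
- by rewrite ltn_add2l.
Qed.

Lemma comp_label_subst (u : 'S_r) (v : 'S_s) :
  map comp_label (subst k (word u) (word v)) = subst_word k u v.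
Proof.
rewrite /subst map_flatten -map_comp /subst_word; congr flatten; apply: eq_map => l /=.
by case: eqP => // _; rewrite -map_comp.
Qed.

End Labels.

Lemma run_nat_labels N (u : seq 'I_N) us (F : 'I_N -> seq A -> A) Fn t :
  (forall l h s, Fn (val l) (h :: s) = F l (h :: s)) ->
  run (@ord_lt N) us u F t = run ltn [seq map val w | w <- us] (map val u) Fn t.
Proof.
move=> E; rewrite (@run_relabel _ _ _ _ (@ord_lt N) ltn val predT _ _ us u F) //.
by move=> i j _ _; apply: val_inj.
Qed.

Lemma theta_multilinear r d (w : (d.+1).-tuple 'S_r) (x : r.-tuple (cochains A))
    (i : 'I_r) (I : finType) (c : I -> R) (f : I -> cochains A) :
  theta w (set_tnth x i (\sum_j c j *: f j)) =
  \sum_j c j *: theta w (set_tnth x i (f j)).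
Proof.
have lin a y z : theta w (set_tnth x i (a *: y + z)) =
    a *: theta w (set_tnth x i y) + theta w (set_tnth x i z).
  by rewrite -!BE_operation_gen BE_operation_multilinear.
have lin0 : theta w (set_tnth x i 0) = 0.
  by have := lin (-1) 0 0; rewrite scaler0 addr0 scaleN1r addNr.
apply: (big_ind2 (fun y z => theta w (set_tnth x i y) = z)) => //.
- by move=> y1 z1 y2 z2 <- <-; rewrite -[y1]scale1r lin !scale1r.
- by move=> j _; rewrite -[_ *: _]addr0 lin lin0 addr0.
Qed.

Definition comp_inputs r s (k : 'I_r) (x : (r + s).-1.-tuple (cochains A))
    (y : s.-tuple (cochains A) -> cochains A) : r.-tuple (cochains A) :=
  [tuple if (i < k)%N then x`_i
         else if i == k then y [tuple x`_(k + j) | j < s]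
         else x`_(i + s).-1 | i < r].

Lemma homogeneous_nth N (m : N.-tuple int) (x : N.-tuple (cochains A)) i :
  homogeneous (@cochain_deg R A) m x -> has_parity (absz m`_i) (tilde x`_i).
Proof.
move=> hx; case: (ltnP i N) => [ltiN|leNi].
  by rewrite -!(tnth_nth 0 _ (Ordinal ltiN)); apply: tilde_parity.
by move=> h s; rewrite [x`_i]nth_default ?size_tuple //= mulr0 eqxx.
Qed.

Lemma path_words r s d e (k : 'I_r) (a : (d.+1).-tuple 'S_r) (b : (e.+1).-tuple 'S_s)
    (p : (d + e).-tuple bool) u us v vs :
  [seq word w | w <- a] = u :: us -> [seq word w | w <- b] = v :: vs ->
  count id p = d ->
  [seq map val (word w) | w <- [tuple perm_comp k (tnth a (inord (path_x (path_set p) t)))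
                              (tnth b (inord (path_y (path_set p) t))) | t < (d + e).+1]] =
  [seq map (@comp_label r s k) w | w <- path_rows k p u us v vs].
Proof.
move=> Ea Eb cp; have szu : size us = d by have := congr1 size Ea; rewrite size_map size_tuple => -[].
have szv : size vs = e by have := congr1 size Eb; rewrite size_map size_tuple => -[].
have cn : count negb p = e by have := count_predC id p; rewrite cp size_tuple => /addnI.
rewrite path_rows_nth ?cp ?cn ?szu ?szv // size_tuple -val_enum_ord.
rewrite -(val_ord_tuple (d + e).+1) /= -!map_comp; apply: eq_map => t /=.
have bnd (P : pred bool) : (count P (take t p) <= count P p)%N.
  by rewrite -[X in (_ <= count P X)%N](cat_take_drop t) count_cat leq_addr.
rewrite word_perm_comp path_x_count path_y_count -comp_label_subst.
have bd : (count id (take t p) <= d)%N by rewrite -[X in (_ <= X)%N]cp.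
have be : (count negb (take t p) <= e)%N by rewrite -[X in (_ <= X)%N]cn.
rewrite !(tnth_nth 1%g) !inordK ?ltnS // -Ea -Eb.
by rewrite !(nth_map 1%g) ?size_tuple ?ltnS.
Qed.

Lemma twn_parity n e (f : seq A -> A) h t : has_parity n f ->
  twn e f (h :: t) = (-1) ^+ (e * n) *: f (h :: t).
Proof.
move=> pf; have [E|/pf E] := eqVneq (f (h :: t)) 0; first by rewrite /twn E !scaler0.
rewrite /twn /=; congr (_ *: _); apply: signr_parity.
by rewrite !oddM /= negbK E.
Qed.

(** [shuffle_runE] after numbering the labels; the sign left is that of v passing
the inputs in front of k. *)
Theorem theta_comp r s d e (k : 'I_r) (a : (d.+1).-tuple 'S_r) (b : (e.+1).-tuple 'S_s)
    (m : (r + s).-1.-tuple int) (x : (r + s).-1.-tuple (cochains A)) :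
  in_filtration 2 b -> homogeneous (@cochain_deg R A) m x ->
  BE_operation (BE_gen_comp R k a b) x =
  (-1) ^+ (e * deg_before m k) *: theta a (comp_inputs k x (theta b)).
Proof.
move=> fb hx; have [u [us [Ea szu fu]]] := tuple_words a.
have [v [vs [Eb szv fv]]] := tuple_words b.
have c2 := filtration_complexity2 Eb fb.
have wfu := full_rows_wf fu; have wfv := full_rows_wf fv.
have [uu mu] := full_head fu; have [uv mv] := full_head fv.
rewrite /BE_gen_comp BE_operation_sum; apply: cochain_eqP => t.
rewrite cochain_sumE cochain_scaleE.
pose Fn n : seq A -> A := tilde (x`_n : cochains A).
pose F (y : ('I_r + 'I_s)%type) := Fn (comp_label k y).
have lF y : multilinear (F y) by apply: tilde_multilinear.
have nF y : normalized (F y) by apply: tilde_normalized.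
pose K (rows : seq (seq ('I_r + 'I_s)%type)) :=
  run_rows ltn [seq map (@comp_label r s k) w | w <- rows] Fn (1 :: t).
rewrite (reindex (@path_set (d + e))); last exact: onW_bij (@path_set_bij _).
transitivity (\sum_(p : (d + e).-tuple bool | count id p == size us)
     (-1) ^+ step_inv p *: K (path_rows k p u us v vs)).
  apply: eq_big => [p|p]; first by rewrite path_set_card szu.
  rewrite path_set_card => /eqP cp.
  rewrite path_inv_steps cochain_scaleE BE_operation_gen; congr (_ *: _).
  rewrite [LHS]/= /theta_fun /K -(@path_words _ _ _ _ k _ _ p _ _ _ _ Ea Eb cp).
  have [w [ws [Ew _ _]]] := tuple_words [tuple perm_comp k (tnth a (inord (path_x (path_set p) t0)))
     (tnth b (inord (path_y (path_set p) t0))) | t0 < (d + e).+1].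
  rewrite (map_comp (map val) (@word _)) Ew /run_rows map_cons.
  by apply: run_nat_labels => l h t'; rewrite /Fn /inputs (tnth_nth 0).
rewrite sum_path_rows ?szu ?szv //.
transitivity (shuffle_run (@ord_lt r) (@ord_lt s) k u us v vs (subst k u v) F (1 :: t)).
  rewrite /shuffle_run big_seq [RHS]big_seq; apply: eq_bigr => p pS; congr (_ *: _).
  rewrite /K map_cons /run_rows.
  apply: (@run_relabel _ _ _ _ _ _ _ (@proper_label r s k)) => //.
  - exact: comp_label_inj.
  - exact: comp_label_lt.
  - by move=> [l|j]; rewrite // mem_subst_inl => /andP[].
  - move=> w wp; have [u' [v' [_ _ ->]]] := shuffles_subst fu fv pS wp.
    by move=> [l|j]; rewrite // mem_subst_inl => /andP[].
rewrite -(@shuffle_runE _ _ _ _ _ _ _ _ us vs u v); first last.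
- exact: nF.
- exact: lF.
- by apply/all_filterP/allP.
- by apply/all_filterP/allP.
- exact: mu.
- by [].
- by [].
- exact: fv.
- exact: fu.
- by move=> l lk; apply: ord_lt_total; rewrite eq_sym.
set y := comp_inputs k x (theta b).
have yk : inputs y k = run (@ord_lt s) vs v (fun j => F (inr j)).
  apply: funext => -[|h t']; first by rewrite /inputs /= run_nil.
  rewrite /inputs /y tnth_mktuple ltnn eqxx /= /theta_fun Eb /run_rows.
  rewrite -[h in RHS]mulr1 ((run_fresh _ vs v (1 :: t')).1 _ h 1 t') //; last first.
    by move=> l _; apply: fresh_tilde.
  by congr (_ * _); apply: run_ext => l h' s' _; rewrite /inputs tnth_mktuple.
pose c (l : 'I_r) : R := if (l < k)%N then (-1) ^+ (e * absz m`_l) else 1.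
rewrite thetaE Ea /run_rows.
rewrite (@run_scale_all _ _ _ _ c _ _ (inputs y)) //; first last.
- move=> l h t' _; rewrite /nest /c; case: (eqVneq l k) => [->|lk].
    by rewrite ltnn scale1r yk.
  rewrite /inputs /y tnth_mktuple (negPf lk) /ord_lt; case: (ltnP l k) => lk'.
    have -> : F (inl l) = tilde (x`_l : cochains A).
      by rewrite /F /Fn /= ltnNge (ltnW lk').
    have pl := @homogeneous_nth _ _ _ l hx.
    by rewrite szv (twn_parity _ _ _ pl).
  rewrite scale1r /F /Fn /= ifT // ltn_neqAle lk' andbT.
  by rewrite eq_sym.
- exact: inputs_multilinear.
congr (_ *: _); rewrite /c -big_mkcond -expr_sum; congr (_ ^+ _).
rewrite -big_distrr /=; congr (_ * _)%N; rewrite big_full // /deg_before.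
have kN : (k <= (r + s).-1)%N by have := ltn_ord k; lia.
have kr : (k <= r)%N by apply: ltnW.
rewrite -(big_ord_widen _ (fun i => absz m`_i) kr) (big_ord_widen _ (fun i => absz m`_i) kN).
by apply: eq_bigr => i _; rewrite (tnth_nth 0).
Qed.

Lemma comp_inputs_set r s (k : 'I_r) (x : (r + s).-1.-tuple (cochains A)) y :
  comp_inputs k x y =
  set_tnth (comp_inputs k x (fun _ => 0)) k (y [tuple x`_(k + j) | j < s]).
Proof.
apply: eq_from_tnth => i; rewrite !tnth_mktuple.
by case: (eqVneq i k) => // ->; rewrite ltnn.
Qed.

Theorem BE_operation_comp r s d e (k : 'I_r) (u : BE R r d) (v : BE R s e)
    (m : (r + s).-1.-tuple int) (x : (r + s).-1.-tuple (cochains A)) :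
  BE_filtration 2 v -> homogeneous (@cochain_deg R A) m x ->
  BE_operation (BE_comp k u v) x =
  (-1) ^+ (e * deg_before m k) *: BE_operation u (comp_inputs k x (BE_operation v)).
Proof.
move=> fv hx; rewrite /BE_comp.
have E (a : simplex r d) : BE_operation
    (\sum_(b : simplex s e) ((u a : R) * (v b : R)) *: BE_gen_comp R k (val a) (val b)) x =
  (-1) ^+ (e * deg_before m k) *:
    ((u a : R) *: theta (val a) (comp_inputs k x (BE_operation v))).
  rewrite BE_operation_sum [in RHS]comp_inputs_set [BE_operation v _]/BE_operation.
  rewrite theta_multilinear !scaler_sumr; apply: eq_bigr => b _.
  have [->|nz] := eqVneq (v b) 0; first by rewrite mulr0 !scale0r !scaler0.
  rewrite (theta_comp _ _ (fv b nz) hx) comp_inputs_set.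
  by rewrite !scalerA; congr (_ *: _); rewrite [LHS]mulrC mulrA.
rewrite [in RHS]/BE_operation scaler_sumr -(eq_bigr _ (fun a _ => E a)).
have sumE (f : simplex r d -> BE R (r + s).-1 (d + e)) :
    BE_operation (\sum_a f a) x = \sum_a BE_operation (f a) x.
  rewrite -(eq_bigr _ (fun a _ => scale1r (f a))) (BE_operation_sum x predT (fun=> 1)).
  by apply: eq_bigr => a _; rewrite scale1r.
exact: sumE.
Qed.

End OperadicComposition.

(** * The cup product *)

Section Argument.

Variables (R : comPzRingType) (A : algType R) (T : eqType) (lt : rel T).
Implicit Types (F G : T -> seq A -> A) (f g : seq A -> A).

Definition has_arity (n : nat) f := forall h t, size t != n -> f (h :: t) = 0.

Lemma has_arity_push n f h : has_arity n.+1 f -> has_arity n (push h f).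
Proof. by move=> af a t szt; rewrite /push af. Qed.

(** The first unfinished label of the next word being j again, interrupting j
would put 1 into it. So j takes all its inputs in a row. *)
Lemma run_argument (p : T -> nat) ws j L F n f h s : wf ws (j :: L) ->
  (forall w ws', ws = w :: ws' -> exists L', pending (j :: L) w = j :: L') ->
  (forall l, multilinear (F l)) -> (forall l, has_parity (p l) (F l)) ->
  multilinear f -> normalized f -> has_arity n f ->
  run lt ws (j :: L) (upd j f F) (h :: s) =
  if (n <= size s)%N then
    (-1) ^+ (n * \sum_(l <- L | lt j l) p l) *:
      run lt ws L F (f (h :: take n s) :: drop n s)
  else 0.
Proof.
move=> wfL actw lF pF; have /= /andP[jL uL] := wfL.1.
have Lout G t : (forall l, l != j -> G l = F l) -> run lt ws L G t = run lt ws L F t.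
  by move=> E; apply: (@run_out _ _ _ _ j).
have updE g : upd j g F j = g by rewrite /upd eqxx.
elim: n f h s => [|n IHn] f h s lf nf af.
  rewrite run_exhausted => [|//||a t]; [|exact: upd_multilinear|by rewrite updE af].
  by rewrite updE mul0n scale1r take0 drop0; apply: Lout => l /negPf lj; rewrite /upd lj.
have lf' := multilinear_push h lf.
have lF' : forall l, multilinear (fill lt j (push h f) (upd j f F) l).
  by apply: fill_multilinear => //; apply: upd_multilinear.
rewrite run_cons updE.
have -> : run lt ws L (upd j f F) (f [:: h] :: s) = 0.
  by rewrite af // run_hot0 //; [apply: wf_tail wfL|apply: upd_multilinear].
have -> : next_row lt ws (j :: L) (fill lt j (push h f) (upd j f F)) s = 0.
  rewrite /next_row; case: ws wfL actw {IHn Lout} => // w ws wfL actw.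
  have [L' EL'] := actw w ws erefl; have := wf_row wfL; rewrite EL' => wfL'.
  rewrite run_hot_zero ?scaler0 // => t; rewrite fill_same.
  by have := nf [:: h] t; apply.
have -> : fill lt j (push h f) (upd j f F) = fill lt j (push h f) F by rewrite fill_upd.
rewrite !addr0 (@run_fill_parity _ _ _ _ _ p) //.
case: s => [|a s]; first by rewrite run_nil scaler0.
rewrite IHn //; last 2 first.
- exact: normalized_push.
- exact: has_arity_push.
rewrite /= ltnS; case: ifP => // _; last by rewrite scaler0.
rewrite scalerA -exprD big_cons eqxx /=; congr (_ ^+ _ *: _).
rewrite mulSn; congr (_ + _)%N; rewrite big_seq_cond [RHS]big_seq_cond.
apply: eq_bigl => l; case lL: (l \in L) => //=; rewrite (_ : l != j) //.
by apply: contraTneq lL => ->.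
Qed.

End Argument.

Section Cup.

Variables (R : comPzRingType) (A : algType R).

Lemma tilde_arity (x : cochains A) (n : nat) : cochain_deg n%:Z x -> has_arity n (tilde x).
Proof. by move=> dx h t szt; rewrite /= dx ?mulr0. Qed.

(** No second word: the first cochain reads p arguments, the second one the other
q. *)
Lemma theta_cup (p q : nat) (x y : cochains A) :
  cochain_deg p%:Z x -> cochain_deg q%:Z y ->
  theta [tuple (1%g : 'S_2)] [tuple x; y] =1 cup p q x y.
Proof.
move=> dx dy s; rewrite /cup; case: (size s =P (p + q)%N) => [sz|/eqP sz]; last first.
  rewrite -BE_operation_gen (@BE_operation_degree _ _ _ _ _ [tuple p%:Z; q%:Z]) //.
    by case=> -[|[|//]] i2; rewrite !(tnth_nth 0).
  by rewrite !big_ord_recl big_ord0 !(tnth_nth 0) /= addr0 subr0 -PoszD eqz_nat.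
have -> : theta [tuple (1%g : 'S_2)] [tuple x; y] s =
    run (@ord_lt 2) [::] [:: ord0; lift ord0 ord0] (inputs [tuple x; y]) (1 :: s).
  have E2 : enum 'I_2 = [:: ord0; lift ord0 ord0].
    by rewrite !enum_ordSl (size0nil (size_enum_ord 0)).
  have Ew : [seq word v | v <- [tuple (1%g : 'S_2)]] = [:: [:: ord0; lift ord0 ord0]].
    by rewrite /= /word E2 /= !perm1.
  by rewrite thetaE Ew.
set F := inputs _; have -> : F = upd ord0 (F ord0) F.
  by apply: funext => l; rewrite /upd; case: eqP => // ->.
have F0 : F ord0 = tilde x by rewrite /F /inputs (tnth_nth 0).
have F1 : F (lift ord0 ord0) = tilde y by rewrite /F /inputs (tnth_nth 0).
rewrite (@run_argument _ _ _ _ (fun l => if l == ord0 then p else q) _ _ _ _ p).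
- rewrite sz leq_addr run_single F0 F1 big_cons big_nil /= addn0.
  by rewrite !mul1r.
- by split.
- by [].
- exact: inputs_multilinear.
- case=> -[|[|//]] i2; rewrite /F /inputs (tnth_nth 0) /=.
    exact: (@tilde_parity _ _ _ p%:Z).
  exact: (@tilde_parity _ _ _ q%:Z).
- exact: inputs_multilinear.
- exact: inputs_normalized.
- by rewrite F0; apply: tilde_arity.
Qed.

End Cup.

(** * Runs of the brace simplex *)

Section MaskBrace.

Variables (R : comPzRingType) (A : algType R).
Variables (g : nat -> seq A -> A) (l : nat -> nat).

(** The contribution of one choice [b] for the inputs of f: false for an argument
of the brace, true for the value of the next g. J is the index of that g, and m
the number of g that are left. *)
Fixpoint mask_value (b : seq bool) (f : seq A -> A) (J m : nat) (h : A) (s : seq A) : A :=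
  match b with
  | [::] => if (m == 0%N) && nilp s then f [:: h] else 0
  | false :: b' => if s is a :: s' then mask_value b' (push h f) J m a s' else 0
  | true :: b' =>
    if (0 < m)%N && (l J <= size s)%N then
      mask_value b' (push h f) J.+1 m.-1 (g J (take (l J) s)) (drop (l J) s)
    else 0
  end.

(** The sign of that choice along the run: each input of f, and each argument of
g_J, passes the g that are left. At a row step the parity of the number of
arguments left is expressed through the arities. *)
Fixpoint mask_exp (b : seq bool) (J m : nat) : nat :=
  match b with
  | [::] => 0%N
  | false :: b' => (\sum_(j <- iota J m) l j + mask_exp b' J m)%N
  | true :: b' => (m.-1 + (size b').+1 + l J * (\sum_(j <- iota J.+1 m.-1) l j) +
                   mask_exp b' J.+1 m.-1)%N
  end.

Definition mask_sum n f J m h s : A :=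
  \sum_(b : n.-tuple bool | count id b == m) (-1) ^+ mask_exp b J m *: mask_value b f J m h s.

(** A word of the brace simplex without its finished labels: 0 stands for f and
j.+1 for the j-th g. *)
Definition brace_row J m i : seq nat := iota J i ++ 0%N :: iota (J + i) (m - i).

Variable G : nat -> seq A -> A.
Hypothesis lG : forall i, multilinear (G i).
Hypothesis nG : forall i, normalized (G i).
Hypothesis aG : forall j, has_arity (l j) (G j.+1).
Hypothesis GE : forall j s, G j.+1 (1 :: s) = g j s.
Hypothesis pG : forall j, has_parity (l j) (G j.+1).

Let p n (i : nat) : nat := if i is j.+1 then l j else n.

Lemma has_arity_parity n (f : seq A -> A) : has_arity n f -> has_parity n f.
Proof.
by move=> af h t nz; congr odd; apply/eqP; apply: contraNT nz => /af ->.
Qed.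

Lemma upd0_parity n (f : seq A -> A) i : has_arity n f -> has_parity (p n i) (upd 0%N f G i).
Proof.
by move=> af; case: i => [|i]; rewrite /upd /=; [apply: has_arity_parity|apply: pG].
Qed.

Lemma sum_iotaS n J m : (\sum_(i <- iota J.+1 m) p n i = \sum_(j <- iota J m) l j)%N.
Proof. by rewrite (iotaDl 1 J) big_map. Qed.

Lemma uniq_brace_labels J m : uniq (0%N :: iota J.+1 m).
Proof. by rewrite /= mem_iota iota_uniq andbT ltn0. Qed.

Lemma pending_brace_row J m i : (i <= m)%N ->
  pending (0%N :: iota J.+2 m) (brace_row J.+1 m.+1 i.+1) = brace_row J.+2 m i.
Proof.
move=> im; rewrite /pending /brace_row filter_cat /= ifF; last first.
  by rewrite inE mem_iota; lia.
rewrite subSS (_ : (J.+1 + i.+1 = J.+2 + i)%N); last by lia.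
by congr (_ ++ _ :: _); apply/all_filterP/allP => x; rewrite !inE !mem_iota; lia.
Qed.

Lemma pending_brace_row0 J m i : (i <= m)%N ->
  pending (iota J.+1 m) (brace_row J.+1 m i) = iota J.+1 m.
Proof.
move=> im; rewrite /pending /brace_row filter_cat /= ifF; last first.
  by rewrite mem_iota ltn0.
by rewrite -filter_cat -iotaD subnKC //; apply/all_filterP/allP.
Qed.

(** f is active whenever it needs an input. If it takes the hot value without a
row step, that input is the next argument of the brace; after a row step the
next g comes first, is evaluated in one go by [run_argument], and its value is
taken by f. After n inputs f can only finish, and words left over then repeat
each other on the unfinished labels. *)
Lemma run_brace n (f : seq A -> A) J m ws h s :
  multilinear f -> normalized f -> has_arity n f ->
  wf ws (0%N :: iota J.+1 m) ->
  [seq pending (0%N :: iota J.+1 m) w | w <- ws] =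
    [seq brace_row J.+1 m i.+1 | i <- iota 0 m] ->
  (size s + m = n + \sum_(j <- iota J m) l j)%N ->
  run ltn ws (0%N :: iota J.+1 m) (upd 0%N f G) (h :: s) = mask_sum n f J m h s.
Proof.
elim: n f J m ws h s => [|n IHn] f J m ws h s lf nf af wfL Ews sz.
  have lF : forall i, multilinear (upd 0%N f G i) by apply: upd_multilinear.
  have f0 : upd 0%N f G 0%N = f by [].
  rewrite run_exhausted ?f0 // => [|a t]; last exact: af.
  rewrite /mask_sum big_mkcond (big_pred1 [tuple]); last first.
    by move=> b; apply/esym/eqP; apply: val_inj; case: b => -[].
  have wfL0 := wf_tail wfL.
  case: m Ews wfL wfL0 sz => [|m] Ews wfL wfL0 sz.
    case: ws Ews {wfL wfL0} => // _; rewrite run_end /= scale1r.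
    by case: nilP.
  rewrite /=; case: ws Ews wfL wfL0 => // w ws [Ew _] wfL wfL0.
  apply: (@run_stutter _ _ _ _ (iota J.+1 m.+1) (w :: ws) [::] (iota J.+1 m.+1) w ws) => //.
  - exact: iota_uniq.
  - by apply/all_filterP/allP.
  - have -> : pending (iota J.+1 m.+1) w = pending (iota J.+1 m.+1) (pending (0%N :: iota J.+1 m.+1) w).
      by rewrite pending_pending2 // => x xi; rewrite inE xi orbT.
    by rewrite Ew pending_brace_row0 //; apply/all_filterP/allP.
  - by move=> i; rewrite /upd; case: eqP.
have lf' := multilinear_push h lf.
have nf' : normalized (push h f) by apply: normalized_push.
have af' : has_arity n (push h f) by apply: has_arity_push.
have lF f1 : multilinear f1 -> forall i, multilinear (upd 0%N f1 G i).
  by move=> lf1 i; apply: upd_multilinear.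
have f0 : upd 0%N f G 0%N = f by [].
have fill0 ws' L t : wf ws' L -> perm_eq L (0%N :: iota J.+1 m) ->
    run ltn ws' L (fill ltn 0%N (push h f) (upd 0%N f G)) t =
    (-1) ^+ (\sum_(j <- iota J m) l j) *: run ltn ws' L (upd 0%N (push h f) G) t.
  move=> wf' pL; rewrite (@run_fill_parity _ _ _ _ _ (p n.+1)) //; first last.
  - by move=> i; apply: upd0_parity.
  - exact: lF.
  have -> : upd 0%N (push h f) (upd 0%N f G) = upd 0%N (push h f) G.
    by apply: funext => i; rewrite /upd; case: eqP.
  congr (_ ^+ _ *: _); rewrite (perm_big _ pL) big_cons /= -(sum_iotaS n.+1).
  rewrite big_seq_cond [RHS]big_seq.
  by apply: eq_bigl => i; rewrite mem_iota /=; lia.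
rewrite run_cons f0 fill0 //.
have -> : run ltn ws (iota J.+1 m) (upd 0%N f G) (f [:: h] :: s) = 0.
  by rewrite af // run_hot0 //; [apply: wf_tail wfL|apply: lF].
rewrite addr0 /mask_sum [RHS]big_mkcond [RHS]big_tuple_cons -![in RHS]big_mkcond /= [LHS]addrC; congr (_ + _).
  rewrite /next_row; case: m ws Ews wfL sz fill0 => [|m] [|w ws] // Ews wfL sz fill0.
    by rewrite big1 // => b /eqP.
  have [EL Ews'] : pending (0%N :: iota J.+1 m.+1) w = brace_row J.+1 m.+1 1 /\
      [seq pending (0%N :: iota J.+1 m.+1) w | w <- ws] =
      [seq brace_row J.+1 m.+1 i.+2 | i <- iota 0 m].
    have Eh := congr1 (head [::]) Ews; have Eb := congr1 behead Ews.
    by split=> //; rewrite [LHS]Eb /= (iotaDl 1 0) -map_comp.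
  have wfw := wf_row wfL; have mL := mem_row wfL.
  rewrite /next_row fill0 //; last first.
    by apply: uniq_perm => //; [exact: wfw.1|exact: uniq_brace_labels].
  have EL2 : pending (0%N :: iota J.+1 m.+1) w = [:: J.+1, 0%N & iota J.+2 m].
    by rewrite EL /brace_row /= addn1 subn1.
  rewrite EL2 in wfw mL *.
  have -> : upd 0%N (push h f) G = upd J.+1 (G J.+1) (upd 0%N (push h f) G).
    by apply: funext => i; rewrite /upd; case: (i =P J.+1) => // ->.
  rewrite (@run_argument _ _ _ _ (p n) _ _ _ _ (l J)) //; first last.
  - by move=> i; apply: upd0_parity.
  - exact: lF.
  - move=> w' ws' E; move: Ews'; rewrite E.
    case: (m) => [|m'] //= [Ew' _]; exists (J.+2 :: 0%N :: iota J.+3 m').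
    rewrite (@eq_pending _ _ (0%N :: iota J.+1 m'.+2)) => [|x _]; last first.
      by rewrite !inE !mem_iota; lia.
    by rewrite Ew' /brace_row /= addn2 subSS subn1.
  have Esum : (\sum_(i <- 0%N :: iota J.+2 m | ltn J.+1 i) p n i = \sum_(j <- iota J.+1 m) l j)%N.
    rewrite big_cons /= -(sum_iotaS n) big_seq_cond [RHS]big_seq.
    by apply: eq_bigl => i; rewrite mem_iota; lia.
  rewrite Esum GE; case: ifP => [le_l|_]; last first.
    by rewrite !scaler0 big1 // => b _; rewrite scaler0.
  have Sl : (\sum_(j <- iota J m.+1) l j = l J + \sum_(j <- iota J.+1 m) l j)%N.
    by rewrite /= big_cons.
  rewrite IHn //; first last.
  - by rewrite size_drop; move: sz; rewrite Sl; lia.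
  - have sub : {subset 0%N :: iota J.+2 m <= 0%N :: iota J.+1 m.+1}.
      by move=> x; rewrite !inE !mem_iota; lia.
    rewrite -(eq_map (fun w => pending_pending2 w sub)).
    rewrite map_comp Ews' -map_comp; apply/eq_in_map => i; rewrite mem_iota => im.
    by rewrite [LHS]/comp pending_brace_row.
  - exact: wf_tail wfw.
  rewrite /mask_sum !scaler_sumr; apply: eq_big => [b|b cb]; first by rewrite add1n eqSS.
  rewrite !scalerA -!exprD size_tuple; congr (_ *: _).
  apply: signr_parity.
  have : odd ((size s).+1 + \sum_(j <- iota J m.+1) l j + (m + n.+1)) = false.
    rewrite (_ : _ + _ = (n.+1 + \sum_(j <- iota J m.+1) l j).*2)%N ?odd_double //.
    by move: sz; lia.
  by rewrite !oddD; do 6!case: (odd _).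
case: s sz => [|a s] sz.
  rewrite run_nil scaler0 big1 // => b _; by rewrite scaler0.
rewrite IHn //; last by move: sz; rewrite addSn addSn => -[].
rewrite /mask_sum scaler_sumr; apply: eq_bigr => b _.
by rewrite scalerA -exprD.
Qed.

End MaskBrace.

(** * Insertions as masks *)

Section MaskSizes.

Variables (R : comPzRingType) (A : algType R).
Variables (g : nat -> seq A -> A) (l : nat -> nat).

Fixpoint mask_sizes (b : seq bool) (J : nat) : seq nat :=
  if b is c :: b' then (if c then l J else 1%N) :: mask_sizes b' (c + J) else [::].

Definition mask_args (b : seq bool) (J : nat) (s : seq A) : seq A :=
  [seq let a := nth [::] (reshape (mask_sizes b J) s) i in
       if nth false b i then g (count id (take i b) + J)%N a else head 0 a
  | i <- iota 0 (size b)].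

Lemma mask_args_cons c b J s : mask_args (c :: b) J s =
  (if c then g J (take (l J) s) else head 0 (take 1 s)) ::
  mask_args b (c + J) (drop (if c then l J else 1%N) s).
Proof.
rewrite /mask_args [iota _ _]/= (iotaDl 1 0) map_cons -map_comp; congr (_ :: _).
  by case: c.
apply: eq_map => i /=.
by rewrite -addnA addnCA.
Qed.

Lemma sumn_mask_sizes b J :
  (sumn (mask_sizes b J) + count id b = size b + \sum_(j <- iota J (count id b)) l j)%N.
Proof.
elim: b J => [|c b IHb] J /=; first by rewrite big_nil.
case: c; rewrite /= ?add0n ?add1n /= ?big_cons ?addSn; last first.
  by have := IHb J; set X := sumn _; lia.
by have := IHb J.+1; lia.
Qed.

Lemma mask_value_args b f J h s : size s = sumn (mask_sizes b J) ->
  mask_value g l b f J (count id b) h s = f (h :: mask_args b J s).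
Proof.
elim: b f J h s => [|c b IHb] f J h s; first by move/size0nil->.
rewrite mask_args_cons; case: c => /= sz; last first.
  case: s sz => [|a s] //= [sz]; rewrite add0n IHb //.
  by rewrite /push drop0.
rewrite sz leq_addr /= IHb //.
by rewrite size_drop sz addKn.
Qed.

(** Getzler's exponent indexed by the filled inputs of f. *)
Definition mask_getzler b J : nat :=
  (\sum_(i < size b | nth false b i)
     (l (count id (take i b) + J)).+1 * sumn (take i (mask_sizes b J)))%N.

Lemma sum_mask_positions (F : nat -> nat) b J :
  (\sum_(i < size b | nth false b i) F (count id (take i b) + J) =
   \sum_(j <- iota J (count id b)) F j)%N.
Proof.
elim: b J => [|c b IHb] J /=; first by rewrite big_ord0 big_nil.
rewrite big_mkcond big_ord_recl /= -big_mkcond /=.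
case: c => /=; rewrite ?add0n ?add1n /= ?big_cons; last exact: IHb.
congr (_ + _)%N; rewrite -IHb; apply: eq_bigr => i _.
by rewrite /= add1n addSnnS.
Qed.

Lemma mask_getzler_cons c b J : mask_getzler (c :: b) J =
  ((if c then l J else 1%N) * (\sum_(j <- iota (c + J) (count id b)) (l j).+1) +
   mask_getzler b (c + J))%N.
Proof.
rewrite /mask_getzler /= big_mkcond big_ord_recl /= muln0 if_same add0n -big_mkcond /=.
rewrite -sum_mask_positions big_distrr -big_split /=; apply: eq_bigr => i _.
rewrite -addnA addnCA.
by rewrite mulnDr [(_ * (l _).+1)%N in RHS]mulnC.
Qed.

(** By recursion on the mask the exponents differ by terms that occur twice. *)
Lemma odd_mask_exp b J :
  odd (count id b * size b +
       \sum_(j < count id b) (count id b - j.+1) * l (j + J) + mask_getzler b J) =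
  odd (mask_exp l b J (count id b)).
Proof.
elim: b J => [|c b IHb] J /=; first by rewrite /mask_getzler !big_ord0.
rewrite mask_getzler_cons; case: c => /=; last first.
  rewrite !add0n [in RHS]oddD -IHb -oddD.
  set T := (\sum_(j < _) _)%N.
  have -> : (\sum_(j <- iota J (count id b)) (l j).+1 =
             count id b + \sum_(j <- iota J (count id b)) l j)%N.
    under eq_bigr do rewrite -add1n.
    by rewrite big_split /= sum1_size size_iota.
  set S := (\sum_(j <- _) _)%N.
  rewrite (_ : _ + _ = S + (count id b * size b + T + mask_getzler b J) + (count id b).*2)%N.
    by rewrite oddD odd_double addbF.
  by rewrite -addnn; lia.
rewrite !add1n /= big_ord_recl /= subn1 /=.
rewrite [in RHS]oddD -IHb -oddD.
have -> : (\sum_(i < count id b) ((count id b).+1 - (bump 0 i).+1) * l (bump 0 i + J) =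
    \sum_(j < count id b) (count id b - j.+1) * l (j + J.+1))%N.
  by apply: eq_bigr => i _; rewrite /bump /= add1n subSS addSnnS.
set T := (\sum_(j < _) _)%N.
have -> : (\sum_(j <- iota J.+1 (count id b)) (l j).+1 =
           count id b + \sum_(j <- iota J.+1 (count id b)) l j)%N.
  under eq_bigr do rewrite -add1n.
  by rewrite big_split /= sum1_size size_iota.
set S := (\sum_(j <- _) _)%N.
rewrite -oddS (_ : (_ + _).+1 = count id b + (size b).+1 + l J * S +
   (count id b * size b + T + mask_getzler b J.+1) + (count id b * l J).*2)%N.
  by rewrite oddD odd_double addbF add0n.
by rewrite -addnn !add0n -![(_ + _)%coq_nat]/(_ + _)%N; nia.
Qed.

End MaskSizes.

Section Increasing.

Variables (m n : nat).
Implicit Types h : {ffun 'I_m -> 'I_n}.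

(** An increasing map is determined by its image. *)
Definition mask_of h : n.-tuple bool := [tuple i \in codom h | i < n].

Lemma path_set_mask h : path_set (mask_of h) = [set h j | j : 'I_m].
Proof.
apply/setP => i; rewrite inE tnth_mktuple; apply/codomP/imsetP => [[j ->]|[j _ ->]].
  by exists j.
by exists j.
Qed.

Lemma increasing_lt h : increasing h -> forall i j : 'I_m, (h i < h j)%N = (i < j)%N.
Proof.
move=> /forallP inc i j; have inc' (a b : 'I_m) : (a < b)%N -> (h a < h b)%N.
  by move: (inc a) => /forallP/(_ b)/implyP.
case: (ltngtP i j) => [/inc' //|/inc' /ltnW|/val_inj ->]; last by rewrite ltnn.
by rewrite leqNgt => /negbTE.
Qed.

Lemma increasing_inj h : increasing h -> injective h.
Proof.
move=> inc i j E; apply/val_inj/eqP.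
case: (ltngtP (val i) (val j)) => //=; rewrite -(increasing_lt inc) E ltnn //.
Qed.

Lemma count_mask h : increasing h -> count id (mask_of h) = m.
Proof.
move=> inc; rewrite -path_set_card path_set_mask card_imset ?card_ord //.
exact: increasing_inj.
Qed.

Lemma rank_mask h (j : 'I_m) : increasing h -> count id (take (h j) (mask_of h)) = j.
Proof.
move=> inc; rewrite -path_x_count /path_x path_set_mask.
rewrite (_ : [set i in _ | _] = [set h j' | j' in [set j' : 'I_m | (j' < j)%N]]).
  rewrite card_imset ?cardsE; last exact: increasing_inj.
  rewrite -sum1_card -(big_ord_widen m (fun=> 1%N)) ?sum1_card ?card_ord //.
  exact: ltnW.
apply/setP => i; rewrite inE; apply/andP/imsetP => [[/imsetP[j' _ ->]]|[j' j'j ->]].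
  by rewrite increasing_lt // => j'j; exists j'; rewrite ?inE.
by rewrite increasing_lt //; move: j'j; rewrite inE => ->; split=> //; apply: imset_f.
Qed.

Lemma inserted_atP h i : increasing h ->
  if inserted_at h i is Some j then
    tnth (mask_of h) i /\ count id (take i (mask_of h)) = j
  else tnth (mask_of h) i = false.
Proof.
move=> inc; rewrite /inserted_at tnth_mktuple; case: pickP => [j /eqP <-|none].
  by rewrite rank_mask // codom_f.
by apply/negbTE/negP => /codomP[j E]; have := none j; rewrite E eqxx.
Qed.

Lemma mask_of_inj : {in [set h | increasing h] &, injective mask_of}.
Proof.
move=> h h'; rewrite !inE => inc inc' E; apply/ffunP => j.
have : h j \in codom h' by have := codom_f h j; rewrite -(tnth_mktuple (fun i => i \in codom h)) -/(mask_of h) E tnth_mktuple.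
case/codomP => j' Ej; rewrite Ej; congr (h' _); apply: val_inj => /=.
by rewrite -(rank_mask j' inc') -Ej -E rank_mask.
Qed.

Lemma mask_of_surj (b : n.-tuple bool) : count id b = m ->
  exists2 h, increasing h & mask_of h = b.
Proof.
move=> cb; have cS : m = #|path_set b| by rewrite path_set_card cb.
pose h := [ffun j : 'I_m => enum_val (cast_ord cS j)].
have enum_lt (i j : 'I_#|path_set b|) : (i < j)%N -> (enum_val i < enum_val j)%N.
  have srt : sorted ltn [seq val x | x <- enum (path_set b)].
    rewrite sorted_map /enum_mem -enumT sorted_filter //.
      by move=> x y z /=; apply: ltn_trans.
    by rewrite -sorted_map val_enum_ord iota_ltn_sorted.
  have nthE (k : 'I_#|path_set b|) :
      val (enum_val k) = nth 0%N [seq val x | x <- enum (path_set b)] k.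
    rewrite (enum_val_nth (enum_val i)) (nth_map (enum_val i)) //.
    by rewrite -cardE.
  move=> ij; rewrite !nthE; apply: (sorted_ltn_nth ltn_trans) => //.
    by rewrite inE size_map -cardE.
  by rewrite inE size_map -cardE.
exists h.
  apply/forallP => i; apply/forallP => j; apply/implyP => ij.
  by rewrite !ffunE enum_lt.
apply: (bij_inj (@path_set_bij n)); rewrite path_set_mask; apply/setP => i.
apply/imsetP/idP => [[j _ ->]|iS]; first by rewrite ffunE enum_valP.
exists (cast_ord (esym cS) (enum_rank_in iS i)) => //.
by rewrite ffunE cast_ordKV enum_rankK_in.
Qed.

End Increasing.

Lemma mask_sizesE l b J : mask_sizes l b J =
  [seq if nth false b i then l (count id (take i b) + J)%N else 1%N | i <- iota 0 (size b)].
Proof.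
elim: b J => [|c b IHb] J //=; rewrite IHb (iotaDl 1 0) -map_comp.
by congr (_ :: _); apply: eq_map => i /=; rewrite -addnA addnCA.
Qed.

Lemma map_enum_ord (T : Type) n (F : nat -> T) (F' : 'I_n -> T) :
  (forall i, F' i = F i) -> [seq F' i | i <- enum 'I_n] = [seq F i | i <- iota 0 n].
Proof. by move=> E; rewrite -val_enum_ord -map_comp; apply: eq_map. Qed.

Section BraceAsMaskSum.

Variables (R : comPzRingType) (A : algType R) (m n : nat).
Variables (lN : nat -> nat) (gN : nat -> seq A -> A).
Variables (l : 'I_m -> nat) (g : 'I_m -> seq A -> A).
Hypothesis lE : forall j : 'I_m, lN j = l j.
Hypothesis gE : forall j : 'I_m, gN j = g j.

Section OneMap.

Variable h : {ffun 'I_m -> 'I_n}.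
Hypothesis inc : increasing h.

Lemma input_sizes_mask : input_sizes l h = mask_sizes lN (mask_of h) 0.
Proof.
rewrite mask_sizesE size_tuple; apply: map_enum_ord => i.
rewrite -tnth_nth; have := inserted_atP i inc; case: inserted_at => [j [-> ->]|->] //=.
by rewrite addn0 lE.
Qed.

Lemma insertion_mask f s : size s = sumn (mask_sizes lN (mask_of h) 0) ->
  insertion l h f g s = f (mask_args gN lN (mask_of h) 0 s).
Proof.
move=> sz; rewrite /insertion input_sizes_mask sz eqxx; congr f.
rewrite /mask_args size_tuple; apply: map_enum_ord => i.
rewrite -tnth_nth; have := inserted_atP i inc; case: inserted_at => [j [-> ->]|->] //=.
by rewrite addn0 gE.
Qed.

Lemma getzler_exp_mask : getzler_exp l h = mask_getzler lN (mask_of h) 0.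
Proof.
rewrite /mask_getzler /getzler_exp input_sizes_mask.
set F := fun i : nat => ((lN (count id (take i (mask_of h)) + 0)).+1 *
                 sumn (take i (mask_sizes lN (mask_of h) 0)))%N.
rewrite -(big_mkord (fun i => nth false (mask_of h) i) F) size_tuple big_mkord.
rewrite (eq_bigl (fun i => i \in path_set (mask_of h))); last first.
  by move=> i; rewrite inE (tnth_nth false).
rewrite path_set_mask big_imset /=; last by move=> i j _ _; apply: increasing_inj.
by apply: eq_bigr => j _; rewrite /F rank_mask // addn0 lE.
Qed.

End OneMap.

Lemma brace_mask_sum f a s : (size s + m = n + \sum_(j <- iota 0 m) lN j)%N ->
  brace n l (fun t => f (a :: t)) g s = mask_sum gN lN n f 0 m a s.
Proof.
move=> sz; rewrite /brace scaler_sumr /mask_sum.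
rewrite [RHS](eq_bigl (fun b => b \in (@mask_of m n @: [set h | increasing h]))); last first.
  move=> b; apply/eqP/imsetP => [cb|[h + ->]]; last by rewrite inE => /count_mask.
  by have [h inc <-] := mask_of_surj cb; exists h; rewrite ?inE.
rewrite big_imset /=; last exact: mask_of_inj.
apply: eq_big => [h|h inc]; first by rewrite inE.
have cm := count_mask inc.
have szs : size s = sumn (mask_sizes lN (mask_of h) 0).
  have := sumn_mask_sizes lN (mask_of h) 0; rewrite cm size_tuple -sz => /eqP.
  by rewrite eqn_add2r => /eqP ->.
rewrite insertion_mask // scalerA -exprD.
have /= := @odd_mask_exp lN (mask_of h) 0.
have /= := mask_value_args gN f a szs.
rewrite cm size_tuple => -> E; congr (_ *: _).
apply: signr_parity.
rewrite getzler_exp_mask // -E /suspension_exp.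
congr odd; congr (_ + _ + _)%N; first by rewrite card_ord.
by apply: eq_bigr => j _; rewrite addn0 lE.
Qed.

Lemma brace_degree f s : (size s + m != n + \sum_(j <- iota 0 m) lN j)%N ->
  brace n l f g s = 0.
Proof.
move=> sz; rewrite /brace big1 ?scaler0 // => h inc.
rewrite /insertion input_sizes_mask // ifF ?scaler0 //.
apply: contraNF sz => /eqP ->.
by have := sumn_mask_sizes lN (mask_of h) 0; rewrite count_mask // size_tuple => ->.
Qed.

End BraceAsMaskSum.

Lemma brace_row_uniq J m i : (i <= m)%N -> (0 < J)%N -> uniq (brace_row J m i).
Proof.
move=> im J0; rewrite /brace_row -cat1s uniq_catCA -iotaD subnKC //=.
by rewrite iota_uniq andbT mem_iota leqNgt J0.
Qed.

Lemma mem_brace_row J m i : (i <= m)%N -> brace_row J m i =i 0%N :: iota J m.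
Proof.
move=> im x; rewrite -[in RHS](subnKC im) iotaD !inE !mem_cat inE.
by rewrite orbCA.
Qed.

Lemma brace_rows r :
  [seq map val w | w <- [seq word v | v <- brace_simplex r]] =
  [seq brace_row 1 r i | i <- iota 0 r.+1].
Proof.
transitivity [seq map val (word (tnth (brace_simplex r) i)) | i <- enum 'I_r.+1].
  have E : tval (brace_simplex r) = [seq tnth (brace_simplex r) i | i <- enum 'I_r.+1].
    by rewrite map_tnth_enum.
  by rewrite [in LHS]E; elim: (enum _) => //= i s ->.
by apply: map_enum_ord => i; apply: word_brace_simplex.
Qed.

Section HochschildAlgebra.

Variables (R : comPzRingType) (A : algType R).

(** The recursion of [run_brace] starts with J = 0. When the number of arguments
does not match the arities, both sides vanish. *)
Lemma theta_brace (r n : nat) (l : 'I_r -> nat) (x : cochains A) (y : 'I_r -> cochains A) :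
  cochain_deg n%:Z x -> (forall j, cochain_deg (l j)%:Z (y j)) ->
  theta (brace_simplex r) [tuple of x :: mktuple y] =1 brace n l x y.
Proof.
move=> dx dy s.
(* sequences over nat, as [run_brace] uses, extending l and y by 0 *)
pose lN j := oapp l 0%N (insub j).
pose yN j : cochains A := oapp y 0 (insub j).
have lE (j : 'I_r) : lN j = l j by rewrite /lN valK.
have yE (j : 'I_r) : yN j = y j by rewrite /yN valK.
have dyN j : cochain_deg (lN j)%:Z (yN j).
  by rewrite /lN /yN; case: insubP => [i _ _|_] //=; apply: dy.
have Sl : (\sum_(j <- iota 0 r) lN j = \sum_(j < r) l j)%N.
  rewrite -[r in iota 0 r]subn0 -/(index_iota 0 r) big_mkord.
  by apply: eq_bigr => j _.
have [sz|sz] := eqVneq (size s + r)%N (n + \sum_(j <- iota 0 r) lN j)%N; last first.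
  rewrite (brace_degree _ lE) // -BE_operation_gen.
  rewrite (@BE_operation_degree _ _ _ _ _ [tuple of n%:Z :: [tuple (l j)%:Z | j < r]]) //.
    by move=> i; case: (unliftP ord0 i) => [j ->|->]; rewrite ?tnthS ?tnth0 ?tnth_mktuple.
  rewrite big_ord_recl tnth0 (eq_bigr (fun j => (l j)%:Z)); last first.
    by move=> j _; rewrite tnthS tnth_mktuple.
  move: sz; rewrite -(big_morph Posz PoszD (erefl _)) Sl.
  by move: (\sum_(j < r) l j)%N => S; lia.
pose xN i : cochains A := if i is j.+1 then yN j else 0.
pose G i : seq A -> A := tilde (xN i).
have Efun : cochain_fun x = fun t => tilde x (1 :: t).
  by apply: funext => t; rewrite /tilde mul1r.
rewrite Efun (brace_mask_sum lE (gN := yN)) //; last by move=> j; rewrite yE.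
rewrite -(@run_brace _ _ yN lN G _ _ _ _ _ n (tilde x) 0 r
            [seq brace_row 1 r i.+1 | i <- iota 0 r]) //; first last.
- rewrite -map_comp; apply/eq_in_map => i; rewrite mem_iota => ir; rewrite [LHS]/comp.
  by rewrite /pending; apply/all_filterP/allP => j; rewrite mem_brace_row.
- split=> [|w /mapP[i]]; first exact: uniq_brace_labels.
  rewrite mem_iota => ir ->; split; first exact: brace_row_uniq.
  by move=> j; rewrite mem_brace_row.
- exact: tilde_arity.
- exact: tilde_normalized.
- exact: tilde_multilinear.
- by move=> j; apply: (@tilde_parity _ _ _ (lN j)%:Z).
- by move=> j t; rewrite /G /= mul1r.
- by move=> j; apply: tilde_arity.
- by move=> j; apply: (tilde_normalized (xN j)).
- by move=> j; apply: (tilde_multilinear (xN j)).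
have [u [us [Ew _ _]]] := tuple_words (brace_simplex r).
have Er := brace_rows r; rewrite Ew /= in Er.
have -> : theta (brace_simplex r) [tuple of x :: mktuple y] s =
    run (@ord_lt r.+1) us u (inputs [tuple of x :: mktuple y]) (1 :: s).
  by rewrite thetaE Ew.
rewrite (@run_nat_labels _ _ _ _ _ _ (upd 0%N (tilde x) G)).
  case: Er => -> ->; have -> : brace_row 1 r 0 = 0%N :: iota 1 r.
    by rewrite /brace_row subn0.
  by rewrite [X in map _ X](iotaDl 1 0) -map_comp.
move=> i h t; rewrite /inputs; case: (unliftP ord0 i) => [j ->|->].
  by rewrite tnthS tnth_mktuple /upd /G /= yE.
by rewrite tnth0.
Qed.

Definition hochschild_algebra :
    filtered_BE_algebra (@cochain_deg R A) (@hochschild_diff R A) 2.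
Proof.
apply: (@FilteredBEAlgebra _ _ _ _ 2 (fun r d u x => BE_operation u x)).
- by move=> r d c u v x _ _; apply: BE_operation_linear.
- by move=> r d u x i c y z _; apply: BE_operation_multilinear.
- by move=> r d u m x _; apply: BE_operation_degree.
- by move=> r d u m x; apply: BE_operation_diff.
- by move=> r d u s m x _; apply: BE_operation_act.
- by move=> x; apply: BE_operation_unit.
- by move=> r s d e k u v m x _; apply: BE_operation_comp.
Defined.

End HochschildAlgebra.

Theorem theorem1p6p7 (R : comPzRingType) (A : algType R) :
  exists theta : filtered_BE_algebra (@cochain_deg R A) (@hochschild_diff R A) 2,
    (forall (p q : nat) (x y : cochains A),
       cochain_deg p%:Z x -> cochain_deg q%:Z y ->
       theta 2 0%N (BE_gen R [tuple (1%g : 'S_2)]) [tuple x; y] =1 cup p q x y)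
    /\
    (forall (r n : nat) (l : 'I_r -> nat) (x : cochains A) (y : 'I_r -> cochains A),
       cochain_deg n%:Z x -> (forall j, cochain_deg (l j)%:Z (y j)) ->
       theta r.+1 r (BE_gen R (brace_simplex r)) [tuple of x :: mktuple y] =1
       brace n l x y).
Proof.
exists (hochschild_algebra A); split=> [p q x y dx dy s|r n l x y dx dy s] /=.
  by rewrite BE_operation_gen; apply: theta_cup.
by rewrite BE_operation_gen; apply: theta_brace.
Qed.
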